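(* Let $\mathcal{M}=(M,\nabla)$ be a non-flat Type $\mathcal{C}$ model, i.e. $M$ is a connected surface and $\nabla$ is the Levi-Civita connection of a (Riemannian or Lorentzian) metric of non-zero constant sectional curvature. Then one of the following holds: (1) $\mathcal{M}$ is locally affine isomorphic to $\mathcal{S}^2$, and in the corresponding local coordinates (on a connected coordinate domain) $E(-1,\nabla)=\operatorname{Span}\{\sin x^1,\ \cos x^1\cos x^2,\ \cos x^1\sin x^2\}$. (2) $\mathcal{M}$ is locally affine isomorphic to $\mathcal{H}^2_+$ or to $\mathcal{H}^2_-$, and in the corresponding local coordinates (on a connected coordinate domain) $E(-1,\nabla)=\operatorname{Span}\{e^{x^1},\ x^2e^{x^1},\ e^{-x^1}\pm(x^2)^2e^{x^1}\}$, with the sign $\pm$ that of $\mathcal{H}^2_\pm$. Furthermore, $E(0,\nabla)=\operatorname{Span}\{1\}$ and $E(\mu,\nabla)=\{0\}$ for any real $\mu\neq-1,0$.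
   Context: For a torsion free connection $\nabla$ on a surface, with $\nabla_{\partial_{x^i}}\partial_{x^j}=\Gamma_{ij}{}^k\partial_{x^k}$, put $R(X,Y)=[\nabla_X,\nabla_Y]-\nabla_{[X,Y]}$, $\rho(X,Y)=\operatorname{Tr}\{Z\mapsto R(Z,X)Y\}$, and let $\rho_s$ be the symmetrization of $\rho$. The Hessian is $\mathcal{H}f=(\partial_{x^i}\partial_{x^j}f-\Gamma_{ij}{}^k\partial_{x^k}f)\,dx^i\otimes dx^j$, and for $\mu\in\mathbb{R}$, $E(\mu,\nabla)=\{f\in C^\infty: \mathcal{H}f=\mu f\rho_s\}$. An affine isomorphism is a diffeomorphism intertwining the connections. Structures (in local coordinates $(x^1,x^2)$, symbols symmetric in lower indices, unlisted ones zero): $\mathcal{S}^2$ (on a domain with $|x^1|<\pi/2$): $\Gamma_{12}{}^2=-\tan x^1$, $\Gamma_{22}{}^1=\cos x^1\sin x^1$; this is the Levi-Civita connection of $dx^1\otimes dx^1+\cos^2x^1\,dx^2\otimes dx^2$. $\mathcal{H}^2_\pm$: $\Gamma_{12}{}^2=1$, $\Gamma_{22}{}^1=\mp e^{2x^1}$; this is the Levi-Civita connection of $\pm dx^1\otimes dx^1+e^{2x^1}dx^2\otimes dx^2$. *)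

(* Defs.v *)
From mathcomp Require Import all_boot all_order all_algebra.
From mathcomp Require Import all_classical all_reals all_analysis.

Set Implicit Arguments.
Unset Strict Implicit.
Unset Printing Implicit Defensive.

Import Order.TTheory GRing.Theory Num.Theory.
Import numFieldNormedType.Exports.

Local Open Scope classical_set_scope.
Local Open Scope ring_scope.

Notation plane R := 'rV[R]_2.

(* The coordinates (x^1, x^2) of x are (x 0 0, x 0 1): indices are shifted
   by one throughout. *)

Section PlaneCalculus.
Variable R : realType.

Definition pd (i : 'I_2) (f : plane R -> R) (x : plane R) : R :=
  'D_'e_i f x.

(* Cn n U f : f is of class C^n on U; meant for open U only. *)
Fixpoint Cn (n : nat) (U : set (plane R)) (f : plane R -> R) : Prop :=
  match n with
  | 0%N => forall x, U x -> {for x, continuous f}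
  | n'.+1 => (forall x, U x -> forall i, derivable f x 'e_i) /\
             (forall i, Cn n' U (pd i f))
  end.

Definition smooth (U : set (plane R)) (f : plane R -> R) : Prop :=
  forall n, Cn n U f.

Definition smooth_map (U : set (plane R)) (F : plane R -> plane R) : Prop :=
  forall i, smooth U (fun x => F x 0 i).

(* G i j k is the Christoffel symbol \Gamma_{ij}^k. *)
Definition christoffel := 'I_2 -> 'I_2 -> 'I_2 -> plane R -> R.

(* Vector fields on the plane, by components. *)
Definition vfield := 'I_2 -> plane R -> R.

Definition const_field (v : plane R) : vfield := fun k _ => v 0 k.

Definition coord_field (i : 'I_2) : vfield := const_field 'e_i.

Definition covariant (G : christoffel) (X Y : vfield) : vfield := fun k x =>
  \sum_(i < 2) X i x * pd i (Y k) x
  + \sum_(i < 2) \sum_(j < 2) X i x * Y j x * G i j k x.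

Definition lie_bracket (X Y : vfield) : vfield := fun k x =>
  \sum_(i < 2) (X i x * pd i (Y k) x - Y i x * pd i (X k) x).

(* R(X,Y)Z with R(X,Y) = [\nabla_X, \nabla_Y] - \nabla_{[X,Y]}. *)
Definition curvature (G : christoffel) (X Y Z : vfield) : vfield := fun k x =>
  covariant G X (covariant G Y Z) k x - covariant G Y (covariant G X Z) k x
  - covariant G (lie_bracket X Y) Z k x.

(* \rho(\partial_i, \partial_j) = Tr (Z |-> R(Z, \partial_i) \partial_j). *)
Definition ricci (G : christoffel) (i j : 'I_2) (x : plane R) : R :=
  \sum_(k < 2) curvature G (coord_field k) (coord_field i) (coord_field j) k x.

Definition ricci_sym (G : christoffel) (i j : 'I_2) (x : plane R) : R :=
  (ricci G i j x + ricci G j i x) / 2.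

Definition hessian (G : christoffel) (f : plane R -> R) (i j : 'I_2)
    (x : plane R) : R :=
  pd i (pd j f) x - \sum_(k < 2) G i j k x * pd k f x.

(* The map F intertwines the connections G and G' over U: the coordinate form
   of F_*(\nabla_X Y) = \nabla'_{F_* X} F_* Y for X, Y coordinate fields. *)
Definition intertwines (U : set (plane R)) (G G' : christoffel)
    (F : plane R -> plane R) : Prop :=
  forall x, U x -> forall i j c,
    \sum_(k < 2) G i j k x * pd k (fun y => F y 0 c) x =
    pd i (pd j (fun y => F y 0 c)) x +
    \sum_(a < 2) \sum_(b < 2) G' a b c (F x) *
      pd i (fun y => F y 0 a) x * pd j (fun y => F y 0 b) x.

(* Bilinear forms on tangent spaces, by components g_{ij}. *)
Definition bilin_field := 'I_2 -> 'I_2 -> plane R -> R.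

Definition bilin (g : bilin_field) (x u v : plane R) : R :=
  \sum_(i < 2) \sum_(j < 2) g i j x * u 0 i * v 0 j.

(* The curvature is tensorial, so extending the tangent vectors u, v by
   constant fields is harmless. *)
Definition sectional_curvature (g : bilin_field) (G : christoffel)
    (x u v : plane R) : R :=
  let Ruvv : plane R := \row_k
    curvature G (const_field u) (const_field v) (const_field v) k x in
  bilin g x Ruvv u /
  (bilin g x u u * bilin g x v v - bilin g x u v ^+ 2).

End PlaneCalculus.

(* chart_inv is the inverse of chart_map; outside of source (resp. of the target)
   the values of chart_map (resp. chart_inv) are irrelevant. *)
Record chart (R : realType) (M : topologicalType) := Chart {
  source : set M;
  chart_map : M -> plane R;
  chart_inv : plane R -> M;
  source_open : open source;
  target_open : open (chart_map @` source);
  chart_mapK : forall p, source p -> chart_inv (chart_map p) = p;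
  chart_map_continuous : forall p, source p -> {for p, continuous chart_map};
  chart_inv_continuous :
    forall x, (chart_map @` source) x -> {for x, continuous chart_inv} }.

Section Charts.
Variables (R : realType) (M : topologicalType).
Implicit Types phi psi : chart R M.

Definition overlap phi psi : set (plane R) :=
  chart_map phi @` (source phi `&` source psi).

Definition transition phi psi : plane R -> plane R :=
  fun x => chart_map psi (chart_inv phi x).

Definition compatible phi psi : Prop :=
  smooth_map (overlap phi psi) (transition phi psi) /\
  smooth_map (overlap psi phi) (transition psi phi).

End Charts.

Record surface (R : realType) := Surface {
  surface_space :> topologicalType;
  surface_hausdorff : hausdorff_space surface_space;
  surface_second_countable : @second_countable surface_space;
  atlas : set (chart R surface_space);
  atlas_cover : forall p, exists2 phi, atlas phi & source phi p;
  atlas_compatible :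
    forall phi psi, atlas phi -> atlas psi -> compatible phi psi }.

(* Only the symbols in the charts of the atlas are meaningful. *)
Record connection (R : realType) (M : surface R) := Connection {
  symbols :> chart R M -> christoffel R;
  symbols_smooth : forall phi, atlas phi ->
    forall i j k, smooth (chart_map phi @` source phi) (symbols phi i j k);
  symbols_torsion_free : forall phi, atlas phi ->
    forall x, (chart_map phi @` source phi) x ->
    forall i j k, symbols phi i j k x = symbols phi j i k x;
  symbols_transform : forall phi psi, atlas phi -> atlas psi ->
    intertwines (overlap phi psi) (symbols phi) (symbols psi)
      (transition phi psi) }.

Record sym2_tensor (R : realType) (M : surface R) := Sym2Tensor {
  entries :> chart R M -> bilin_field R;
  entries_smooth : forall phi, atlas phi ->
    forall i j, smooth (chart_map phi @` source phi) (entries phi i j);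
  entries_sym : forall phi, atlas phi ->
    forall x, (chart_map phi @` source phi) x ->
    forall i j, entries phi i j x = entries phi j i x;
  entries_transform : forall phi psi, atlas phi -> atlas psi ->
    forall x, overlap phi psi x -> forall i j,
    entries phi i j x =
    \sum_(a < 2) \sum_(b < 2) entries psi a b (transition phi psi x) *
      pd i (fun y => transition phi psi y 0 a) x *
      pd j (fun y => transition phi psi y 0 b) x }.

Section AffineSurfaces.
Variables (R : realType) (M : surface R).
Implicit Types (nabla : connection M) (g : sym2_tensor M).

Definition riemannian g : Prop :=
  forall phi, atlas phi -> forall x, (chart_map phi @` source phi) x ->
  forall v, v != 0 -> 0 < bilin (g phi) x v v.

(* Signature (1,1) at every point. *)
Definition lorentzian g : Prop :=
  forall phi, atlas phi -> forall x, (chart_map phi @` source phi) x ->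
  exists v w, [/\ bilin (g phi) x v w = 0, bilin (g phi) x v v < 0
                & 0 < bilin (g phi) x w w].

(* nabla g = 0; torsion-freeness is part of [connection]. *)
Definition levi_civita g nabla : Prop :=
  forall phi, atlas phi -> forall x, (chart_map phi @` source phi) x ->
  forall k i j, pd k (g phi i j) x =
    \sum_(l < 2) (nabla phi k i l x * g phi l j x +
                  nabla phi k j l x * g phi i l x).

(* The nonvanishing condition says that u, v span the tangent plane. *)
Definition constant_sectional_curvature g nabla (kappa : R) : Prop :=
  forall phi, atlas phi -> forall x, (chart_map phi @` source phi) x ->
  forall u v,
    bilin (g phi) x u u * bilin (g phi) x v v - bilin (g phi) x u v ^+ 2 != 0 ->
    sectional_curvature (g phi) (nabla phi) x u v = kappa.

Definition nonflat_typeC nabla : Prop :=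
  connected [set: M] /\
  exists (g : sym2_tensor M) (kappa : R),
    [/\ riemannian g \/ lorentzian g,
        levi_civita g nabla,
        constant_sectional_curvature g nabla kappa
      & kappa != 0].

Definition smooth_function (W : set M) (f : M -> R) : Prop :=
  forall phi, atlas phi ->
    smooth (chart_map phi @` (source phi `&` W)) (f \o chart_inv phi).

(* E(mu, nabla) over the open set W, as a set of functions on M of which only
   the values on W matter. *)
Definition E nabla (W : set M) (mu : R) : set (M -> R) :=
  [set f | smooth_function W f /\
    forall phi, atlas phi -> forall p, source phi p -> W p -> forall i j,
      hessian (nabla phi) (f \o chart_inv phi) i j (chart_map phi p) =
      mu * f p * ricci_sym (nabla phi) i j (chart_map phi p)].

Definition span_on (W : set M) (hs : seq (M -> R)) : set (M -> R) :=
  [set f | exists a : nat -> R, forall p, W p ->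
    f p = \sum_(i < size hs) a i * nth (fun=> 0) hs i p].

End AffineSurfaces.

Record plane_model (R : realType) := PlaneModel {
  model_domain : set (plane R);
  model_symbols : christoffel R }.

Section LocalIsomorphisms.
Variables (R : realType) (M : surface R).

(* An affine isomorphism of an open subset of M onto an open subset of a model
   is the same thing as a chart c in the maximal atlas, with values in the
   model, that intertwines the connections. *)
Definition affine_coordinates (nabla : connection M) (m : plane_model R)
    (c : chart R M) : Prop :=
  [/\ chart_map c @` source c `<=` model_domain m,
      forall phi, atlas phi -> compatible phi c
    & forall phi, atlas phi ->
        intertwines (overlap phi c) (nabla phi) (model_symbols m)
          (transition phi c)].

Definition locally_affine_isomorphic (nabla : connection M)
    (m : plane_model R) : Prop :=
  forall p : M, exists2 c, affine_coordinates nabla m c & source c p.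

End LocalIsomorphisms.

Section Models.
Variable R : realType.

Definition S2 : plane_model R := {|
  model_domain := [set x : plane R | `|x 0 0| < pi / 2];
  model_symbols := fun i j k x =>
    if (i != j) && (k == 1) then - tan (x 0 0)
    else if [&& i == 1, j == 1 & k == 0] then cos (x 0 0) * sin (x 0 0)
    else 0 |}.

(* H2 1 is H^2_+ and H2 (-1) is H^2_-. *)
Definition H2 (eps : R) : plane_model R := {|
  model_domain := setT;
  model_symbols := fun i j k x =>
    if (i != j) && (k == 1) then 1
    else if [&& i == 1, j == 1 & k == 0] then - eps * expR (2 * x 0 0)
    else 0 |}.

End Models.

(* Main.v *)
Require Import Defs.
From HB Require Import structures.
From mathcomp Require Import all_boot all_order all_algebra.
From mathcomp Require Import all_classical all_reals all_analysis.
From mathcomp Require Import ring lra.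

Set Implicit Arguments.
Unset Strict Implicit.
Unset Printing Implicit Defensive.

Import Order.TTheory GRing.Theory Num.Theory.
Import numFieldNormedType.Exports.

Local Open Scope classical_set_scope.
Local Open Scope ring_scope.

(** Let g be the metric, kappa its curvature and b = kappa g. Constant curvature
    means R(X,Y)Z = b(Y,Z)X - b(X,Z)Y, so the Ricci tensor is b, and b is
    parallel and non-degenerate. These facts ([curv_data]) are all that is used
    of g, and E(mu) is the space of solutions of Hess f = mu f b.

    The case mu = -1. The equation Hess f = - f b is a linear first order system
    for the jet (f, df), and the formula for R says exactly that this system is
    flat. By the theorem of Frobenius ([frobenius], which solves linear ODEs
    along one axis and then along the lines parallel to the other) there is near
    every point one solution with a prescribed jet ([hessian_solve]), and only one ([linear_unique]): locally
    E(-1) has dimension three.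

    Each model carries three functions Phi_0, Phi_1, Phi_2, those of the
    statement, which solve its equation and embed it into a quadric of R^3: the
    unit sphere, or a hyperboloid. To find affine coordinates at a point p of
    the surface, take solutions f_0, f_1, f_2 whose jets at p are those of the
    Phi_a at the origin, read in a frame where b has the normal form of the
    model. The matrix of products of jets of the f_a, minus the matrix of b,
    solves a homogeneous linear system and vanishes at p, so the f_a stay on the
    quadric ([quadric]). Hence f_a = Phi_a o F for a map F, which is found by
    inverting two of the Phi_a ([inverse_function]), and F intertwines the
    connections because the Phi_a have independent jets
    ([model_functions_intertwine], [local_coordinates]). The normal form of b
    decides on the model: b is positive definite for a Riemannian metric with
    kappa > 0, negative definite for a Riemannian metric with kappa < 0, and
    indefinite for a Lorentzian metric, whatever the sign of kappa.

    Conversely let F be affine coordinates into a model. The equality of third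
    derivatives gives an integrability condition for Hess f = f B
    ([integrability]). Applied to the Phi_a o F, it shows that F pulls the form
    of the model back to b ([pullback_metric]), so that the Phi_a o F are in
    E(-1). Every other element of E(-1) has at each point the jet of a
    combination of them, hence equals it nearby, with coefficients that are
    constant on a connected domain ([model_span]).

    The case mu <> -1. The integrability condition for B = mu b is
    (mu + 1)(b_1j d_0 f - b_0j d_1 f) = 0, which forces df = 0
    ([rigid_gradient]). So f is locally constant, and mu f b = 0. *)

(** * Points and norms of the plane *)

Section PlanePoints.
Variable R : realType.
Implicit Types (x y z p : plane R).

Lemma ord2P (P : 'I_2 -> Prop) : P 0 -> P 1 -> forall k, P k.
Proof.
move=> P0 P1 [[|[|//]] h].
  by rewrite (_ : Ordinal h = 0) //; apply/val_inj.
by rewrite (_ : Ordinal h = 1) //; apply/val_inj.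
Qed.

Lemma plane_eqP x y : x 0 0 = y 0 0 -> x 0 1 = y 0 1 -> x = y.
Proof. by move=> e0 e1; apply/rowP; apply: ord2P. Qed.

Lemma sum2E (V : nmodType) (F : 'I_2 -> V) : \sum_(i < 2) F i = F 0 + F 1.
Proof. by rewrite big_ord_recl big_ord1; congr (_ + F _); apply/val_inj. Qed.

Lemma plane_norm_le x e : 0 <= e ->
  (`|x| <= e) <-> (forall k, `|x 0 k| <= e).
Proof.
move=> e0; rewrite [in X in X <-> _]/Num.Def.normr/= mx_normrE; split=> [xe k|xe].
  by apply: le_trans xe; apply: (le_bigmax _ (fun i : 'I_1 * 'I_2 => `|x i.1 i.2|) (0, k)).
by apply: bigmax_le => // -[i k] _ /=; rewrite ord1.
Qed.

Lemma plane_norm_ge x k : `|x 0 k| <= `|x|.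
Proof. by have /plane_norm_le := lexx `|x|; apply. Qed.

Lemma plane_ballP p d x : ball p d x <-> forall k, `|p 0 k - x 0 k| < d.
Proof.
split=> [[_ h] k|h]; first by have := h 0 k; rewrite -ball_normE.
split; first exact: le_lt_trans (h 0).
by move=> i k; rewrite ord1 -ball_normE; exact: h.
Qed.

Definition mkpt (a b : R) : plane R := \row_(k < 2) (if k == 0 then a else b).

Lemma mkpt0 a b : mkpt a b 0 0 = a. Proof. by rewrite mxE. Qed.
Lemma mkpt1 a b : mkpt a b 0 1 = b. Proof. by rewrite mxE. Qed.

Lemma axisE (t : R) (i : 'I_2) x k :
  (t *: 'e_i + x) 0 k = t * (k == i)%:R + x 0 k.
Proof. by rewrite !mxE eqxx. Qed.

Lemma norm_axis (t : R) (i : 'I_2) : `|t *: 'e_i : plane R| = `|t|.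
Proof.
apply/eqP; rewrite eq_le; apply/andP; split.
  apply/plane_norm_le => // k; rewrite !mxE eqxx /=.
  by case: eqP; rewrite ?mulr1 ?mulr0 ?normr0.
have := plane_norm_ge (t *: 'e_i) i.
by rewrite !mxE !eqxx mulr1.
Qed.

End PlanePoints.

(** * Mean value theorems *)

Section MeanValue.
Variable R : realType.
Implicit Types (f g : plane R -> R) (x y z p : plane R).

(** The derivative as an affine approximation, a form in which estimates can be
    fed without dividing by the increment. *)
Lemma is_derive_eps (V : normedModType R) (f : V -> R) (x v : V) (c : R) :
  (forall e, 0 < e ->
    \forall h \near (0 : R), `|f (h *: v + x) - f x - h * c| <= e * `|h|) ->
  is_derive x v f c.
Proof.
move=> H.
have cv : h^-1 *: (f (h *: v + x) - f x) @[h --> 0^'] --> c.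
  apply/cvgrPdist_le => e e0.
  have He := H _ e0.
  near=> h.
  have h0 : h != 0 by near: h; exact: nbhs_dnbhs_neq.
  have hp : 0 < `|h| by rewrite normr_gt0.
  rewrite distrC -(ler_pM2l hp) -normrM mulrBr /GRing.scale /= mulVKf // [leRHS]mulrC.
  by near: h; apply: cvg_within.
split; first by apply/cvg_ex; exists c.
exact/cvg_lim.
Unshelve. all: by end_near. Qed.

Lemma mvt1 (g g' : R -> R) (a b : R) :
  (forall s, Num.min a b <= s <= Num.max a b -> is_derive s 1 g (g' s)) ->
  exists2 s, Num.min a b <= s <= Num.max a b & g b - g a = (b - a) * g' s.
Proof.
wlog ab : a b / a <= b => [W H|].
  case/orP: (le_total a b) => [/W/(_ H)//|ba].
  have [|s sI e] := W b a ba; first by rewrite minC maxC.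
  by exists s; [rewrite minC maxC|rewrite -opprB e -mulNr opprB].
rewrite (min_idPl ab) (max_idPr ab) => H.
have [s] : exists2 c, c \in `[a, b]%R & g b - g a = g' c * (b - a).
  apply: (MVT_segment ab) => [s|].
    by rewrite in_itv /= => /andP[/ltW h1 /ltW h2]; apply: H; rewrite h1.
  apply: derivable_within_continuous => s; rewrite in_itv /= => /H [].
  by [].
by rewrite in_itv /= => sI e; exists s => //; rewrite mulrC.
Qed.

(** Partial derivatives are derivatives of restrictions to lines parallel to the
    axes; this carries the one-variable theory over to the plane. *)
Lemma line_derive f (i : 'I_2) x (t : R) :
  derivable f (t *: 'e_i + x) 'e_i ->
  is_derive t 1 (fun s => f (s *: 'e_i + x)) (pd i f (t *: 'e_i + x)).
Proof.
move=> H.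
have E : (fun h : R => h^-1 *: (f ((h *: 1 + t) *: 'e_i + x) - f (t *: 'e_i + x))) =
  (fun h => h^-1 *: (f (h *: 'e_i + (t *: 'e_i + x)) - f (t *: 'e_i + x))).
  by apply/funext => h; rewrite scalerDl addrA /GRing.scale /= mulr1.
by split; [rewrite /derivable /= E|rewrite /pd /derive /= E].
Qed.

(** The closed rectangle with opposite corners x and y. Going from x to y along
    its sides uses partial derivatives only, and balls of the norm of the plane,
    which are squares, contain the rectangles spanned by their points. *)
Definition inrect x y z :=
  forall k, Num.min (x 0 k) (y 0 k) <= z 0 k <= Num.max (x 0 k) (y 0 k).

Lemma inrect_ball p d x y z : ball p d x -> ball p d y -> inrect x y z ->
  ball p d z.
Proof.
move=> /plane_ballP bx /plane_ballP by_ H; apply/plane_ballP => k.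
have := bx k; have := by_ k; have := H k; rewrite !ltr_norml.
by case: (leP (x 0 k) (y 0 k)) => _ /andP[? ?] /andP[? ?] /andP[? ?]; apply/andP; split; lra.
Qed.

Lemma inrect_dist x y z : inrect x y z -> `|z - x| <= `|y - x|.
Proof.
move=> H; apply/plane_norm_le => // k; apply: le_trans (plane_norm_ge _ k).
rewrite !mxE; have := H k; case: (leP (x 0 k) (y 0 k)) => h /andP[? ?].
  by rewrite !ger0_norm; lra.
by rewrite !ler0_norm; lra.
Qed.

Lemma mvt_axis f (i : 'I_2) x y : (forall k, k != i -> y 0 k = x 0 k) ->
  (forall z, inrect x y z -> derivable f z 'e_i) ->
  exists2 z, inrect x y z & f y - f x = (y 0 i - x 0 i) * pd i f z.
Proof.
move=> yx H; pose L s := (s - x 0 i) *: 'e_i + x.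
have Lr s : Num.min (x 0 i) (y 0 i) <= s <= Num.max (x 0 i) (y 0 i) ->
    inrect x y (L s).
  move=> h k; rewrite axisE; case: (eqVneq k i) => [->|/yx ->].
    by rewrite mulr1 subrK.
  by rewrite mulr0 add0r minxx maxxx lexx.
have Lx : L (x 0 i) = x by rewrite /L subrr scale0r add0r.
have Ly : L (y 0 i) = y.
  apply/rowP => k; rewrite axisE; case: (eqVneq k i) => [->|/yx ->].
    by rewrite mulr1 subrK.
  by rewrite mulr0 add0r.
have [s sI e] : exists2 s, Num.min (x 0 i) (y 0 i) <= s <= Num.max (x 0 i) (y 0 i)
   & (f \o L) (y 0 i) - (f \o L) (x 0 i) = (y 0 i - x 0 i) * pd i f (L s).
  apply: (@mvt1 _ (fun s => pd i f (L s))) => s sI.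
  pose x' := - x 0 i *: 'e_i + x.
  have LE u : L u = u *: 'e_i + x' by rewrite /L /x' scalerBl scaleNr addrA.
  have -> : f \o L = (fun s => f (s *: 'e_i + x')).
    by apply/funext => u /=; rewrite LE.
  rewrite LE; apply: line_derive; rewrite -LE; exact/H/Lr.
by exists (L s); [exact: Lr|move: e; rewrite /= Lx Ly].
Qed.

Lemma mvt2 f x y :
  (forall z, inrect x y z -> forall i, derivable f z 'e_i) ->
  exists z0 z1, [/\ inrect x y z0, inrect x y z1 &
    f y - f x = (y 0 0 - x 0 0) * pd 0 f z0 + (y 0 1 - x 0 1) * pd 1 f z1].
Proof.
move=> H; pose w := mkpt (y 0 0) (x 0 1).
have rw z : inrect x w z -> inrect x y z.
  move=> h k; have := h k; elim/ord2P: k; rewrite ?mkpt0 ?mkpt1 // minxx maxxx.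
  by case: (leP (x 0 1) (y 0 1)) => ? /andP[? ?]; apply/andP; split; lra.
have ry z : inrect w y z -> inrect x y z.
  move=> h k; have := h k; elim/ord2P: k; rewrite ?mkpt0 ?mkpt1 // minxx maxxx.
  by case: (leP (x 0 0) (y 0 0)) => ? /andP[? ?]; apply/andP; split; lra.
have [z0 z0r e0] : exists2 z, inrect x w z & f w - f x = (w 0 0 - x 0 0) * pd 0 f z.
  apply: mvt_axis => [|z /rw/H//]; apply: ord2P; rewrite ?mkpt1 //.
have [z1 z1r e1] : exists2 z, inrect w y z & f y - f w = (y 0 1 - w 0 1) * pd 1 f z.
  apply: mvt_axis => [|z /ry/H//]; apply: ord2P; rewrite ?mkpt0 //.
exists z0, z1; split; [exact: rw|exact: ry|].
by rewrite -(subrKA (f w)) addrC e0 e1 mkpt0 mkpt1 ?[f w - _]e0; ring.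
Qed.

End MeanValue.

(** * Rules for derivatives *)

Section DerivativeRules.
Variable R : realType.

Lemma isdD (V : normedModType R) (f g : V -> R) (x v : V) a b : is_derive x v f a ->
  is_derive x v g b -> is_derive x v (fun y => f y + g y) (a + b).
Proof. exact: is_deriveD. Qed.

Lemma isdN (V : normedModType R) (f : V -> R) (x v : V) a : is_derive x v f a ->
  is_derive x v (fun y => - f y) (- a).
Proof. exact: is_deriveN. Qed.

Lemma isdB (V : normedModType R) (f g : V -> R) (x v : V) a b : is_derive x v f a ->
  is_derive x v g b -> is_derive x v (fun y => f y - g y) (a - b).
Proof. by move=> df dg; apply: isdD => //; exact: isdN. Qed.

Lemma isdM (V : normedModType R) (f g : V -> R) (x v : V) a b : is_derive x v f a ->
  is_derive x v g b -> is_derive x v (fun y => f y * g y) (a * g x + f x * b).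
Proof.
move=> df dg; apply: (is_derive_eq (is_deriveM df dg)).
by rewrite addrC; congr (_ + _); exact: mulrC.
Qed.

Lemma isdC (V : normedModType R) (c : R) (x v : V) : is_derive x v (fun _ : V => c) 0.
Proof. exact: is_derive_cst. Qed.

Lemma isd_sum (V : normedModType R) (I : Type) (r : seq I) (F : I -> V -> R) (a : I -> R) (x v : V) :
  (forall i, is_derive x v (F i) (a i)) ->
  is_derive x v (fun y => \sum_(i <- r) F i y) (\sum_(i <- r) a i).
Proof.
move=> dF; elim: r => [|i r IH].
  rewrite big_nil (_ : (fun y => _) = fun=> 0); first exact: isdC.
  by apply/funext => y; rewrite big_nil.
rewrite big_cons (_ : (fun y => _) = fun y => F i y + \sum_(j <- r) F j y); first exact: isdD.
by apply/funext => y; rewrite big_cons.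
Qed.

End DerivativeRules.

(** * Continuous partial derivatives give differentiability *)

Section Differentiability.
Variable R : realType.
Implicit Types (f g : plane R -> R) (x y z p : plane R) (U : set (plane R)).

(** The differential is defined by choosing a linear map that approximates; it
    is enough to exhibit one. *)
Lemma differentiable_approx f x (df : {linear plane R -> R}) : continuous df ->
  (forall e, 0 < e -> \forall y \near x, `|f y - f x - df (y - x)| <= e * `|y - x|) ->
  differentiable f x.
Proof.
move=> cdf H; apply/diffP => /=.
apply: (@getPex _ (fun (df : {linear plane R -> R}) => continuous df /\
  forall y, f y = f (lim (nbhs x)) + df (y - lim (nbhs x))
                  +o_(y \near x) (y - lim (nbhs x)))).
have E : f = (cst (f x) + (df \o +%R^~ (- x))) +o_x (+%R^~ (- x)).
  apply/eqaddoP => e e0; apply: filterS (H e e0) => y.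
  by rewrite !fctE /= opprD addrA.
exists df; split=> //; apply: eqaddoEx; rewrite lim_id //.
exact: (fun y => congr1 (@^~ y) E).
Qed.

Definition lincomb2 (a b : R) (v : plane R) : R := v 0 0 * a + v 0 1 * b.

Lemma lincomb2_linear a b : linear (lincomb2 a b).
Proof. by move=> k u v; rewrite /lincomb2 !mxE /GRing.scale /=; ring. Qed.

HB.instance Definition _ a b :=
  GRing.isLinear.Build _ _ _ _ (lincomb2 a b) (lincomb2_linear a b).

Lemma continuous_lincomb2 a b : continuous (lincomb2 a b).
Proof.
move=> x; apply: (@continuousD _ _ _ (fun v : plane R => v 0 0 * a) (fun v : plane R => v 0 1 * b)).
  by apply: (@continuousM _ _ (fun v : plane R => v 0 0) (cst a)); [exact: coord_continuous|exact: cst_continuous].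
by apply: (@continuousM _ _ (fun v : plane R => v 0 1) (cst b)); [exact: coord_continuous|exact: cst_continuous].
Qed.

Lemma ord2_ind_near (P : 'I_2 -> plane R -> Prop) x :
  (forall i, \forall y \near x, P i y) -> \forall y \near x, forall i, P i y.
Proof.
move=> H; have H0 := H 0; have H1 := H 1; near=> y; apply: ord2P.
  by near: y.
by near: y.
Unshelve. all: by end_near. Qed.

Lemma open_ball U x : open U -> U x -> exists2 d, 0 < d & ball x d `<=` U.
Proof.
move=> oU Ux; have /nbhs_ballP[d d0 H] : nbhs x U by exact: open_nbhs_nbhs.
by exists d.
Qed.

Lemma norm_comb2_le (a b c d e1 e2 n : R) : `|a| <= n -> `|b| <= n ->
  `|c| <= e1 -> `|d| <= e2 -> `|a * c + b * d| <= (e1 + e2) * n.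
Proof.
move=> an bn ce de; apply: le_trans (ler_normD _ _) _; rewrite !normrM mulrDl.
by apply: lerD; rewrite mulrC ler_pM.
Qed.

Lemma near_dist_le f x e : {for x, continuous f} -> 0 < e ->
  \forall y \near x, `|f y - f x| <= e.
Proof.
by move=> /cvgrPdist_le cf /cf; apply: filterS => y; rewrite distrC.
Qed.

(** The increment of f is a combination of partial derivatives at points of the
    rectangle spanned by x and y ([mvt2]), which by continuity differ little from
    those at x. *)
Lemma C1_approx U f x e : open U -> Cn 1 U f -> U x -> 0 < e ->
  \forall y \near x,
    `|f y - f x - lincomb2 (pd 0 f x) (pd 1 f x) (y - x)| <= e * `|y - x|.
Proof.
move=> oU [df cf] Ux e0.
have e20 : 0 < e / 2 by rewrite divr_gt0.
have H : \forall y \near x, forall i, `|pd i f y - pd i f x| <= e / 2.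
  by apply: ord2_ind_near => i; apply: near_dist_le => //; exact: cf.
have /nbhs_ballP[d /= d0 Hd] : nbhs x ((fun y => forall i, `|pd i f y - pd i f x| <= e / 2) `&` U).
  by apply: filterI => //; exact: open_nbhs_nbhs.
near=> y.
have yd : ball x d y by near: y; exact: nbhsx_ballx.
have xd : ball x d x by exact: ballxx.
have sub z : inrect x y z -> ball x d z := inrect_ball xd yd.
have [z0 [z1 [r0 r1 ->]]] : exists z0 z1, [/\ inrect x y z0, inrect x y z1 &
    f y - f x = (y 0 0 - x 0 0) * pd 0 f z0 + (y 0 1 - x 0 1) * pd 1 f z1].
  by apply: mvt2 => z /sub/Hd [_ Uz]; exact: df.
have [/(_ 0) h0 _] := Hd _ (sub _ r0); have [/(_ 1) h1 _] := Hd _ (sub _ r1).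
rewrite /= /lincomb2 !mxE.
rewrite (_ : _ - _ = (y 0 0 - x 0 0) * (pd 0 f z0 - pd 0 f x) +
  (y 0 1 - x 0 1) * (pd 1 f z1 - pd 1 f x)); last by ring.
have nk k : `|y 0 k - x 0 k| <= `|y - x|.
  by have := plane_norm_ge (y - x) k; rewrite !mxE.
rewrite (splitr e); exact: (norm_comb2_le (nk 0) (nk 1) h0 h1).
Unshelve. all: by end_near. Qed.

Lemma C1_differentiable U f x : open U -> Cn 1 U f -> U x -> differentiable f x.
Proof.
move=> oU cf Ux; apply: differentiable_approx => [|e e0].
  exact: (@continuous_lincomb2 (pd 0 f x) (pd 1 f x)).
exact: (C1_approx oU cf Ux e0).
Qed.

Lemma pd_is_derive f i x : differentiable f x -> is_derive x 'e_i f (pd i f x).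
Proof. by move=> df; apply: derivableP; exact: diff_derivable. Qed.

Lemma is_derive_pd f i x c : is_derive x 'e_i f c -> pd i f x = c.
Proof. by move=> [_]. Qed.

Lemma pd_near_eq f g i x : (\near x, f x = g x) -> pd i f x = pd i g x.
Proof. exact: near_eq_derive. Qed.

Lemma pd_eq_on U f g i x : open U -> {in U, f =1 g} -> U x -> pd i f x = pd i g x.
Proof.
move=> oU fg Ux; apply: pd_near_eq.
have : nbhs x U by exact: open_nbhs_nbhs.
by apply: filterS => y Uy; apply: fg; rewrite inE.
Qed.

Lemma pdD f g i x : derivable f x 'e_i -> derivable g x 'e_i ->
  pd i (fun x => f x + g x) x = pd i f x + pd i g x.
Proof. exact: deriveD. Qed.

Lemma pdN f i x : derivable f x 'e_i -> pd i (fun x => - f x) x = - pd i f x.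
Proof. exact: deriveN. Qed.

Lemma pdM f g i x : derivable f x 'e_i -> derivable g x 'e_i ->
  pd i (fun x => f x * g x) x = pd i f x * g x + f x * pd i g x.
Proof.
move=> df dg; rewrite /pd (deriveM df dg) addrC; congr (_ + _).
exact: mulrC.
Qed.

Lemma pdV f i x : f x != 0 -> derivable f x 'e_i ->
  pd i (fun x => (f x)^-1) x = - ((f x)^-1 * (f x)^-1 * pd i f x).
Proof.
move=> f0 df; rewrite /pd (deriveV f0 df) expr2 invfM.
exact: mulNr.
Qed.

Lemma pd_cst i (c : R) x : pd i (fun=> c) x = 0.
Proof. exact: derive_cst. Qed.

Lemma is_derive_coord (i k : 'I_2) x :
  is_derive x 'e_i (fun x : plane R => x 0 k) (k == i)%:R.
Proof.
apply: is_derive_eps => e e0; near=> h.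
by rewrite axisE addrK subrr normr0 mulr_ge0 // ltW.
Unshelve. all: by end_near. Qed.

Lemma pd_coord (i k : 'I_2) x : pd i (fun x : plane R => x 0 k) x = (k == i)%:R.
Proof. exact/is_derive_pd/is_derive_coord. Qed.

Lemma differentiable_map (F : plane R -> plane R) x :
  (forall k, differentiable (fun y => F y 0 k) x) -> differentiable F x.
Proof.
move=> H; have -> : F = (fun y => F y 0 0 *: 'e_0 + F y 0 1 *: 'e_1).
  by apply/funext => y; apply: plane_eqP; rewrite !mxE /= ?(mulr1, mulr0, addr0, add0r).
by apply: differentiableD; apply: differentiableZl.
Qed.

Lemma row_e (v : plane R) : v = \sum_k v 0 k *: 'e_k.
Proof. by rewrite sum2E; apply: plane_eqP; rewrite !mxE /= ?(mulr1, mulr0, addr0, add0r). Qed.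

Lemma pd_comp f (F : plane R -> plane R) i x :
  differentiable f (F x) -> (forall k, differentiable (fun y => F y 0 k) x) ->
  pd i (f \o F) x = \sum_k pd k f (F x) * pd i (fun y => F y 0 k) x.
Proof.
move=> df dFk; have dF := differentiable_map dFk.
have dF' : 'd F x 'e_i = \row_k pd i (fun y => F y 0 k) x.
  rewrite -deriveE // derive_mx; last exact: diff_derivable.
  by apply/rowP => k; rewrite !mxE.
rewrite /pd deriveE; last exact: differentiable_comp.
rewrite diff_comp //= dF' [X in 'd f (F x) X]row_e linear_sum; apply: eq_bigr => k _.
by rewrite linearZ /= mxE -deriveE // mulrC.
Qed.

End Differentiability.

(* Keeps unification from unfolding partial derivatives into limits. *)
Opaque pd.

(** * Functions of class C^n *)

Section SmoothClasses.
Variable R : realType.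
Implicit Types (f g : plane R -> R) (x y z p : plane R) (U V : set (plane R)).

Lemma Cn_sub n U V f : U `<=` V -> Cn n V f -> Cn n U f.
Proof.
move=> UV; elim: n f => [|n IH] f /=; first by move=> H x /UV/H.
by move=> [df cf]; split => [x /UV/df//|i]; exact: IH.
Qed.

Lemma Cn_S n U f : open U -> Cn n.+1 U f -> Cn n U f.
Proof.
move=> oU; elim: n f => [|n IH] f H.
  by move=> x Ux; apply: differentiable_continuous; exact: C1_differentiable H Ux.
by case: H => df cf; split=> // i; exact: IH.
Qed.

Lemma Cn_le m n U f : open U -> (m <= n)%N -> Cn n U f -> Cn m U f.
Proof.
move=> oU; elim: n => [|n IH]; first by rewrite leqn0 => /eqP ->.
by rewrite leq_eqVlt => /predU1P[-> //|mn /Cn_S-/(_ oU)]; exact: IH.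
Qed.

Lemma Cn_differentiable n U f x : open U -> Cn n.+1 U f -> U x -> differentiable f x.
Proof. by move=> oU cf; apply: C1_differentiable => //; exact: Cn_le cf. Qed.

Lemma Cn_derivable n U f x i : Cn n.+1 U f -> U x -> derivable f x 'e_i.
Proof. by move=> [df _] /df. Qed.

Lemma Cn_pd n U f i : Cn n.+1 U f -> Cn n U (pd i f).
Proof. by move=> [_ /(_ i)]. Qed.

Lemma Cn_eq n U f g : open U -> {in U, f =1 g} -> Cn n U f -> Cn n U g.
Proof.
move=> oU; elim: n f g => [|n IH] f g fg.
  move=> cf x Ux; rewrite /prop_for /continuous_at -(fg x) ?inE //.
  apply: cvg_trans (cf x Ux); apply: (@near_eq_cvg _ _ (nbhs x)).
  have : nbhs x U by exact: open_nbhs_nbhs.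
  by apply: filterS => y Uy; rewrite /= fg ?inE.
move=> [df cf]; split=> [x Ux i|i].
  apply: near_eq_derivable (df x Ux i).
  have : nbhs x U by exact: open_nbhs_nbhs.
  by apply: filterS => y Uy; rewrite fg ?inE.
by apply: IH (cf i) => x; rewrite inE => Ux; exact: pd_eq_on Ux.
Qed.

Lemma Cn_cst n U (c : R) : Cn n U (fun=> c).
Proof.
elim: n c => [|n IH] c; first by move=> x _; exact: cst_continuous.
split=> [x _ i|i]; first exact: derivable_cst.
by rewrite (_ : pd i _ = fun=> 0) //; apply/funext => x; exact: pd_cst.
Qed.

Lemma Cn_coord n U k : Cn n U (fun x : plane R => x 0 k).
Proof.
case: n => [|n]; first by move=> x _; exact: coord_continuous.
split=> [x _ i|i]; first by have [] := is_derive_coord i k x.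
rewrite (_ : pd i _ = fun=> (k == i)%:R); first exact: Cn_cst.
by apply/funext => x; exact: pd_coord.
Qed.

Lemma Cn_add n U f g : open U -> Cn n U f -> Cn n U g -> Cn n U (fun x => f x + g x).
Proof.
move=> oU; elim: n f g => [|n IH] f g.
  by move=> cf cg x Ux; apply: (@continuousD _ _ _ f g); [exact: cf|exact: cg].
move=> [df cf] [dg cg]; split=> [x Ux i|i].
  by apply: (@derivableD _ _ _ f g); [exact: df|exact: dg].
apply: (@Cn_eq _ _ (fun x => pd i f x + pd i g x)) (IH _ _ (cf i) (cg i)) => //.
by move=> x; rewrite inE => Ux; rewrite pdD //; [exact: df|exact: dg].
Qed.

Lemma Cn_mul n U f g : open U -> Cn n U f -> Cn n U g -> Cn n U (fun x => f x * g x).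
Proof.
move=> oU; elim: n f g => [|n IH] f g.
  by move=> cf cg x Ux; apply: (@continuousM _ _ f g); [exact: cf|exact: cg].
move=> cf cg; split=> [x Ux i|i].
  by apply: (@derivableM _ _ f g); [case: cf => + _; exact|case: cg => + _; exact].
apply: (@Cn_eq _ _ (fun x => pd i f x * g x + f x * pd i g x)) => //.
  move=> x; rewrite inE => Ux; rewrite pdM //; first by case: cf => + _; exact.
  by case: cg => + _; exact.
by apply: Cn_add => //; apply: IH; [exact: Cn_pd|exact: Cn_S|exact: Cn_S|exact: Cn_pd].
Qed.

Lemma Cn_opp n U f : open U -> Cn n U f -> Cn n U (fun x => - f x).
Proof.
move=> oU cf; apply: (@Cn_eq _ _ (fun x => (-1) * f x)) => //.
  by move=> x _; rewrite mulN1r.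
by apply: Cn_mul => //; exact: Cn_cst.
Qed.

Lemma Cn_sub2 n U f g : open U -> Cn n U f -> Cn n U g -> Cn n U (fun x => f x - g x).
Proof. by move=> oU cf cg; apply: Cn_add => //; exact: Cn_opp. Qed.

Lemma Cn_sum n U (I : Type) (r : seq I) (F : I -> plane R -> R) : open U ->
  (forall i, Cn n U (F i)) -> Cn n U (fun x => \sum_(i <- r) F i x).
Proof.
move=> oU cF; elim: r => [|a r IH].
  by apply: Cn_eq (Cn_cst n U 0) => // x _; rewrite big_nil.
by apply: Cn_eq (Cn_add oU (cF a) IH) => // x _; rewrite big_cons.
Qed.

Lemma Cn_comp n U V f (F : plane R -> plane R) : open U -> open V ->
  (forall x, U x -> V (F x)) -> Cn n V f -> (forall k, Cn n U (fun y => F y 0 k)) ->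
  Cn n U (f \o F).
Proof.
move=> oU oV UV; elim: n f => [|n IH] f cf cF.
  move=> x Ux; apply: continuous_comp; last exact/cf/UV.
  apply/(@cvgrPdist_le _ _ _ (nbhs x)) => e e0.
  have H : \forall y \near x, forall k, `|F x 0 k - F y 0 k| <= e.
    by apply: ord2_ind_near => k; have /cvgrPdist_le/(_ _ e0) := cF k x Ux.
  apply: filterS H => y Hy; apply/plane_norm_le; first exact: ltW.
  by move=> k; rewrite !mxE.
have dF x k : U x -> differentiable (fun y => F y 0 k) x.
  by move=> Ux; exact: Cn_differentiable (cF k) Ux.
have df x : U x -> differentiable f (F x).
  by move=> /UV; exact: Cn_differentiable cf.
split=> [x Ux i|i].
  apply: diff_derivable; apply: differentiable_comp; last exact: df.
  by apply: differentiable_map => k; exact: dF.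
apply: (@Cn_eq _ _ (fun x => \sum_k (pd k f \o F) x * pd i (fun y => F y 0 k) x)) => //.
  move=> x; rewrite inE => Ux; rewrite pd_comp //; first exact: df.
  by move=> k; exact: dF.
apply: Cn_sum => // k; apply: Cn_mul => //; last exact: Cn_pd.
apply: IH => [|k']; first exact: Cn_pd.
by apply: Cn_S.
Qed.

Lemma Cn_inv n U f : open U -> (forall x, U x -> f x != 0) -> Cn n U f ->
  Cn n U (fun x => (f x)^-1).
Proof.
move=> oU f0; elim: n => [|n IH] cf.
  by move=> x Ux; apply: (@continuousV _ _ f); [exact: f0|exact: cf].
have df x i : U x -> derivable f x 'e_i by move=> Ux; case: cf => + _; exact.
split=> [x Ux i|i]; first by apply: derivableV; [exact: f0|exact: df].
apply: (@Cn_eq _ _ (fun x => - ((f x)^-1 * (f x)^-1 * pd i f x))) => //.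
  move=> x; rewrite inE => Ux; rewrite pdV ?f0 //; exact: df.
have cV := IH (Cn_S oU cf).
by apply: Cn_opp => //; apply: Cn_mul => //; [exact: Cn_mul|exact: Cn_pd].
Qed.

Lemma is_derive_coord_fun (h : R -> R) (h' : R) (k i : 'I_2) x :
  is_derive (x 0 k) 1 h h' ->
  is_derive x 'e_i (fun y : plane R => h (y 0 k)) ((k == i)%:R * h').
Proof.
move=> [dh <-].
have dk := is_derive_coord i k x.
have dfk : differentiable (fun y : plane R => y 0 k) x by exact: differentiable_coord.
have dh' : differentiable h (x 0 k) by apply/derivable1_diffP.
have dc : differentiable (h \o (fun y : plane R => y 0 k)) x by exact: differentiable_comp.
split; first exact: diff_derivable.
have e1 : 'd (fun y : plane R => y 0 k) x 'e_i = (k == i)%:R *: (1 : R^o).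
  by rewrite -deriveE // [LHS](is_derive_pd dk) /GRing.scale /= mulr1.
rewrite (deriveE _ dc) diff_comp //= e1 linearZ /= -deriveE //.
Qed.

(** Raises the class by one: it is applied repeatedly to functions, such as
    sine and the exponential, whose derivatives form a finite family. *)
Lemma Cn_coord_fun n U (h h' : R -> R) (k : 'I_2) : open U ->
  (forall x, U x -> is_derive (x 0 k) 1 h (h' (x 0 k))) ->
  Cn n U (fun x => h' (x 0 k)) -> Cn n.+1 U (fun x => h (x 0 k)).
Proof.
move=> oU dh ch; split=> [x Ux i|i].
  by have [] := is_derive_coord_fun i (dh x Ux).
apply: (@Cn_eq _ _ (fun x => (k == i)%:R * h' (x 0 k))) => //.
  by move=> x; rewrite inE => Ux; apply/esym/is_derive_pd/is_derive_coord_fun/dh.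
by apply: Cn_mul => //; exact: Cn_cst.
Qed.

End SmoothClasses.

(** * Symmetry of second derivatives *)

Section Schwarz.
Variable R : realType.
Implicit Types (f g : plane R -> R) (x y z p : plane R) (U V : set (plane R)).

Lemma is_derive_translate f c x v d : is_derive (x + c) v f d ->
  is_derive x v (fun y => f (y + c)) d.
Proof.
have E : (fun h : R => h^-1 *: (f (h *: v + x + c) - f (x + c))) =
  (fun h => h^-1 *: (f (h *: v + (x + c)) - f (x + c))).
  by apply/funext => h; rewrite addrA.
by case=> [df <-]; split; [rewrite /derivable E|rewrite /derive E].
Qed.

(** Applying the mean value theorem in the direction i to the increment of f in
    the direction j turns the second difference, which is symmetric in i and j,
    into a mixed derivative. *)
Lemma second_difference d f (h : R) (i j : 'I_2) x : i != j -> `|h| < d ->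
  Cn 2 (ball x d) f ->
  exists2 z, ball x d z &
    f (h *: 'e_i + (h *: 'e_j + x)) - f (h *: 'e_i + x) - f (h *: 'e_j + x) + f x =
    h * h * pd j (pd i f) z.
Proof.
move=> ij hd [df cf]; set phi := fun y => f (y + h *: 'e_j) - f y.
have inb (a b : R) : `|a| < d -> `|b| < d -> ball x d (a *: 'e_i + (b *: 'e_j + x)).
  move=> ad bd; apply/plane_ballP => k; rewrite !axisE.
  case: (eqVneq k i) => [->|ki]; first by rewrite (negbTE ij) !(mulr1, mulr0) add0r opprD addrCA subrr addr0 normrN.
  case: (k == j); rewrite !(mulr1, mulr0) add0r; first by rewrite opprD addrCA subrr addr0 normrN.
  by rewrite add0r subrr normr0 (le_lt_trans _ ad).
have d0 : 0 < d := le_lt_trans (normr_ge0 _) hd.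
have n0 : `|0 : R| < d by rewrite normr0.
have rect1 z : inrect x (h *: 'e_i + x) z -> exists2 a, `|a| < d & z = a *: 'e_i + x.
  move=> r; exists (z 0 i - x 0 i).
    have := inrect_dist r; rewrite addrK norm_axis => /(le_trans (plane_norm_ge _ i)).
    by rewrite !mxE => /le_lt_trans; exact.
  apply/rowP => k; rewrite axisE; case: (eqVneq k i) => [->|ki].
    by rewrite mulr1 subrK.
  have := r k; rewrite axisE (negbTE ki) mulr0 !add0r minxx maxxx => ?.
  by rewrite mulr0 add0r; apply/esym/eqP; rewrite eq_le.
have rect2 a z : `|a| < d -> inrect (a *: 'e_i + x) (h *: 'e_j + (a *: 'e_i + x)) z ->
    ball x d z.
  move=> ad r; have ji : j != i by rewrite eq_sym.
  have e : z = a *: 'e_i + ((z 0 j - x 0 j) *: 'e_j + x).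
    apply/rowP => k; have := r k; rewrite !axisE.
    case: (eqVneq k j) => [->|kj].
      by rewrite (negbTE ji) !(mulr1, mulr0) !add0r subrK.
    rewrite !(mulr0, add0r) minxx maxxx => ?.
    by apply/esym/eqP; rewrite eq_le.
  rewrite e; apply: inb => //.
  have := inrect_dist r; rewrite addrK norm_axis => /(le_trans (plane_norm_ge _ j)).
  rewrite 2!mxE axisE (negbTE ji) mulr0 add0r => /le_lt_trans; exact.
have dphi z : inrect x (h *: 'e_i + x) z ->
    is_derive z 'e_i phi (pd i f (z + h *: 'e_j) - pd i f z).
  move=> /rect1[a ad ->].
  have b1 := inb _ _ ad hd; have b2 := inb _ _ ad n0.
  apply: is_deriveB.
    apply: is_derive_translate; rewrite -addrA [x + _]addrC.
    by apply: derivableP; exact: df.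
  by rewrite scale0r add0r in b2; apply: derivableP; exact: df.
have [w wr e1] : exists2 w, inrect x (h *: 'e_i + x) w &
    phi (h *: 'e_i + x) - phi x = ((h *: 'e_i + x) 0 i - x 0 i) * pd i phi w.
  apply: mvt_axis => [k ki|z /dphi[]//].
  by rewrite axisE (negbTE ki) mulr0 add0r.
have [a ad ew] := rect1 _ wr.
have [z zr e2] : exists2 z, inrect w (h *: 'e_j + w) z &
    pd i f (h *: 'e_j + w) - pd i f w = ((h *: 'e_j + w) 0 j - w 0 j) * pd j (pd i f) z.
  apply: mvt_axis => [k kj|z].
    by rewrite axisE (negbTE kj) mulr0 add0r.
  by rewrite ew => /(rect2 _ _ ad) bz; case: (cf i) => + _; exact.
exists z; first by move: zr; rewrite ew; exact: rect2.
move: e1; rewrite (is_derive_pd (dphi _ wr)) axisE eqxx mulr1 addrK [w + _]addrC e2.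
rewrite axisE eqxx mulr1 addrK /phi mulrA => <-.
have -> : h *: 'e_i + x + h *: 'e_j = h *: 'e_i + (h *: 'e_j + x).
  by rewrite -addrA [x + _]addrC.
by rewrite [x + _]addrC; ring.
Qed.

Lemma second_difference_inj (A B C D k u v : R) : k != 0 ->
  A - B - C + D = k * u -> A - C - B + D = k * v -> u = v.
Proof. by move=> k0 e1 e2; apply: (mulfI k0); rewrite -e1 -e2; ring. Qed.

Lemma close_triangle (a b c1 c2 e : R) : `|c1 - a| <= e / 2 -> `|c2 - b| <= e / 2 ->
  c1 = c2 -> `|a - b| <= e.
Proof.
move=> h1 h2 ec; rewrite (splitr e) -(subrKA c1); apply: le_trans (ler_normD _ _) _.
by apply: lerD; rewrite ?ec // -ec distrC.
Qed.

Lemma schwarz U f x (i j : 'I_2) : open U -> Cn 2 U f -> U x ->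
  pd i (pd j f) x = pd j (pd i f) x.
Proof.
move=> oU cf Ux; case: (eqVneq i j) => [->//|ij].
apply/eqP; rewrite -subr_eq0 -normr_le0; apply/ler_addgt0Pl => e e0; rewrite addr0.
have e20 : 0 < e / 2 by rewrite divr_gt0.
have near_pd k l : \forall y \near x, `|pd k (pd l f) y - pd k (pd l f) x| <= e / 2.
  by apply: near_dist_le => //; exact: (Cn_pd k (Cn_pd l cf)).
have /nbhs_ballP[d /= d0 Hd] : nbhs x ((fun y => `|pd i (pd j f) y - pd i (pd j f) x| <= e / 2)
    `&` (fun y => `|pd j (pd i f) y - pd j (pd i f) x| <= e / 2) `&` U).
  by apply: filterI; [apply: filterI; exact: near_pd|exact: open_nbhs_nbhs].
have e12 : (d / 2) *: 'e_i + ((d / 2) *: 'e_j + x) = (d / 2) *: 'e_j + ((d / 2) *: 'e_i + x) by rewrite addrCA.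
have hd : `|d / 2| < d by rewrite gtr0_norm ?divr_gt0 // ltr_pdivrMr // ltr_pMr // ltr1n.
have cfd : Cn 2 (ball x d) f by apply: Cn_sub cf => y /Hd[].
have [z1 /Hd[[_ h1] _] e1] := second_difference ij hd cfd.
have ji : j != i by rewrite eq_sym.
have [z2 /Hd[[h2 _] _] e2] := second_difference ji hd cfd.
rewrite e12 in e1.
have h0 : d / 2 * (d / 2) != 0 by rewrite mulf_neq0 // gt_eqF // divr_gt0.
apply: (close_triangle h2 h1).
exact: (second_difference_inj h0 e2 e1).
Unshelve. all: by end_near. Qed.

End Schwarz.

(** * The inverse function theorem *)

(* Makes the plane a complete normed module, as the contraction principle
   requires. *)
HB.instance Definition _ (R : realType) m n := Complete.on 'M[R]_(m.+1, n.+1).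

Section InverseFunction.
Variable R : realType.
Implicit Types (f g : plane R -> R) (x y z p : plane R) (U V : set (plane R)).

Definition jac (F : plane R -> plane R) x :=
  pd 0 (fun y => F y 0 0) x * pd 1 (fun y => F y 0 1) x -
  pd 1 (fun y => F y 0 0) x * pd 0 (fun y => F y 0 1) x.

Lemma pd_zero_cst p d f : (forall x, ball p d x -> forall i, derivable f x 'e_i) ->
  (forall x i, ball p d x -> pd i f x = 0) ->
  forall x, ball p d x -> f x = f p.
Proof.
move=> df pf x px; have d0 : 0 < d.
  by move/plane_ballP: px => /(_ 0); exact/le_lt_trans/normr_ge0.
have pp : ball p d p by exact: ballxx.
have [|z0 [z1 [r0 r1 e]]] := @mvt2 _ f p x.
  by move=> z zr; apply: df; exact: inrect_ball zr.
apply/eqP; rewrite -subr_eq0 e !pf ?mulr0 ?addr0 //; exact: inrect_ball r0 || exact: inrect_ball r1.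
Qed.

Lemma small_pd_lipschitz p d f (c : R) :
  (forall x, ball p d x -> forall i, derivable f x 'e_i) ->
  (forall x i, ball p d x -> `|pd i f x| <= c) ->
  forall x y, ball p d x -> ball p d y -> `|f y - f x| <= (c + c) * `|y - x|.
Proof.
move=> df pf x y px py.
have [|z0 [z1 [r0 r1 ->]]] := @mvt2 _ f x y.
  by move=> z zr; apply: df; exact: inrect_ball zr.
have nk k : `|y 0 k - x 0 k| <= `|y - x|.
  by have := plane_norm_ge (y - x) k; rewrite !mxE.
by apply: norm_comb2_le => //; apply: pf; [exact: inrect_ball r0|exact: inrect_ball r1].
Qed.

(** Solution h of the system with v_0 = h_0 c00 + h_1 c10 and
    v_1 = h_0 c01 + h_1 c11, the coefficients being indexed as in [jac]: first by
    the direction of differentiation, then by the component. *)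
Definition cramer (c00 c10 c01 c11 : R) (v : plane R) : plane R :=
  mkpt ((c11 * v 0 0 - c10 * v 0 1) / (c00 * c11 - c10 * c01))
       ((c00 * v 0 1 - c01 * v 0 0) / (c00 * c11 - c10 * c01)).

Lemma cramerB c00 c10 c01 c11 u v :
  cramer c00 c10 c01 c11 (u - v) = cramer c00 c10 c01 c11 u - cramer c00 c10 c01 c11 v.
Proof. by apply: plane_eqP; rewrite !mxE /=; ring. Qed.

Lemma cramerZ c00 c10 c01 c11 (h : R) v :
  cramer c00 c10 c01 c11 (h *: v) = h *: cramer c00 c10 c01 c11 v.
Proof. by apply: plane_eqP; rewrite !mxE /=; ring. Qed.

Lemma rowZB (h : R) (u v : plane R) k : (h *: u - v) 0 k = h * u 0 k - v 0 k.
Proof. by rewrite !mxE. Qed.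

Lemma cramer_norm c00 c10 c01 c11 v :
  `|cramer c00 c10 c01 c11 v| <=
  (`|c00| + `|c10| + `|c01| + `|c11|) / `|c00 * c11 - c10 * c01| * `|v|.
Proof.
set S := (X in X / _ * _); set D := c00 * c11 - _.
have nv k := plane_norm_ge v k.
have S0 : 0 <= S by rewrite /S !addr_ge0.
apply/plane_norm_le; first by rewrite mulr_ge0 // divr_ge0.
have H (a b : R) i j : `|a| + `|b| <= S -> `|(a * v 0 i - b * v 0 j) / D| <= S / `|D| * `|v|.
  move=> ab; rewrite normrM normfV mulrAC ler_wpM2r ?invr_ge0 //.
  apply: le_trans (ler_normB _ _) _; rewrite !normrM.
  apply: le_trans (_ : (`|a| + `|b|) * `|v| <= _); last by rewrite ler_wpM2r.
  by rewrite mulrDl lerD // ler_wpM2l.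
have := normr_ge0 c00; have := normr_ge0 c01; have := normr_ge0 c10; have := normr_ge0 c11.
by move=> ? ? ? ?; apply: ord2P; rewrite ?mkpt0 ?mkpt1; apply: H; rewrite /S; lra.
Qed.

Lemma cramerK c00 c10 c01 c11 (h v : plane R) : c00 * c11 - c10 * c01 != 0 ->
  v 0 0 = h 0 0 * c00 + h 0 1 * c10 -> v 0 1 = h 0 0 * c01 + h 0 1 * c11 ->
  cramer c00 c10 c01 c11 v = h.
Proof.
by move=> D0 e0 e1; apply: plane_eqP; rewrite ?mkpt0 ?mkpt1 e0 e1; field.
Qed.

Lemma cramer_inj c00 c10 c01 c11 : c00 * c11 - c10 * c01 != 0 ->
  injective (cramer c00 c10 c01 c11).
Proof.
move=> D0; suff K : cancel (cramer c00 c10 c01 c11) (fun h => mkpt (h 0 0 * c00 + h 0 1 * c10) (h 0 0 * c01 + h 0 1 * c11)).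
  exact: can_inj K.
move=> v; by apply: plane_eqP; rewrite !mxE /=; field.
Qed.

(* In this section y - J (F y) is a contraction, where J is the inverse of the
   differential of F at the centre of the ball N. *)
Section Local.
Variables (F : plane R -> plane R) (c00 c10 c01 c11 d : R) (p : plane R).
Let J := cramer c00 c10 c01 c11.
Let L := (`|c00| + `|c10| + `|c01| + `|c11|) / `|c00 * c11 - c10 * c01|.
Let N := ball p d.
Hypothesis D0 : c00 * c11 - c10 * c01 != 0.
Hypothesis quarter : forall x y, N x -> N y ->
  `|(y - J (F y)) - (x - J (F x))| <= 4^-1 * `|y - x|.

Let L0 : 0 <= L. Proof. by rewrite /L divr_ge0 // !addr_ge0. Qed.

(** F is injective on N, with a Lipschitz inverse, since J o F differs from the
    identity by a contraction. *)
Lemma inverse_lipschitz x y : N x -> N y -> `|y - x| <= 2 * L * `|F y - F x|.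
Proof.
move=> Nx Ny; have h1 := quarter Nx Ny.
have h2 : `|J (F y) - J (F x)| <= L * `|F y - F x| by rewrite -cramerB cramer_norm.
have h3 : `|y - x| <= `|(y - J (F y)) - (x - J (F x))| + `|J (F y) - J (F x)|.
  apply: le_trans (ler_normD _ _); rewrite le_eqVlt; apply/orP; left; apply/eqP.
  by congr (`|_|); rewrite opprB; apply/rowP => k; rewrite !mxE; ring.
have := normr_ge0 (y - x); rewrite -mulrA; lra.
Qed.

(** The equation F y = z is the fixed point equation y = y - J (F y) + J z,
    whose right-hand side contracts a small ball around y0 into itself when z is
    close to F y0. *)
Lemma image_open : open (F @` N).
Proof.
rewrite openE => _ [y0 Ny0 <-].
have [s s0 sN] := open_ball (ball_open p d : open N) Ny0.
have L1 : 0 < L + 1 by rewrite ltr_wpDl.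
apply/nbhs_ballP; exists (s / 4 / (L + 1)) => /=; first by rewrite !divr_gt0.
move=> z zb.
have {}zb : L * `|z - F y0| <= s / 4.
  have zb' : `|z - F y0| <= s / 4 / (L + 1).
    by move: zb; rewrite -ball_normE /= distrC => /ltW.
  apply: le_trans (_ : (L + 1) * (s / 4 / (L + 1)) <= _).
    by apply: ler_pM => //; rewrite lerDl.
  by rewrite mulrC divfK // gt_eqF.
pose B : set (plane R) := [set y | `|y - y0| <= s / 2].
have BN : B `<=` N.
  rewrite /B => y /= yB; apply: sN; rewrite -ball_normE /= distrC; lra.
pose T y := (y - J (F y)) + J z.
have TB : {homo T : y / B y >-> B y}.
  move=> y By; rewrite /B /= /T.
  rewrite (_ : _ - y0 = ((y - J (F y)) - (y0 - J (F y0))) + (J z - J (F y0))); last first.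
    by apply/rowP => k; rewrite !mxE; ring.
  apply: le_trans (ler_normD _ _) _.
  have h1 := quarter Ny0 (BN _ By).
  have h2 : `|J z - J (F y0)| <= L * `|z - F y0| by rewrite -cramerB cramer_norm.
  move: By; rewrite /B /=; lra.
have B0 : B !=set0 by exists y0; rewrite /B /= subrr normr0 divr_ge0 // ltW.
have cB : closed B.
  have -> : B = closed_ball_ Num.norm y0 (s / 2).
    by apply/seteqP; split => y; rewrite /B /closed_ball_ /= distrC.
  by apply: closed_closed_ball_.
have ctr : is_contraction (mkfun TB).
  have q0 : (0 : R) <= 4^-1 by rewrite invr_ge0.
  exists (NngNum q0); split => /=; first by rewrite invf_lt1 // ltr1n.
  move=> [y y'] /= [By By']; rewrite /T.
  rewrite opprD addrACA subrr addr0.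
  by apply: quarter; exact: BN.
have [y By e] := banach_fixed_point ctr cB B0.
exists y; first exact: BN.
apply: (cramer_inj D0); rewrite -/J; move: e; rewrite /= /T => e.
apply/eqP; rewrite -subr_eq0 -oppr_eq0 opprB; apply/eqP.
have := congr1 (fun u => u - y) e; rewrite subrr => ->.
by apply/rowP => k; rewrite !mxE; ring.
Qed.

End Local.

Definition jac_inv (F : plane R -> plane R) (i k : 'I_2) x : R :=
  cramer (pd 0 (fun y => F y 0 0) x) (pd 1 (fun y => F y 0 0) x)
         (pd 0 (fun y => F y 0 1) x) (pd 1 (fun y => F y 0 1) x) 'e_i 0 k.

Lemma Cn_jac n U (F : plane R -> plane R) : open U -> (forall k, Cn n.+1 U (fun y => F y 0 k)) -> Cn n U (jac F).
Proof.
by move=> oU cF; apply: Cn_sub2 => //; apply: Cn_mul => //; apply: Cn_pd.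
Qed.

Lemma Cn_jac_inv n U (F : plane R -> plane R) (i k : 'I_2) : open U -> (forall k, Cn n.+1 U (fun y => F y 0 k)) ->
  (forall x, U x -> jac F x != 0) -> Cn n U (jac_inv F i k).
Proof.
move=> oU cF J0; have cJ : Cn n U (fun x => (jac F x)^-1).
  by apply: Cn_inv => //; exact: Cn_jac.
have cp i' k' : Cn n U (pd i' (fun y => F y 0 k')) by exact: Cn_pd.
rewrite /jac_inv /cramer; elim/ord2P: k.
  apply: Cn_eq (Cn_mul oU (Cn_sub2 oU (Cn_mul oU (cp 1 1) (Cn_cst _ _ ('e_i 0 0))) (Cn_mul oU (cp 1 0) (Cn_cst _ _ ('e_i 0 1)))) cJ) => // x _.
  by rewrite mkpt0.
apply: Cn_eq (Cn_mul oU (Cn_sub2 oU (Cn_mul oU (cp 0 0) (Cn_cst _ _ ('e_i 0 1))) (Cn_mul oU (cp 0 1) (Cn_cst _ _ ('e_i 0 0)))) cJ) => // x _.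
by rewrite mkpt1.
Qed.

(** The derivatives of y - J (F y) vanish at p, so they are small nearby and
    [Local] provides a continuous inverse G on an open image. Solving the
    first order expansion of F for the increment shows that G has the partial
    derivatives [jac_inv] o G; an induction then gives smoothness. *)
Theorem inverse_function U (F : plane R -> plane R) p : open U -> U p ->
  smooth_map U F -> jac F p != 0 ->
  exists (N : set (plane R)) (G : plane R -> plane R),
  [/\ [/\ open N, N p & N `<=` U], open (F @` N), (forall y, N y -> G (F y) = y),
      (forall z, (F @` N) z -> {for z, continuous G}) & smooth_map (F @` N) G].
Proof.
move=> oU Up sF J0.
set c00 := pd 0 (fun y => F y 0 0) p; set c10 := pd 1 (fun y => F y 0 0) p.
set c01 := pd 0 (fun y => F y 0 1) p; set c11 := pd 1 (fun y => F y 0 1) p.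
pose J := cramer c00 c10 c01 c11.
pose H y := y - J (F y).
have cH n k : Cn n U (fun y => H y 0 k).
  rewrite /H /J /cramer; set D := c00 * c11 - c10 * c01.
  elim/ord2P: k.
    apply: (@Cn_eq _ _ _ (fun y => y 0 0 - (c11 * F y 0 0 - c10 * F y 0 1) * D^-1)) => //.
      by move=> y _; rewrite 2!mxE mkpt0.
    apply: Cn_sub2 => //; first exact: Cn_coord.
    apply: Cn_mul => //; last exact: Cn_cst.
    by apply: Cn_sub2 => //; apply: Cn_mul => //; first [exact: Cn_cst|exact: sF].
  apply: (@Cn_eq _ _ _ (fun y => y 0 1 - (c00 * F y 0 1 - c01 * F y 0 0) * D^-1)) => //.
    by move=> y _; rewrite 2!mxE mkpt1.
  apply: Cn_sub2 => //; first exact: Cn_coord.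
  apply: Cn_mul => //; last exact: Cn_cst.
  by apply: Cn_sub2 => //; apply: Cn_mul => //; first [exact: Cn_cst|exact: sF].
have dF k : differentiable (fun y => F y 0 k) p := Cn_differentiable oU (sF k 1%N) Up.
have pH i k : pd i (fun y => H y 0 k) p = 0.
  have dk l : derivable (fun y => F y 0 l) p 'e_i by exact: diff_derivable.
  have iF l := pd_is_derive i (dF l).
  elim/ord2P: k.
    have E : (fun y => H y 0 0) = (fun y => y 0 0 - (c11 * F y 0 0 - c10 * F y 0 1) * (c00 * c11 - c10 * c01)^-1).
      by apply/funext => y; rewrite /H /J /cramer 2!mxE mkpt0.
    rewrite E; apply: is_derive_pd.
    apply: (is_derive_eq (isdB (is_derive_coord i 0 p) (isdM (isdB
      (isdM (isdC c11 p _) (iF 0)) (isdM (isdC c10 p _) (iF 1))) (isdC _ p _)))).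
    move: J0; rewrite /jac -/c00 -/c10 -/c01 -/c11 => J0.
    by rewrite !mul0r !add0r mulr0 addr0; elim/ord2P: i {dk iF}; rewrite -?/c00 -?/c01 -?/c10 -?/c11 /=; field.
  have E : (fun y => H y 0 1) = (fun y => y 0 1 - (c00 * F y 0 1 - c01 * F y 0 0) * (c00 * c11 - c10 * c01)^-1).
    by apply/funext => y; rewrite /H /J /cramer 2!mxE mkpt1.
  rewrite E; apply: is_derive_pd.
  apply: (is_derive_eq (isdB (is_derive_coord i 1 p) (isdM (isdB
    (isdM (isdC c00 p _) (iF 1)) (isdM (isdC c01 p _) (iF 0))) (isdC _ p _)))).
  move: J0; rewrite /jac -/c00 -/c10 -/c01 -/c11 => J0.
  by rewrite !mul0r !add0r mulr0 addr0; elim/ord2P: i {dk iF}; rewrite -?/c00 -?/c01 -?/c10 -?/c11 /=; field.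
(* With partial derivatives below 1/8, each component is 1/4-Lipschitz. *)
have H8 : \forall y \near p, forall k i, `|pd i (fun y => H y 0 k) y| <= 8^-1.
  apply: ord2_ind_near => k; apply: ord2_ind_near => i.
  have e0 : (0 : R) < 8^-1 by rewrite invr_gt0.
  have : \forall y \near p, `|pd i (fun y => H y 0 k) y - pd i (fun y => H y 0 k) p| <= 8^-1.
    by apply: near_dist_le => //; exact: (Cn_pd i (cH 1%N k)).
  by apply: filterS => y; rewrite pH subr0.
have JN : \forall y \near p, jac F y != 0.
  have cJ : {for p, continuous (jac F)} by apply: (Cn_jac (n := 0) oU) => // k; exact: sF.
  have : nbhs (jac F p) [set t | t != 0].
    by apply: open_nbhs_nbhs; split=> //; exact: open_neq.
  by move=> /cJ.
have /nbhs_ballP[d /= d0 Hd] : nbhs p ((fun y => forall k i, `|pd i (fun y => H y 0 k) y| <= 8^-1)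
    `&` (fun y => jac F y != 0) `&` U).
  by apply: filterI; [apply: filterI|exact: open_nbhs_nbhs].
have quarter x y : ball p d x -> ball p d y -> `|(y - J (F y)) - (x - J (F x))| <= 4^-1 * `|y - x|.
  move=> bx by_; apply/plane_norm_le; first by rewrite mulr_ge0 // invr_ge0.
  move=> k; have := @small_pd_lipschitz p d (fun y => H y 0 k) 8^-1 _ _ x y bx by_.
  rewrite (_ : 8^-1 + 8^-1 = 4^-1); last by field.
  rewrite /H !mxE; apply.
    by move=> z /Hd[_ Uz] i; case: (cH 1%N k) => + _; exact.
  by move=> z i /Hd[[+ _] _]; exact.
have D0 : c00 * c11 - c10 * c01 != 0 := J0.
have oN := image_open D0 quarter.
have inj := inverse_lipschitz quarter.
set N := ball p d in quarter oN inj.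
have cN : open N by exact: ball_open.
set K := 2 * _ in inj.
pose G z := xget p [set y | N y /\ F y = z].
have GF y : N y -> G (F y) = y.
  move=> Ny; rewrite /G; case: xgetP => [w _ [Nw e]|/(_ y)]; last by case.
  by apply/eqP; rewrite -subr_eq0 -normr_le0 (le_trans (inj _ _ Ny Nw)) // e subrr normr0 mulr0.
have K0 : 0 <= K by rewrite /K mulr_ge0 // divr_ge0 // !addr_ge0.
have FG z : (F @` N) z -> N (G z) /\ F (G z) = z.
  by move=> [y Ny <-]; rewrite GF.
have lipG z w : (F @` N) z -> (F @` N) w -> `|G w - G z| <= K * `|w - z|.
  by move=> /FG[Nz ez] /FG[Nw ew]; rewrite -[in leRHS]ez -[in leRHS]ew; exact: inj.
have cG z : (F @` N) z -> {for z, continuous G}.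
  move=> Fz; apply/(@cvgrPdist_le _ _ _ (nbhs z)) => e e0.
  have K1 : 0 < K + 1 by rewrite ltr_wpDl.
  near=> w.
  have Fw : (F @` N) w by near: w; exact: open_nbhs_nbhs.
  rewrite distrC (le_trans (lipG _ _ Fz Fw)) //.
  have : `|w - z| <= e / (K + 1).
    near: w; apply/nbhs_ballP; exists (e / (K + 1)) => /=; first by rewrite divr_gt0.
    by move=> w; rewrite -ball_normE /= distrC => /ltW.
  move=> h; apply: le_trans (_ : (K + 1) * (e / (K + 1)) <= _).
    by apply: ler_pM => //; rewrite lerDl.
  by rewrite mulrC divfK // gt_eqF.
have JN0 y : N y -> jac F y != 0 by move=> /Hd[[_]].
have dG z i k : (F @` N) z -> is_derive z 'e_i (fun w => G w 0 k) (jac_inv F i k (G z)).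
  move=> Fz; have [Ny ey] := FG _ Fz; set y := G z in Ny ey *.
  have Uy : U y by case: (Hd _ Ny).
  set D := jac F y.
  pose C := (`|pd 0 (fun y => F y 0 0) y| + `|pd 1 (fun y => F y 0 0) y| +
    `|pd 0 (fun y => F y 0 1) y| + `|pd 1 (fun y => F y 0 1) y|) / `|D|.
  have C0 : 0 <= C by rewrite /C divr_ge0 // !addr_ge0.
  apply: is_derive_eps => e e0.
  pose M := C * K + 1.
  have M0 : 0 < M by rewrite /M ltr_wpDl // mulr_ge0.
  pose e' := e / M; have e'0 : 0 < e' by rewrite divr_gt0.
  pose rem w k := F w 0 k - F y 0 k -
    lincomb2 (pd 0 (fun y => F y 0 k) y) (pd 1 (fun y => F y 0 k) y) (w - y).
  have Hr : \forall w \near y, forall k, `|rem w k| <= e' * `|w - y|.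
    apply: ord2_ind_near => l; exact: C1_approx oU (sF l 1%N) Uy e'0.
  have Hr' : \forall v \near z, forall k, `|rem (G v) k| <= e' * `|G v - y|.
    exact: (cG z Fz _ Hr).
  have axis_cvg (A : set (plane R)) : nbhs z A -> \forall h \near (0 : R), A (h *: 'e_i + z).
    move=> /nbhs_ballP[r /= r0 HA]; near=> h; apply: HA.
    rewrite -ball_normE /= opprD addrCA subrr addr0 normrN norm_axis.
    near: h; apply/nbhs_ballP; exists r => //= h; rewrite -ball_normE /= sub0r normrN.
    by [].
  have Hr2 := axis_cvg _ Hr'.
  near=> h.
  have Fh : (F @` N) (h *: 'e_i + z).
    by near: h; apply: axis_cvg; exact: open_nbhs_nbhs.
  have Hh : forall k, `|rem (G (h *: 'e_i + z)) k| <= e' * `|G (h *: 'e_i + z) - y|.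
    by near: h.
  set w := G (h *: 'e_i + z) in Hh *.
  have [Nw ew] := FG _ Fh; rewrite -/w in Nw ew.
  have wy : `|w - y| <= K * `|h|.
    by rewrite -(norm_axis h i) -[h *: 'e_i](addrK z) lipG.
  pose r : plane R := \row_k rem w k.
  have rn : `|r| <= e' * (K * `|h|).
    apply/plane_norm_le; first by apply: mulr_ge0; [exact: ltW|exact: mulr_ge0].
    by move=> l; rewrite mxE (le_trans (Hh l)) // ler_wpM2l // ltW.
  have E : w - y = cramer (pd 0 (fun y => F y 0 0) y) (pd 1 (fun y => F y 0 0) y)
      (pd 0 (fun y => F y 0 1) y) (pd 1 (fun y => F y 0 1) y) (h *: 'e_i - r).
    apply/esym/cramerK; first exact: JN0.
      by rewrite /r /rem ew ey /lincomb2 !mxE; ring.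
    by rewrite /r /rem ew ey /lincomb2 !mxE; ring.
  have E2 : w 0 k - y 0 k - h * jac_inv F i k y = - cramer (pd 0 (fun y => F y 0 0) y) (pd 1 (fun y => F y 0 0) y)
      (pd 0 (fun y => F y 0 1) y) (pd 1 (fun y => F y 0 1) y) r 0 k.
    have -> : w 0 k - y 0 k = (w - y) 0 k by rewrite !mxE.
    rewrite E cramerB cramerZ rowZB /jac_inv; ring.
  rewrite E2 normrN (le_trans (plane_norm_ge _ k)) // (le_trans (cramer_norm _ _ _ _ _)) //.
  rewrite -/(jac F y) -/D -/C.
  apply: le_trans (_ : C * (e' * (K * `|h|)) <= _); first by rewrite ler_wpM2l.
  rewrite (_ : C * _ = (C * K) / M * e * `|h|); last by rewrite /e'; ring.
  rewrite ler_wpM2r //; apply: ler_piMl; first exact: ltW.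
  by rewrite ler_pdivrMr // mul1r /M lerDl ler01.
have smG n : forall k, Cn n (F @` N) (fun w => G w 0 k).
  elim: n => [|n IH] k.
    move=> z Fz; apply: (@continuous_comp _ _ _ G (fun v : plane R => v 0 k)); first exact: cG.
    exact: coord_continuous.
  split=> [z Fz i|i]; first by have [] := dG z i k Fz.
  apply: (@Cn_eq _ _ _ (jac_inv F i k \o G)) => //.
    by move=> z; rewrite inE => Fz; exact/esym/is_derive_pd/dG.
  apply: Cn_comp IH => //; first exact: cN.
    by move=> z /FG[].
  apply: Cn_jac_inv => // l.
  by apply: Cn_sub (sF l n.+1) => y /Hd[].
exists N, G; split => //; last by move=> k n; exact: smG.
split=> //; first exact: ballxx.
by move=> y /Hd[].
Unshelve. all: by end_near. Qed.

End InverseFunction.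

(** * Linear ordinary differential equations *)

Section LinearODE.
Variable R : realType.

(** Truncation to [-d, d]. It extends coefficients known on this interval to
    continuous bounded functions on the whole line, so that no domain has to be
    carried along in the iteration below. *)
Definition clamp (d t : R) : R := Num.max (- d) (Num.min d t).

Lemma clamp_lip d s t : `|clamp d s - clamp d t| <= `|s - t|.
Proof.
rewrite /clamp; case: (lerP d s) => ?; case: (lerP d t) => ?;
 repeat match goal with |- context [Num.max ?a ?b] => case: (lerP a b) => ? end;
 rewrite ?subrr ?normr0 ?normr_ge0 // ler_norml; apply/andP; split;
 have := ler_norm (s - t); have := ler_norm (- (s - t)); rewrite normrN; lra.
Qed.

Lemma clamp_norm d t : 0 <= d -> `|clamp d t| <= d.
Proof.
move=> d0; rewrite ler_norml /clamp; case: (lerP d t) => ?;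
 match goal with |- context [Num.max ?a ?b] => case: (lerP a b) => ? end;
 apply/andP; split; lra.
Qed.

Lemma clamp_id d t : `|t| <= d -> clamp d t = t.
Proof.
rewrite ler_norml => /andP[? ?]; rewrite /clamp; case: (lerP d t) => ?;
 case: (lerP (- d) _) => ?; lra.
Qed.

Lemma clamp_continuous d : continuous (clamp d).
Proof.
move=> t; apply/cvgrPdist_le => e e0; near=> s.
apply: le_trans (clamp_lip d t s) _.
near: s; apply/nbhs_ballP; exists e => //= s.
by move=> /ltW.
Unshelve. all: by end_near. Qed.

Lemma mvt_bound (f f' : R -> R) (a B : R) :
  (forall s : R, `|s| <= `|a| -> is_derive s 1 f (f' s)) ->
  (forall s : R, `|s| <= `|a| -> `|f' s| <= B) -> `|f a - f 0| <= `|a| * B.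
Proof.
move=> df fB; have sub s : Num.min 0 a <= s <= Num.max 0 a -> `|s| <= `|a|.
  by case: (lerP 0 a) => ? /andP[? ?]; [rewrite !ger0_norm|rewrite !ler0_norm]; lra.
have [s sa ->] : exists2 s, Num.min 0 a <= s <= Num.max 0 a & f a - f 0 = (a - 0) * f' s.
  by apply: mvt1 => s /sub; exact: df.
by rewrite subr0 normrM ler_wpM2l // fB // sub.
Qed.

Lemma antiderivative (f : R -> R) (d : R) : 0 < d -> continuous f ->
  exists F : R -> R, [/\ continuous F, F 0 = 0,
    forall t : R, `|t| < d -> is_derive t 1 F (f t) &
    forall B, (forall t, `|f t| <= B) -> forall t, `|F t| <= d * B].
Proof.
move=> d0 cf; set mu := @lebesgue_measure R.
pose F0 x := (\int[mu]_(t in [set` `[- (d + 1), x]%R]) (f t))%R.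
have dF0 (x : R) : `|x| <= d -> is_derive x 1 F0 (f x).
  rewrite ler_norml => /andP[x1 x2].
  have [||||h1 h2] := @continuous_FTC1_closed R f (- (d + 1)) x (d + 1); first lra.
  - apply: continuous_compact_integrable; first exact: segment_compact.
    by apply: continuous_subspaceT => y; exact: cf.
  - by lra.
  - exact: cf.
  by rewrite -h2 derive1E; exact: derivableP.
pose F x := F0 (clamp d x) - F0 0.
have n0 : `|0 : R| <= d by rewrite normr0 ltW.
exists F; split.
- move=> x; apply: (@continuousB _ _ _ (fun x => F0 (clamp d x)) (cst (F0 0))); last exact: cst_continuous.
  apply: continuous_comp; first exact: clamp_continuous.
  have [dF _] := dF0 _ (clamp_norm x (ltW d0)).
  exact/differentiable_continuous/derivable1_diffP.
- by rewrite /F clamp_id // subrr.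
- move=> t td; apply: (@near_eq_is_derive _ _ _ (fun x => F0 x - F0 0)).
    have : nbhs t [set s | `|s| < d].
      apply: open_nbhs_nbhs; split=> //.
      by apply: (@open_comp _ _ (fun s : R => `|s|) [set y | y < d]) => [s _|]; [exact: norm_continuous|exact: open_lt].
    by apply: filterS => s /= sd; rewrite /F clamp_id // ltW.
  by rewrite -[f t]subr0; apply: (isdB (dF0 _ (ltW td)) (isdC _ _ _)).
- move=> B fB t; have cd := clamp_norm t (ltW d0).
  apply: le_trans (_ : `|clamp d t| * B <= _); last first.
    by rewrite ler_wpM2r // (le_trans (normr_ge0 _) (fB 0)).
  apply: (@mvt_bound F0 f) => s sc; last exact: fB.
  exact/dF0/(le_trans sc).
Qed.

Lemma geometric_limit (s : nat -> R) (C : R) :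
  (forall n m, `|s (n + m)%N - s n| <= C * 2^-1 ^+ n) ->
  exists l, forall n, `|l - s n| <= C * 2^-1 ^+ n.
Proof.
move=> H; pose E := [set s n - C * 2^-1 ^+ n | n in [set: nat]].
have C0 : 0 <= C by have := le_trans (normr_ge0 _) (H 0%N 0%N); rewrite expr0 mulr1.
have p0 n : 0 <= C * 2^-1 ^+ n by rewrite mulr_ge0 // exprn_ge0 // invr_ge0.
have ub n k : s n - C * 2^-1 ^+ n <= s k + C * 2^-1 ^+ k.
  have [/subnKC e|/ltnW/subnKC e] := leqP n k.
    have := H n (k - n)%N; rewrite e ler_norml => /andP[h _]; have := p0 k; lra.
  have := H k (n - k)%N; rewrite e ler_norml => /andP[_ h]; have := p0 n; lra.
have E0 : E !=set0 by exists (s 0%N - C * 2^-1 ^+ 0); exists 0%N.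
have hs : has_sup E by split=> //; exists (s 0%N + C * 2^-1 ^+ 0) => _ [n _ <-].
exists (sup E) => n; rewrite ler_norml; apply/andP; split.
  have : s n - C * 2^-1 ^+ n <= sup E by apply: sup_upper_bound => //; exists n.
  lra.
have : sup E <= s n + C * 2^-1 ^+ n by apply: ge_sup => // _ [k _ <-].
lra.
Qed.

Lemma geometric_small (C e : R) : 0 < e -> exists n, C * 2^-1 ^+ n <= e.
Proof.
move=> e0; have [n hn] : exists n : nat, C / e <= n%:R.
  by exists (Num.bound `|C / e|); rewrite (le_trans (ler_norm _)) // ltW // archi_boundP.
exists n; rewrite exprVn ler_pdivrMr ?exprn_gt0 // mulrC -ler_pdivrMr // (le_trans hn) //.
by rewrite -natrX ler_nat ltnW // ltn_expl.
Qed.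

Lemma le_of_geometric (a C : R) : (forall n, a <= C * 2^-1 ^+ n) -> a <= 0.
Proof.
move=> H; apply/ler_addgt0Pl => e e0; rewrite addr0.
by have [n hn] := geometric_small C e0; exact: le_trans (H n) hn.
Qed.

Lemma uniform_geometric_continuous (s : nat -> R -> R) (u : R -> R) (C : R) :
  (forall n, continuous (s n)) -> (forall n t, `|u t - s n t| <= C * 2^-1 ^+ n) ->
  continuous u.
Proof.
move=> cs H t; apply/cvgrPdist_le => e e0.
have e30 : 0 < e / 3 by rewrite divr_gt0.
have [n hn] := geometric_small C e30.
have : \forall y \near t, `|s n t - s n y| <= e / 3.
  by move/cvgrPdist_le: (cs n t) => /(_ _ e30).
apply: filterS => y hy.
have := le_trans (H n t) hn; have := le_trans (H n y) hn; move: hy.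
rewrite !ler_norml => /andP[? ?] /andP[? ?] /andP[? ?]; apply/andP; split; lra.
Qed.

Lemma sum_bound (I : finType) (F : I -> R) (B : R) : (forall i, `|F i| <= B) ->
  `|\sum_i F i| <= #|I|%:R * B.
Proof.
move=> H; apply: le_trans (ler_norm_sum _ _ _) _.
apply: le_trans (_ : \sum_(i : I) B <= _); first exact: ler_sum.
by rewrite sumr_const mulr_natl.
Qed.

Lemma continuous_sum (T : topologicalType) (I : Type) (r : seq I) (F : I -> T -> R) (t : T) :
  (forall i, {for t, continuous (F i)}) ->
  {for t, continuous (fun s => \sum_(i <- r) F i s)}.
Proof.
move=> cF; elim: r => [|i r IH].
  rewrite (_ : (fun s => _) = fun=> 0); first exact: cst_continuous.
  by apply/funext => s; rewrite big_nil.
rewrite (_ : (fun s => _) = fun s => F i s + \sum_(j <- r) F j s); first exact: continuousD.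
by apply/funext => s; rewrite big_cons.
Qed.

(** Picard iteration: the terms v_n of the series are iterated integrals, which
    decrease geometrically since the interval is short. The sum u is continuous,
    and it equals the integral of its right-hand side, because both are
    approximated by the partial sums of the series. *)
Lemma linear_ode (I : finType) (A : I -> I -> R -> R) (M d : R) (u0 : I -> R) :
  0 < d -> (forall i j, continuous (A i j)) -> (forall i j t, `|A i j t| <= M) ->
  #|I|%:R * M * d <= 2^-1 ->
  exists u : I -> R -> R, (forall i, u i 0 = u0 i) /\
    forall i (t : R), `|t| < d -> is_derive t 1 (u i) (\sum_j A i j t * u j t).
Proof.
move=> d0 cA AM small.
have [P HP] : exists P : (R -> R) -> R -> R, forall f, continuous f ->
    [/\ continuous (P f), P f 0 = 0, forall t : R, `|t| < d -> is_derive t 1 (P f) (f t) &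
     forall B, (forall t, `|f t| <= B) -> forall t, `|P f t| <= d * B].
  have /choice [P HP] : forall f : R -> R, exists F : R -> R, continuous f ->
    [/\ continuous F, F 0 = 0, forall t : R, `|t| < d -> is_derive t 1 F (f t) &
     forall B, (forall t, `|f t| <= B) -> forall t, `|F t| <= d * B].
    move=> f; case: (pselect (continuous f)) => [cf|ncf]; last by exists f.
    by have [F HF] := antiderivative d0 cf; exists F.
  by exists P.
pose rhs (v : I -> R -> R) i t := \sum_j A i j t * v j t.
have c_rhs v i : (forall j, continuous (v j)) -> continuous (rhs v i).
  move=> cv t; apply: (@continuous_sum _ _ _ (fun j t => A i j t * v j t)) => j.
  by apply: continuousM; [exact: cA|exact: cv].
pose v := fix v n : I -> R -> R :=
  if n is n'.+1 then fun i => P (rhs (v n') i) else fun i _ => u0 i.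
have cv n : forall i, continuous (v n i).
  elim: n => [|n IH] i; first exact: cst_continuous.
  by have [] := HP _ (c_rhs _ i IH).
pose B := \sum_i `|u0 i|.
have B0 : 0 <= B by apply: sumr_ge0.
have vB n : forall i t, `|v n i t| <= B * 2^-1 ^+ n.
  elim: n => [|n IH] i t.
    by rewrite expr0 mulr1 /B (bigD1 i) //= lerDl sumr_ge0.
  have [_ _ _ H] := HP _ (c_rhs _ i (cv n)).
  apply: le_trans (H (#|I|%:R * (M * (B * 2^-1 ^+ n))) _ t) _.
    move=> s; apply: sum_bound => j; rewrite normrM ler_pM //; exact: IH.
  have -> : d * (#|I|%:R * (M * (B * 2^-1 ^+ n))) = (#|I|%:R * M * d) * (B * 2^-1 ^+ n) by ring.
  by rewrite exprS [leRHS]mulrCA ler_wpM2r // mulr_ge0 // exprn_ge0 // invr_ge0.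
pose s n i t := \sum_(k < n) v k i t.
have cs n i : continuous (s n i).
  move=> t; apply: (@continuous_sum _ _ _ (fun (k : 'I_n) t => v k i t)) => k; exact: cv.
have sS n i t : s n.+1 i t = s n i t + v n i t by rewrite /s big_ord_recr.
have sC i t n m : `|s (n + m)%N i t - s n i t| <= (2 * B) * 2^-1 ^+ n.
  apply: le_trans (_ : 2 * B * 2^-1 ^+ n - 2 * B * 2^-1 ^+ (n + m) <= _); last first.
    by rewrite gerBl mulr_ge0 // ?mulr_ge0 // exprn_ge0 // invr_ge0.
  elim: m => [|m IH]; first by rewrite addn0 !subrr normr0.
  rewrite addnS sS addrAC; apply: le_trans (ler_normD _ _) _.
  have := vB (n + m)%N i t; rewrite exprS; move: IH.
  set x := `|_|; set y := `|_|; set a := _ ^+ n; set b := _ ^+ _ => h1 h2.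
  have -> : 2 * B * (2^-1 * b) = B * b by field.
  lra.
have /choice [u0' Hu] : forall it : I * R, exists l, forall n, `|l - s n it.1 it.2| <= 2 * B * 2^-1 ^+ n.
  by move=> [i t]; exact: geometric_limit (sC i t).
pose u i t := u0' (i, t).
have us i n t : `|u i t - s n i t| <= 2 * B * 2^-1 ^+ n := Hu (i, t) n.
have cu i : continuous (u i).
  exact: (@uniform_geometric_continuous (fun n => s n i) (u i) (2 * B)).
pose w i t := u0 i + P (rhs u i) t.
have uw i t : `|t| < d -> u i t = w i t.
  move=> td; have [_ P0 dP _] := HP _ (c_rhs _ i cu).
  apply/eqP; rewrite -subr_eq0 -normr_le0; apply: (@le_of_geometric _ (2 * B)) => n.
  (* The (n+1)-st partial sum s is u0 plus the integral of the right-hand side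
     along the n-th one; D compares it with the integral w for u itself. *)
  pose D t := s n.+1 i t - w i t.
  have D0 : D 0 = 0.
    rewrite /D /w P0 addr0 /s big_ord_recl /= big1 ?addr0 ?subrr // => k _.
    by have [_ -> _ _] := HP _ (c_rhs _ i (cv k)).
  have dD (r : R) : `|r| < d -> is_derive r 1 D (rhs (fun j => s n j) i r - rhs u i r).
    move=> rd; rewrite -[rhs u i r]add0r /rhs.
    apply: isdB; last exact: (isdD (isdC _ _ _) (dP _ rd)).
    have -> : s n.+1 i = fun t => u0 i + \sum_(k < n) P (rhs (v k) i) t.
      by apply/funext => t'; rewrite /s big_ord_recl.
    have -> : \sum_j A i j r * s n j r = 0 + \sum_(k < n) rhs (v k) i r.
      rewrite add0r /rhs exchange_big /=; apply: eq_bigr => j _.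
      by rewrite /s mulr_sumr.
    apply: (isdD (isdC (u0 i) r 1)); apply: isd_sum => k.
    by have [_ _ + _] := HP _ (c_rhs _ i (cv k)); apply.
  have bD : `|D t| <= B * 2^-1 ^+ n.
    rewrite -[D t]subr0 -D0.
    apply: le_trans (_ : `|t| * (#|I|%:R * (M * (2 * B * 2^-1 ^+ n))) <= _).
      apply: (mvt_bound (f' := fun r => rhs (fun j => s n j) i r - rhs u i r)) => r rt.
        by apply: dD; exact: le_lt_trans rt td.
      rewrite /rhs -sumrB; apply: sum_bound => j.
      by rewrite -mulrBr normrM ler_pM // distrC us.
    rewrite (_ : `|t| * _ = (#|I|%:R * M * `|t|) * 2 * (B * 2^-1 ^+ n)); last by ring.
    have M0 : 0 <= M by apply: le_trans (AM i i 0).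
    rewrite -[leRHS]mul1r ler_wpM2r //; first by rewrite mulr_ge0 // exprn_ge0 // invr_ge0.
    have : #|I|%:R * M * `|t| <= #|I|%:R * M * d by rewrite ler_wpM2l ?mulr_ge0 // ltW.
    lra.
  have := us i n.+1 t; rewrite -(subrKA (s n.+1 i t)).
  move=> h; apply: le_trans (ler_normD _ _) _.
  rewrite -/(D t); move: h; rewrite exprS; move: bD; set a := _ ^+ n.
  have -> : 2 * B * (2^-1 * a) = B * a by field.
  have : 0 <= a by rewrite exprn_ge0 // invr_ge0.
  lra.
exists w; split=> [i|i t td].
  by have [_ P0 _ _] := HP _ (c_rhs _ i cu); rewrite /w P0 addr0.
have [_ _ dP _] := HP _ (c_rhs _ i cu).
have -> : \sum_j A i j t * w j t = 0 + rhs u i t.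
  by rewrite add0r; apply: eq_bigr => j _; rewrite uw.
exact: (isdD (isdC _ _ _) (dP _ td)).
Qed.

(** On a short interval no exponential is needed: integrate at the maximum c of
    the sum of the |E j| and absorb the half of it that reappears. *)
Lemma gronwall (I : finType) (E E' : I -> R -> R) (d M r e0 : R) :
  0 < d -> 0 <= M -> 0 <= r ->
  (forall i (t : R), `|t| < d -> is_derive t 1 (E i) (E' i t)) ->
  (forall i (t : R), `|t| < d -> `|E' i t| <= M * (\sum_j `|E j t|) + r) ->
  (forall i, `|E i 0| <= e0) -> #|I|%:R * M * d <= 2^-1 ->
  forall i (t : R), `|t| < d -> `|E i t| <= 2 * #|I|%:R * (e0 + d * r).
Proof.
move=> d0 M0 r0 dE E'b E0 small i t td.
pose N s := \sum_j `|E j s|.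
have cE j s : `|s| < d -> {for s, continuous (E j)}.
  by move=> /(dE j s) [dEs _]; exact/differentiable_continuous/derivable1_diffP.
have [c] : exists2 c, c \in `[- `|t|, `|t|]%R & forall s, s \in `[- `|t|, `|t|]%R -> N s <= N c.
  apply: EVT_max; first by have := normr_ge0 t; lra.
  apply: continuous_in_subspaceT => s; rewrite inE /= in_itv /= -ler_norml => st.
  apply: (@continuous_sum _ _ _ (fun j s => `|E j s|)) => j.
  apply: (@continuous_comp _ _ _ (E j) (fun x : R => `|x|)); last exact: norm_continuous.
  by apply: cE; exact: le_lt_trans td.
rewrite in_itv /= -ler_norml => ct Nmax.
have cd : `|c| < d := le_lt_trans ct td.
have Ec j : `|E j c| <= e0 + d * (M * N c + r).
  rewrite -[E j c](subrK (E j 0)) addrC; apply: le_trans (ler_normD _ _) _.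
  rewrite lerD //; apply: le_trans (_ : `|c| * (M * N c + r) <= _).
    apply: (mvt_bound (f' := E' j)) => s sc; first by apply: dE; exact: le_lt_trans cd.
    apply: le_trans (E'b _ _ (le_lt_trans sc cd)) _; rewrite lerD2r ler_wpM2l //.
    by apply: Nmax; rewrite in_itv /= -ler_norml; exact: le_trans ct.
  apply: ler_wpM2r; last exact: ltW.
  by apply: addr_ge0 => //; apply: mulr_ge0 => //; exact: sumr_ge0.
have Nc : N c <= #|I|%:R * (e0 + d * (M * N c + r)).
  apply: le_trans (_ : \sum_(j : I) (e0 + d * (M * N c + r)) <= _).
    exact: ler_sum.
  by rewrite sumr_const mulr_natl.
have Nit : `|E i t| <= N t by rewrite /N (bigD1 i) //= lerDl sumr_ge0.
have Ntc : N t <= N c by apply: Nmax; rewrite in_itv /= -ler_norml.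
apply: le_trans Nit _; apply: le_trans Ntc _.
have Nc0 : 0 <= N c by apply: sumr_ge0.
have : #|I|%:R * M * d * N c <= 2^-1 * N c by rewrite ler_wpM2r.
move: Nc; set k : R := #|I|%:R => Nc.
have e1 : k * (e0 + d * (M * N c + r)) = k * (e0 + d * r) + k * M * d * N c by ring.
rewrite {}e1 in Nc; rewrite -mulrA; lra.
Qed.

End LinearODE.

(** * Flat linear systems in the plane *)

Section Frobenius.
Variable R : realType.
Implicit Types (x y p : plane R) (U : set (plane R)).

Lemma is_derive_epsP (V : normedModType R) (f : V -> R) (x v : V) (c e : R) :
  is_derive x v f c -> 0 < e ->
  \forall h \near (0 : R), `|f (h *: v + x) - f x - h * c| <= e * `|h|.
Proof.
move=> [dv <-] e0.
have /cvgrPdist_le/(_ _ e0) : h^-1 *: (f (h *: v + x) - f x) @[h --> 0^'] --> 'D_v f x.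
  exact: dv.
move=> /nbhs_ballP[r /= r0 H]; apply/nbhs_ballP; exists r => //= h hr.
have [->|h0] := eqVneq h 0.
  by rewrite scale0r add0r subrr mul0r subrr normr0 mulr0.
have := H h hr h0; rewrite distrC => H'.
have hp : 0 < `|h| by rewrite normr_gt0.
rewrite -(ler_pM2l hp) -normrM mulrBr /GRing.scale /= mulVKf // in H'.
by rewrite [leRHS]mulrC.
Qed.

Lemma local_bound (I : finType) (f : I -> plane R -> R) U p : open U -> U p ->
  (forall i, Cn 0 U (f i)) ->
  exists M d, [/\ 0 < M, 0 < d, ball p d `<=` U &
    forall i x, ball p d x -> `|f i x| <= M].
Proof.
move=> oU Up cf; pose M := 1 + \sum_i (`|f i p| + 1).
have near1 i : \forall x \near p, `|f i x| <= `|f i p| + 1.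
  have : \forall x \near p, `|f i x - f i p| <= 1 by apply: near_dist_le => //; exact: cf.
  apply: filterS => x h; rewrite -[f i x](subrK (f i p)) addrC.
  by apply: le_trans (ler_normD _ _) _; rewrite lerD2l.
have near2 : \forall x \near p, forall i, `|f i x| <= `|f i p| + 1.
  by apply: (@filter_forall _ _ _ (nbhs p)).
have /nbhs_ballP[d /= d0 Hd] : nbhs p ((fun x => forall i, `|f i x| <= `|f i p| + 1) `&` U).
  by apply: filterI; [exact: near2|exact: open_nbhs_nbhs].
have pos i : 0 <= `|f i p| + 1 by rewrite addr_ge0.
exists M, d; split=> //.
- by rewrite /M ltr_pwDl // sumr_ge0.
- by move=> x /Hd[].
- move=> i x /Hd[/(_ i) h _]; apply: le_trans h _.
  rewrite /M (bigD1 i) //= addrCA lerDl addr_ge0 // sumr_ge0 //.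
Qed.

Lemma gronwall0 (I : finType) (E E' : I -> R -> R) (d M e0 : R) :
  0 < d -> 0 <= M ->
  (forall i (t : R), `|t| < d -> is_derive t 1 (E i) (E' i t)) ->
  (forall i (t : R), `|t| < d -> `|E' i t| <= M * (\sum_j `|E j t|)) ->
  (forall i, `|E i 0| <= e0) -> #|I|%:R * M * d <= 2^-1 ->
  forall i (t : R), `|t| < d -> `|E i t| <= 2 * #|I|%:R * e0.
Proof.
move=> d0 M0 dE E'b E0 small i t td.
have := gronwall d0 M0 (lexx 0) dE _ E0 small i td; rewrite mulr0 addr0; apply.
by move=> j s sd; rewrite addr0; exact: E'b.
Qed.

Lemma plane_subE (u v : plane R) k : (u - v) 0 k = u 0 k - v 0 k.
Proof. by rewrite !mxE. Qed.

(** The point p + (s, t), as a function of two scalars: the equations are solved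
    along lines parallel to the axes. *)
Definition shift2 p (s t : R) : plane R := mkpt (p 0 0 + s) (p 0 1 + t).

Lemma shift2_ball p d s t : `|s| < d -> `|t| < d -> ball p d (shift2 p s t).
Proof.
move=> sd td; apply/plane_ballP; apply: ord2P; rewrite ?mkpt0 ?mkpt1;
  by rewrite opprD addrA subrr add0r normrN.
Qed.

Lemma shift2_coord p x : shift2 p (x 0 0 - p 0 0) (x 0 1 - p 0 1) = x.
Proof. by apply: plane_eqP; rewrite ?mkpt0 ?mkpt1 addrC subrK. Qed.

Lemma shift2_derive0 p f s t : derivable f (shift2 p s t) 'e_0 ->
  is_derive s 1 (fun s => f (shift2 p s t)) (pd 0 f (shift2 p s t)).
Proof.
have E u : shift2 p u t = u *: 'e_0 + shift2 p 0 t.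
  by apply: plane_eqP; rewrite axisE ?mkpt0 ?mkpt1 /= ?mulr1 ?mulr0; ring.
have -> : (fun s => f (shift2 p s t)) = (fun s => f (s *: 'e_0 + shift2 p 0 t)).
  by apply/funext => u; rewrite E.
by rewrite E; exact: line_derive.
Qed.

Lemma shift2_derive1 p f s t : derivable f (shift2 p s t) 'e_1 ->
  is_derive t 1 (fun t => f (shift2 p s t)) (pd 1 f (shift2 p s t)).
Proof.
have E u : shift2 p s u = u *: 'e_1 + shift2 p s 0.
  by apply: plane_eqP; rewrite axisE ?mkpt0 ?mkpt1 /= ?mulr1 ?mulr0; ring.
have -> : (fun t => f (shift2 p s t)) = (fun t => f (t *: 'e_1 + shift2 p s 0)).
  by apply/funext => u; rewrite E.
by rewrite E; exact: line_derive.
Qed.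

(** Grönwall's estimate along the horizontal axis through p, then along
    vertical lines; hence the two factors. *)
Lemma gronwall_plane (I : finType) (A : 'I_2 -> I -> I -> plane R -> R)
    (q : I -> plane R -> R) (p : plane R) (M d e0 : R) : 0 < d -> 0 <= M ->
  (forall x k i, ball p d x -> is_derive x 'e_k (q i) (\sum_j A k i j x * q j x)) ->
  (forall x k i j, ball p d x -> `|A k i j x| <= M) ->
  #|I|%:R * M * d <= 2^-1 -> (forall i, `|q i p| <= e0) ->
  forall i x, ball p d x -> `|q i x| <= 2 * #|I|%:R * (2 * #|I|%:R * e0).
Proof.
move=> d0 M0 dq AM small q0 i x px.
have n0 : `|0 : R| < d by rewrite normr0.
have rhs_le k i' y : ball p d y ->
    `|\sum_j A k i' j y * q j y| <= M * (\sum_j `|q j y|).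
  move=> py; rewrite mulr_sumr; apply: le_trans (ler_norm_sum _ _ _) _.
  by apply: ler_sum => j _; rewrite normrM ler_wpM2r // AM.
have pdq y k i' : ball p d y -> pd k (q i') y = \sum_j A k i' j y * q j y.
  by move=> /dq /is_derive_pd; apply.
have H0 i' s : `|s| < d -> `|q i' (shift2 p s 0)| <= 2 * #|I|%:R * e0.
  move=> sd; apply: (@gronwall0 _ (fun i s => q i (shift2 p s 0))
    (fun i s => pd 0 (q i) (shift2 p s 0)) d M e0) => //.
  - move=> j r rd; apply: shift2_derive0.
    by have [] := dq _ 0 j (shift2_ball p rd n0).
  - by move=> j r rd; rewrite pdq; [apply: rhs_le|]; exact: shift2_ball.
  - by move=> j; rewrite /shift2 !addr0 (_ : mkpt _ _ = p) //; apply: plane_eqP; rewrite ?mkpt0 ?mkpt1.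
have /plane_ballP px' := px.
have nx k : `|x 0 k - p 0 k| < d by rewrite distrC.
rewrite -(shift2_coord p x).
apply: (@gronwall0 _ (fun i t => q i (shift2 p (x 0 0 - p 0 0) t))
    (fun i t => pd 1 (q i) (shift2 p (x 0 0 - p 0 0) t)) d M) => //.
- move=> j r rd; apply: shift2_derive1.
  by have [] := dq _ 1 j (shift2_ball p (nx 0) rd).
- by move=> j r rd; rewrite pdq; [apply: rhs_le|]; exact: shift2_ball.
- by move=> j; exact: H0.
Qed.

Section Core.
Variables (I : finType) (A : 'I_2 -> I -> I -> plane R -> R) (U : set (plane R)).
Variables (p : plane R) (M d d1 : R).
Hypothesis oU : open U.
Hypothesis cA : forall k i j, Cn 2 U (A k i j).
Hypothesis d0 : 0 < d.
Hypothesis dd1 : d < d1.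
Hypothesis M0 : 0 < M.
Hypothesis bU : ball p d1 `<=` U.
Hypothesis AM : forall k i j x, ball p d1 x -> `|A k i j x| <= M.
Hypothesis dAM : forall l k i j x, ball p d1 x -> `|pd l (A k i j) x| <= M.
Hypothesis ddAM : forall m l k i j x, ball p d1 x -> `|pd m (pd l (A k i j)) x| <= M.
Hypothesis small : #|I|%:R * M * d <= 2^-1.
Hypothesis flat : forall x i j, U x ->
  pd 0 (A 1 i j) x + \sum_l A 1 i l x * A 0 l j x =
  pd 1 (A 0 i j) x + \sum_l A 0 i l x * A 1 l j x.

Let q := shift2 p.
Let kk : R := #|I|%:R.

Let qb s t : `|s| <= d -> `|t| <= d -> ball p d1 (q s t).
Proof. by move=> sd td; apply: shift2_ball; [apply: le_lt_trans sd _|apply: le_lt_trans td _]. Qed.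

Let dA k i j x l : ball p d1 x -> derivable (A k i j) x 'e_l.
Proof. by move=> /bU; exact: Cn_derivable (cA k i j). Qed.

Let ddA k i j m x l : ball p d1 x -> derivable (pd m (A k i j)) x 'e_l.
Proof. by move=> /bU; exact: Cn_derivable (Cn_pd m (cA k i j)). Qed.

Let cAq (k : 'I_2) i j (g : R -> plane R) : (forall t, ball p d1 (g t)) ->
  (forall s t, `|g s - g t| <= `|s - t|) -> continuous (fun t => A k i j (g t)).
Proof.
move=> gb gl t; apply: (@continuous_comp _ _ _ g (A k i j)); last first.
  by apply: (Cn_le (n := 2) (m := 0) oU _ (cA k i j)) => //; exact: bU.
apply/cvgrPdist_le => e e0; near=> s; apply: le_trans (gl _ _) _.
near: s; apply/nbhs_ballP; exists e => //= s.
by move=> /ltW.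
Unshelve. all: by end_near. Qed.

(* The clamped argument extends the coefficients beyond the interval. *)
Let horizontal (u0 : I -> R) : exists v : I -> R -> R, (forall i, v i 0 = u0 i) /\
  forall i (s : R), `|s| < d -> is_derive s 1 (v i) (\sum_j A 0 i j (q s 0) * v j s).
Proof.
pose g s := q (clamp d s) 0.
have gb s : ball p d1 (g s) by apply: qb; rewrite ?clamp_norm ?normr0 // ltW.
have gl s t : `|g s - g t| <= `|s - t|.
  apply/plane_norm_le => //; apply: ord2P; rewrite /g /q /shift2 plane_subE ?mkpt0 ?mkpt1.
    by rewrite opprD addrACA subrr add0r clamp_lip.
  by rewrite subrr normr0.
have cAg i j : continuous (fun s => A 0 i j (g s)) by exact: cAq.
have AMg i j t : `|A 0 i j (g t)| <= M by apply: AM; exact: gb.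
have [v [v0 dv]] := linear_ode u0 d0 cAg AMg small.
exists v; split=> // i s sd; have := dv i s sd.
by rewrite /g clamp_id // ltW.
Qed.

Let vertical (s : R) (u0 : I -> R) : `|s| < d -> exists w : I -> R -> R, (forall i, w i 0 = u0 i) /\
  forall i (t : R), `|t| < d -> is_derive t 1 (w i) (\sum_j A 1 i j (q s t) * w j t).
Proof.
move=> sd; pose g t := q s (clamp d t).
have gb t : ball p d1 (g t) by apply: qb; rewrite ?clamp_norm // ltW.
have gl r t : `|g r - g t| <= `|r - t|.
  apply/plane_norm_le => //; apply: ord2P; rewrite /g /q /shift2 plane_subE ?mkpt0 ?mkpt1.
    by rewrite subrr normr0.
  by rewrite opprD addrACA subrr add0r clamp_lip.
have cAg i j : continuous (fun s => A 1 i j (g s)) by exact: cAq.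
have AMg i j t : `|A 1 i j (g t)| <= M by apply: AM; exact: gb.
have [v [v0 dv]] := linear_ode u0 d0 cAg AMg small.
exists v; split=> // i t td; have := dv i t td.
by rewrite /g clamp_id // ltW.
Qed.

Let between (s h z : R) : `|s| < d -> `|s + h| < d ->
  Num.min s (s + h) <= z <= Num.max s (s + h) -> `|z| < d /\ `|z - s| <= `|h|.
Proof.
rewrite !ltr_norml => /andP[? ?] /andP[? ?].
case: (lerP s (s + h)) => hs /andP[? ?]; split; try (by apply/andP; split; lra).
  by rewrite !ger0_norm; lra.
by rewrite !ler0_norm; lra.
Qed.

(* First and second order Taylor bounds for the coefficients in the horizontal
   direction. *)
Let increment k i j s h t : `|s| < d -> `|s + h| < d -> `|t| < d ->
  `|A k i j (q (s + h) t) - A k i j (q s t)| <= M * `|h| /\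
  `|A k i j (q (s + h) t) - A k i j (q s t) - h * pd 0 (A k i j) (q s t)| <= M * `|h| * `|h|.
Proof.
move=> sd shd td.
have qbz z : Num.min s (s + h) <= z <= Num.max s (s + h) -> ball p d1 (q z t).
  by move=> /(between sd shd)[zd _]; apply: qb; exact: ltW.
have [z zI ->] : exists2 z, Num.min s (s + h) <= z <= Num.max s (s + h) &
    A k i j (q (s + h) t) - A k i j (q s t) = (s + h - s) * pd 0 (A k i j) (q z t).
  apply: (@mvt1 _ (fun s => A k i j (q s t)) (fun z => pd 0 (A k i j) (q z t))) => z zI.
  by apply: shift2_derive0; apply: dA; exact: qbz.
have -> : s + h - s = h by rewrite addrAC subrr add0r.
split; first by rewrite normrM mulrC ler_wpM2r //; apply: dAM; exact: qbz.
rewrite -mulrBr normrM mulrC ler_wpM2r //.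
have [zd zh] := between sd shd zI.
have [w wI ->] : exists2 w, Num.min s z <= w <= Num.max s z &
    pd 0 (A k i j) (q z t) - pd 0 (A k i j) (q s t) = (z - s) * pd 0 (pd 0 (A k i j)) (q w t).
  apply: (@mvt1 _ (fun s => pd 0 (A k i j) (q s t)) (fun z => pd 0 (pd 0 (A k i j)) (q z t))) => w wI.
  apply: shift2_derive0; apply: ddA; apply: qb; last exact: ltW.
  have := @between s (z - s) w sd; rewrite addrC subrK => /(_ zd wI)[wd _]; exact: ltW.
have qw : ball p d1 (q w t).
  apply: qb; last exact: ltW.
  have := @between s (z - s) w sd; rewrite addrC subrK => /(_ zd wI)[wd _]; exact: ltW.
by rewrite normrM mulrC ler_pM // ddAM.
Qed.

(** Solve along the horizontal axis (v), then along every vertical line (W).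
    The vertical equation holds by construction. For the horizontal one let V be
    the expected derivative: by flatness it solves the vertical equation
    differentiated in s, so the remainder W (s + h) - W s - h V satisfies a
    linear equation with an error of order h^2 and with initial value o(h), and
    Grönwall's estimate makes it o(h) everywhere. *)
Lemma frobenius_core (u0 : I -> R) : exists u : I -> plane R -> R,
  (forall i, u i p = u0 i) /\
  forall x k i, ball p d x -> is_derive x 'e_k (u i) (\sum_j A k i j x * u j x).
Proof.
have [v [v0 dv]] := horizontal u0.
have /choice [W HW] : forall s, exists w : I -> R -> R, `|s| < d ->
    (forall i, w i 0 = v i s) /\
    forall i (t : R), `|t| < d -> is_derive t 1 (w i) (\sum_j A 1 i j (q s t) * w j t).
  move=> s; case: (ltP `|s| d) => [sd|_]; last by exists (fun _ _ => 0).
  by have [w Hw] := vertical (fun i => v i s) sd; exists w.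
pose V s i t := \sum_j A 0 i j (q s t) * W s j t.
have n0 : `|0 : R| < d by rewrite normr0.
have kk0 : 0 <= kk by [].
pose B0 := \sum_i `|u0 i|.
pose Bw := 2 * kk * (2 * kk * B0).
have B00 : 0 <= B0 by apply: sumr_ge0.
have Bw0 : 0 <= Bw by rewrite /Bw !mulr_ge0.
have rhs_le k (y : I -> R) x i : ball p d1 x ->
    `|\sum_j A k i j x * y j| <= M * (\sum_j `|y j|).
  move=> px; rewrite mulr_sumr; apply: le_trans (ler_norm_sum _ _ _) _.
  by apply: ler_sum => j _; rewrite normrM ler_wpM2r // AM.
have vB i s : `|s| < d -> `|v i s| <= 2 * kk * B0.
  move=> sd.
  apply: (@gronwall0 _ v (fun i s => \sum_j A 0 i j (q s 0) * v j s) d M B0) => //.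
  - exact: ltW.
  - by move=> j r rd; apply: rhs_le; apply: qb; exact: ltW.
  - by move=> j; rewrite v0 /B0 (bigD1 j) //= lerDl sumr_ge0.
have WB i s t : `|s| < d -> `|t| < d -> `|W s i t| <= Bw.
  move=> sd td; have [W0 dW] := HW s sd.
  apply: (@gronwall0 _ (W s) (fun i t => \sum_j A 1 i j (q s t) * W s j t) d M) => //.
  - exact: ltW.
  - by move=> j r rd; apply: rhs_le; apply: qb; exact: ltW.
  - by move=> j; rewrite W0 vB.
have VB i s t : `|s| < d -> `|t| < d -> `|V s i t| <= kk * (M * Bw).
  move=> sd td; apply: sum_bound => j; rewrite normrM ler_pM // ?WB //.
  by apply: AM; apply: qb; exact: ltW.
(* Flatness rewrites the vertical derivative of V. *)
have dV i (s t : R) : `|s| < d -> `|t| < d -> is_derive t 1 (V s i)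
    (\sum_j (pd 0 (A 1 i j) (q s t) * W s j t + A 1 i j (q s t) * V s j t)).
  move=> sd td; have [_ dW] := HW s sd.
  have qst : ball p d1 (q s t) by apply: qb; exact: ltW.
  apply: (is_derive_eq (f' := \sum_j (pd 1 (A 0 i j) (q s t) * W s j t +
    A 0 i j (q s t) * \sum_l A 1 j l (q s t) * W s l t))).
    apply: isd_sum => j; apply: isdM; last exact: dW.
    by apply: shift2_derive1; exact: dA.
  have swap (P Q : I -> I -> R) (y : I -> R) :
      \sum_j P i j * (\sum_l Q j l * y l) = \sum_l (\sum_j P i j * Q j l) * y l.
    under eq_bigr => j _ do rewrite mulr_sumr.
    rewrite exchange_big /=; apply: eq_bigr => l _; rewrite mulr_suml.
    by apply: eq_bigr => j _; rewrite mulrA.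
  rewrite !big_split /= /V.
  rewrite (swap (fun i j => A 0 i j (q s t)) (fun i j => A 1 i j (q s t))).
  rewrite (swap (fun i j => A 1 i j (q s t)) (fun i j => A 0 i j (q s t))).
  rewrite -!big_split /=; apply: eq_bigr => j _.
  by rewrite -!mulrDl -flat //; exact: bU.
pose C := kk * (M * Bw) + kk * (M * (kk * (M * Bw))).
have C0 : 0 <= C.
  by rewrite /C addr_ge0 // !mulr_ge0 // ltW.
(* The remainder, with e1 its bound on the horizontal axis. *)
have est i (s t h e1 : R) : `|s| < d -> `|s + h| < d -> `|t| < d ->
    (forall j, `|v j (s + h) - v j s - h * V s j 0| <= e1) ->
    `|W (s + h) i t - W s i t - h * V s i t| <= 2 * kk * (e1 + d * (C * `|h| * `|h|)).
  move=> sd shd td He; have [W0 dW] := HW s sd; have [W0' dW'] := HW _ shd.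
  apply: (@gronwall R I (fun i t => W (s + h) i t - W s i t - h * V s i t)
    (fun i t => \sum_j A 1 i j (q (s + h) t) * W (s + h) j t -
      \sum_j A 1 i j (q s t) * W s j t - (0 * V s i t + h *
      \sum_j (pd 0 (A 1 i j) (q s t) * W s j t + A 1 i j (q s t) * V s j t)))
    d M (C * `|h| * `|h|) e1) => //; first exact: ltW; first by rewrite !mulr_ge0.
  - move=> j r rd; apply: isdB; first by apply: isdB; [exact: dW'|exact: dW].
    exact: (isdM (isdC h r 1) (dV j s r sd rd)).
  - move=> l r rd.
    have -> : \sum_j A 1 l j (q (s + h) r) * W (s + h) j r -
       \sum_j A 1 l j (q s r) * W s j r - (0 * V s l r + h *
       \sum_j (pd 0 (A 1 l j) (q s r) * W s j r + A 1 l j (q s r) * V s j r)) =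
       \sum_j A 1 l j (q (s + h) r) * (W (s + h) j r - W s j r - h * V s j r) +
       (\sum_j (A 1 l j (q (s + h) r) - A 1 l j (q s r) - h * pd 0 (A 1 l j) (q s r)) * W s j r +
        \sum_j h * (A 1 l j (q (s + h) r) - A 1 l j (q s r)) * V s j r).
      rewrite mul0r add0r mulr_sumr -!sumrB -!big_split /=; apply: eq_bigr => j _; ring.
    apply: le_trans (ler_normD _ _) _; apply: lerD.
      have := @rhs_le 1 (fun j => W (s + h) j r - W s j r - h * V s j r) (q (s + h) r) l.
      by apply; apply: qb; exact: ltW.
    rewrite /C mulrDl mulrDl; apply: le_trans (ler_normD _ _) _; apply: lerD.
      have -> : kk * (M * Bw) * `|h| * `|h| = kk * (M * `|h| * `|h| * Bw) by ring.
      apply: sum_bound => j; rewrite normrM ler_pM // ?WB //.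
      by have [] := increment 1 l j sd shd rd.
    have -> : kk * (M * (kk * (M * Bw))) * `|h| * `|h| =
      kk * (`|h| * (M * `|h|) * (kk * (M * Bw))) by ring.
    apply: sum_bound => j; rewrite 2!normrM ler_pM // ?VB // ler_wpM2l //.
    by have [] := increment 1 l j sd shd rd.
  - by move=> j; rewrite W0 W0'.
pose u i x := W (x 0 0 - p 0 0) i (x 0 1 - p 0 1).
exists u; split=> [i|x k i px].
  by rewrite /u !subrr; have [-> _] := HW 0 n0.
have /plane_ballP px' := px.
have nx l : `|x 0 l - p 0 l| < d by rewrite distrC.
pose s := x 0 0 - p 0 0; pose t := x 0 1 - p 0 1.
have sd : `|s| < d := nx 0; have td : `|t| < d := nx 1.
have qx : q s t = x := shift2_coord p x.
elim/ord2P: k.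
- have -> : \sum_j A 0 i j x * u j x = V s i t by rewrite /V qx.
  apply: is_derive_eps => e e0.
  (* e1 and r make the two terms of the estimate at most e / 2 each. *)
  pose e1 := e / (4 * kk + 1).
  have e10 : 0 < e1 by rewrite divr_gt0 // ltr_wpDl // mulr_ge0.
  pose r := e / (4 * kk * d * C + 1).
  have r0 : 0 < r by rewrite divr_gt0 // ltr_wpDl // !mulr_ge0 // ltW.
  have Hv : \forall h \near (0 : R), forall j, `|v j (h *: 1 + s) - v j s - h * V s j 0| <= e1 * `|h|.
    apply: (@filter_forall _ _ _ (nbhs (0 : R))) => j; apply: is_derive_epsP => //.
    have [W0 _] := HW s sd.
    have -> : V s j 0 = \sum_l A 0 j l (q s 0) * v l s.
      by apply: eq_bigr => l _; rewrite W0.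
    exact: dv.
  have Hs : \forall h \near (0 : R), `|s + h| < d /\ `|h| <= r.
    have m0 : 0 < Num.min (d - `|s|) r by rewrite lt_min subr_gt0 sd.
    apply/nbhs_ballP; exists (Num.min (d - `|s|) r) => //= h.
    rewrite /ball /= sub0r normrN lt_min => /andP[h1 h2]; split; last exact: ltW.
    by apply: le_lt_trans (ler_normD _ _) _; rewrite -ltrBrDl.
  near=> h.
  have [shd hr] : `|s + h| < d /\ `|h| <= r by near: h.
  have Hvh : forall j, `|v j (h *: 1 + s) - v j s - h * V s j 0| <= e1 * `|h| by near: h.
  have -> : u i (h *: 'e_0 + x) = W (s + h) i t.
    by rewrite /u !axisE /= mulr1 mulr0 add0r -addrA -/s -/t addrC.
  apply: le_trans (est i s t h (e1 * `|h|) sd shd td _) _.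
    have eh : h *: 1 + s = s + h by rewrite addrC /GRing.scale /= mulr1.
    by move=> j; have := Hvh j; rewrite eh.
  have -> : 2 * kk * (e1 * `|h| + d * (C * `|h| * `|h|)) =
    (2 * kk * e1 + 2 * kk * d * C * `|h|) * `|h| by ring.
  rewrite ler_wpM2r // (splitr e); apply: lerD.
    rewrite /e1 mulrA ler_pdivrMr; last by rewrite ltr_wpDl // mulr_ge0.
    rewrite (_ : e / 2 * (4 * kk + 1) = 2 * kk * e + e / 2); last by field.
    by rewrite lerDl divr_ge0 // ltW.
  apply: le_trans (_ : 2 * kk * d * C * r <= _).
    by rewrite ler_wpM2l // !mulr_ge0 // ltW.
  rewrite /r mulrA ler_pdivrMr; last by rewrite ltr_wpDl // !mulr_ge0 // ltW.
  rewrite (_ : e / 2 * (4 * kk * d * C + 1) = 2 * kk * d * C * e + e / 2); last by field.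
  by rewrite lerDl divr_ge0 // ltW.
- have [_ dW] := HW s sd.
  have -> : \sum_j A 1 i j x * u j x = \sum_j A 1 i j (q s t) * W s j t by rewrite qx.
  apply: is_derive_eps => e e0.
  have := is_derive_epsP (dW i t td) e0; apply: filterS => h.
  have -> : u i (h *: 'e_1 + x) = W s i (h *: 1 + t) => //.
  by rewrite /u !axisE /= mulr1 mulr0 add0r -addrA -/s -/t /GRing.scale /= mulr1.
Unshelve. all: by end_near. Qed.

End Core.

(** Near p the coefficients and their first two derivatives are bounded, which
    is what [frobenius_core] asks for; smoothness of the solution follows by
    feeding the equation into itself. *)
Theorem frobenius (I : finType) (A : 'I_2 -> I -> I -> plane R -> R) U p :
  open U -> U p -> (forall k i j, smooth U (A k i j)) ->
  (forall x i j, U x ->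
    pd 0 (A 1 i j) x + \sum_l A 1 i l x * A 0 l j x =
    pd 1 (A 0 i j) x + \sum_l A 0 i l x * A 1 l j x) ->
  exists d, [/\ 0 < d, ball p d `<=` U & forall u0 : I -> R,
    exists u : I -> plane R -> R, [/\ (forall i, u i p = u0 i),
     (forall x k i, ball p d x -> is_derive x 'e_k (u i) (\sum_j A k i j x * u j x)) &
     forall i, smooth (ball p d) (u i)]].
Proof.
move=> oU Up sA flat.
have [M1 [d1 [M10 d10 b1 H1]]] := @local_bound ('I_2 * I * I)%type
  (fun a => A a.1.1 a.1.2 a.2) U p oU Up (fun a => sA _ _ _ 0%N).
have [M2 [d2 [M20 d20 b2 H2]]] := @local_bound ('I_2 * 'I_2 * I * I)%type
  (fun a => pd a.1.1.1 (A a.1.1.2 a.1.2 a.2)) U p oU Up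
  (fun a => Cn_pd _ (sA _ _ _ 1%N)).
have [M3 [d3 [M30 d30 b3 H3]]] := @local_bound ('I_2 * 'I_2 * 'I_2 * I * I)%type
  (fun a => pd a.1.1.1.1 (pd a.1.1.1.2 (A a.1.1.2 a.1.2 a.2))) U p oU Up
  (fun a => Cn_pd _ (Cn_pd _ (sA _ _ _ 2%N))).
pose M := M1 + M2 + M3; have M0 : 0 < M by rewrite /M; lra.
pose d4 := Num.min d1 (Num.min d2 d3).
have d40 : 0 < d4 by rewrite /d4 !lt_min d10 d20.
have s41 : ball p d4 `<=` ball p d1 by apply: le_ball; rewrite /d4 ge_min lexx.
have s42 : ball p d4 `<=` ball p d2 by apply: le_ball; rewrite /d4 !ge_min lexx orbT.
have s43 : ball p d4 `<=` ball p d3 by apply: le_ball; rewrite /d4 !ge_min lexx !orbT.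
pose kM := #|I|%:R * M + 1.
have kM0 : 0 < kM by rewrite /kM ltr_wpDl // mulr_ge0 // ltW.
pose d := Num.min (d4 / 2) (2^-1 / kM).
have d0 : 0 < d by rewrite /d lt_min !divr_gt0 // invr_gt0.
have dd4 : d < d4.
  by rewrite /d gt_min; apply/orP; left; rewrite ltr_pdivrMr // ltr_pMr // ltr1n.
have small : #|I|%:R * M * d <= 2^-1.
  apply: le_trans (_ : kM * (2^-1 / kM) <= _); last by rewrite mulrC divfK // gt_eqF.
  apply: ler_pM => //; [by rewrite mulr_ge0 // ltW|exact: ltW|by rewrite /kM lerDl|].
  by rewrite /d ge_min lexx orbT.
have bU : ball p d4 `<=` U by move=> x /s41/b1.
have AM k i j x : ball p d4 x -> `|A k i j x| <= M.
  by move=> /s41/(H1 (k, i, j)) /= h; rewrite /M; lra.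
have dAM l k i j x : ball p d4 x -> `|pd l (A k i j) x| <= M.
  by move=> /s42/(H2 (l, k, i, j)) /= h; rewrite /M; lra.
have ddAM m l k i j x : ball p d4 x -> `|pd m (pd l (A k i j)) x| <= M.
  by move=> /s43/(H3 (m, l, k, i, j)) /= h; rewrite /M; lra.
have sd : ball p d `<=` ball p d4 by apply: le_ball; exact: ltW.
exists d; split=> // [x /sd/bU//|u0].
have [u [up du]] := frobenius_core oU (fun k i j => sA k i j 2%N) d0 dd4 M0 bU AM dAM ddAM small flat u0.
exists u; split=> //.
have ob : open (ball p d) by exact: ball_open.
have bu i x : ball p d x -> `|u i x| <= 2 * #|I|%:R * (2 * #|I|%:R * \sum_i `|u0 i|).
  apply: (gronwall_plane d0 (ltW M0) du) => // [y k i' j /sd|j]; first exact: AM.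
  by rewrite up (bigD1 j) //= lerDl sumr_ge0.
have smn n : forall i, Cn n (ball p d) (u i).
  elim: n => [|n IH] i.
    move=> x px; set B := _ * _ in bu.
    have B0 : 0 <= B by apply: le_trans (bu i x px).
    pose c := #|I|%:R * (M * B).
    have c0 : 0 <= c by apply: mulr_ge0 => //; apply: mulr_ge0 => //; exact: ltW.
    have lip y : ball p d y -> `|u i y - u i x| <= (c + c) * `|y - x|.
      apply: small_pd_lipschitz px => [z pz k|z k pz]; first by have [] := du z k i pz.
      rewrite (is_derive_pd (du z k i pz)); apply: sum_bound => j.
      by rewrite normrM ler_pM // ?bu //; apply: AM; exact: sd.
    apply/(@cvgrPdist_le _ _ _ (nbhs x)) => e e0; have c1 : 0 < c + c + 1 by lra.
    near=> y; have py : ball p d y by near: y; exact: open_nbhs_nbhs.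
    rewrite distrC; apply: le_trans (lip y py) _.
    have : `|y - x| <= e / (c + c + 1).
      near: y; apply/nbhs_ballP; exists (e / (c + c + 1)) => /=; first by rewrite divr_gt0.
      by move=> w; rewrite -ball_normE /= distrC => /ltW.
    move=> h; apply: le_trans (_ : (c + c + 1) * (e / (c + c + 1)) <= _).
      by apply: ler_pM => //; [lra|rewrite lerDl].
    by rewrite mulrC divfK // gt_eqF.
  split=> [x px k|k]; first by have [] := du x k i px.
  apply: (@Cn_eq _ _ _ (fun x => \sum_j A k i j x * u j x)) => //.
    by move=> x; rewrite inE => px; rewrite (is_derive_pd (du x k i px)).
  apply: Cn_sum => // j; apply: Cn_mul => //.
  by apply: Cn_sub (sA k i j n) => x /sd/bU.
by move=> i n; exact: smn.
Unshelve. all: by end_near. Qed.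

(** Grönwall's estimate with initial value zero. *)
Lemma linear_unique (I : finType) (A : 'I_2 -> I -> I -> plane R -> R)
    (q : I -> plane R -> R) U p : open U -> U p ->
  (forall k i j, smooth U (A k i j)) ->
  (forall x k i, U x -> is_derive x 'e_k (q i) (\sum_j A k i j x * q j x)) ->
  (forall i, q i p = 0) ->
  exists2 d, 0 < d & ball p d `<=` U /\ forall i x, ball p d x -> q i x = 0.
Proof.
move=> oU Up sA dq q0.
have [M [d1 [M0 d10 b1 H1]]] := @local_bound ('I_2 * I * I)%type
  (fun a => A a.1.1 a.1.2 a.2) U p oU Up (fun a => sA _ _ _ 0%N).
pose kM := #|I|%:R * M + 1.
have kM0 : 0 < kM by rewrite /kM ltr_wpDl // mulr_ge0 // ltW.
pose d := Num.min d1 (2^-1 / kM).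
have d0 : 0 < d by rewrite /d lt_min d10 !divr_gt0 // invr_gt0.
have sd : ball p d `<=` ball p d1 by apply: le_ball; rewrite /d ge_min lexx.
have small : #|I|%:R * M * d <= 2^-1.
  apply: le_trans (_ : kM * (2^-1 / kM) <= _); last by rewrite mulrC divfK // gt_eqF.
  apply: ler_pM => //; [by rewrite mulr_ge0 // ltW|exact: ltW|by rewrite /kM lerDl|].
  by rewrite /d ge_min lexx orbT.
exists d => //; split=> [x /sd/b1//|i x px].
apply/eqP; rewrite -normr_le0.
have -> : (0 : R) = 2 * #|I|%:R * (2 * #|I|%:R * 0) by rewrite !mulr0.
apply: (gronwall_plane d0 (ltW M0) (A := A)) px => //.
- by move=> y k j /sd/b1; exact: dq.
- by move=> y k j l /sd; exact: (H1 (k, j, l)).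
- by move=> j; rewrite q0 normr0.
Qed.

End Frobenius.

(* Partial derivatives are generalized before calling [ring], which would
   otherwise compare them up to conversion. *)
Ltac gen_pd :=
  repeat match goal with |- context [@pd ?R ?i ?f ?x] => generalize (@pd R i f x); intro end.

(** * Parallel forms and the equation Hess f = - f b *)

Section PlaneGeometry.
Variable R : realType.
Implicit Types (x y p : plane R) (U V : set (plane R)) (f h : plane R -> R)
  (G : christoffel R) (b : bilin_field R) (F : plane R -> plane R).

(** The component k of R(d_i, d_j) d_l. *)
Definition riem G (i j l k : 'I_2) x : R :=
  pd i (G j l k) x - pd j (G i l k) x +
  \sum_m (G j l m x * G i m k x - G i l m x * G j m k x).

(** The structure carried by kappa g in a chart: [cd_parallel] says that b is
    parallel and [cd_curv] that R(X,Y)Z = b(Y,Z)X - b(X,Z)Y. Working with b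
    rather than g removes kappa from all the equations. *)
Record curv_data U G b : Prop := CurvData {
  cd_open : open U;
  cd_G : forall i j k, smooth U (G i j k);
  cd_Gsym : forall x, U x -> forall i j k, G i j k x = G j i k x;
  cd_b : forall i j, smooth U (b i j);
  cd_bsym : forall x, U x -> forall i j, b i j x = b j i x;
  cd_parallel : forall x, U x -> forall k i j, pd k (b i j) x =
    \sum_l (G k i l x * b l j x + G k j l x * b i l x);
  cd_det : forall x, U x -> b 0 0 x * b 1 1 x - b 0 1 x * b 1 0 x != 0;
  cd_curv : forall x, U x -> forall j k,
    riem G 0 1 j k x = b 1 j x * (k == 0)%:R - b 0 j x * (k == 1)%:R }.

(** The equation Hess f = - f b as a first order system d_k q_m = sum_n A_k,m,n
    q_n for the jet q of f; the index None stands for the value of f and Some i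
    for its partial derivative of index i. *)
Definition jet_coeff G b (k : 'I_2) (m n : option 'I_2) : plane R -> R :=
  match m, n with
  | None, None => fun=> 0
  | None, Some j => fun=> (k == j)%:R
  | Some i, None => fun x => - b k i x
  | Some i, Some l => G k i l
  end.

Definition jet f (m : option 'I_2) : plane R -> R :=
  if m is Some i then pd i f else f.

Lemma sum_option (V : nmodType) (F : option 'I_2 -> V) :
  \sum_m F m = F None + (F (Some 0) + F (Some 1)).
Proof.
rewrite (bigD1 None) //=; congr (_ + _).
rewrite (reindex_omap (op := +%R) Some id) /=; last by case.
by rewrite (eq_bigl xpredT) ?sum2E // => i; rewrite eqxx.
Qed.

Lemma smooth_jet_coeff U G b k m n : curv_data U G b -> smooth U (jet_coeff G b k m n).
Proof.
move=> cd; case: m n => [i|] [l|] r /=.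
- exact: (cd_G cd).
- by apply: Cn_opp; [exact: cd_open cd|exact: (cd_b cd)].
- exact: Cn_cst.
- exact: Cn_cst.
Qed.

Definition hess_eq U G f b := forall x, U x -> forall i j, hessian G f i j x = f x * b i j x.

Lemma smooth_derivable U f x i : smooth U f -> U x -> derivable f x 'e_i.
Proof. by move=> sf Ux; exact: Cn_derivable (sf 1%N) Ux. Qed.

Lemma smooth_pd U f i : smooth U f -> smooth U (pd i f).
Proof. by move=> sf n; exact: (Cn_pd i (sf n.+1)). Qed.

Lemma smooth_is_derive U f x i : smooth U f -> U x -> is_derive x 'e_i f (pd i f x).
Proof. by move=> sf Ux; apply: derivableP; exact: smooth_derivable sf Ux. Qed.

Lemma jet_is_derive U G b f x k m : smooth U f ->
  hess_eq U G f (fun i j x => - b i j x) -> U x ->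
  is_derive x 'e_k (jet f m) (\sum_n jet_coeff G b k m n x * jet f n x).
Proof.
move=> sf Hf Ux; rewrite sum_option; case: m => [i|] /=.
  apply: (is_derive_eq (smooth_is_derive k (smooth_pd i sf) Ux)).
  have := Hf x Ux k i; rewrite /hessian sum2E => /eqP; rewrite subr_eq => /eqP ->.
  by rewrite mulrN mulNr mulrC.
apply: (is_derive_eq (smooth_is_derive k sf Ux)); rewrite mul0r add0r.
by elim/ord2P: k; rewrite /= mul1r mul0r ?addr0 ?add0r.
Qed.

(** Flatness of the system. For two derivative indices it is the curvature
    formula, for a derivative and the value it is [cd_parallel], and in the last
    two cases the symmetry of G and of b. *)
Lemma jet_flat U G b x m n : curv_data U G b -> U x ->
  pd 0 (jet_coeff G b 1 m n) x + \sum_l jet_coeff G b 1 m l x * jet_coeff G b 0 l n x =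
  pd 1 (jet_coeff G b 0 m n) x + \sum_l jet_coeff G b 0 m l x * jet_coeff G b 1 l n x.
Proof.
move=> cd Ux; have bs := cd_bsym cd Ux; have Gs := cd_Gsym cd Ux.
rewrite !sum_option; case: m n => [i|] [j|] /=.
- have := cd_curv cd Ux i j; rewrite /riem sum2E => h.
  apply/eqP; rewrite -subr_eq0; apply/eqP.
  set a := pd 0 _ x in h *; set c := pd 1 _ x in h *.
  have -> : a = b 1 i x * (j == 0)%:R - b 0 i x * (j == 1)%:R + c -
    (G 1 i 0 x * G 0 0 j x - G 0 i 0 x * G 1 0 j x +
    (G 1 i 1 x * G 0 1 j x - G 0 i 1 x * G 1 1 j x)) by rewrite -h; ring.
  by clear h; clearbody a c; elim/ord2P: j => /=; ring.
- have db k l := smooth_derivable (i := k) (cd_b cd l i) Ux.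
  rewrite !pdN // !(cd_parallel cd) // !sum2E (Gs 1 0 0) (Gs 1 0 1); ring.
- by rewrite !pd_cst; elim/ord2P: j; rewrite /= (Gs 1 0); ring.
- by rewrite !pd_cst (bs 1 0) /=; ring.
Qed.

Lemma hessian_solve U G b p : curv_data U G b -> U p ->
  exists d, [/\ 0 < d, ball p d `<=` U & forall c (al : 'I_2 -> R),
    exists f, [/\ smooth (ball p d) f, hess_eq (ball p d) G f (fun i j x => - b i j x),
      f p = c & forall i, pd i f p = al i]].
Proof.
move=> cd Up.
have [d [d0 dU H]] := frobenius (cd_open cd) Up (fun k m n => smooth_jet_coeff k m n cd)
  (fun x m n Ux => jet_flat m n cd Ux).
exists d; split=> // c al.
have [u [up du su]] := H (fun m => if m is Some i then al i else c).
have ob : open (ball p d) by exact: ball_open.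
have pdu k x : ball p d x -> pd k (u None) x = u (Some k) x.
  move=> px; rewrite (is_derive_pd (du x k None px)) sum_option /=.
  by rewrite mul0r add0r; elim/ord2P: k; rewrite /= mul1r mul0r ?addr0 ?add0r.
exists (u None); split=> //; last 2 first.
- exact: up.
- by move=> i; rewrite pdu ?up //; exact: ballxx.
move=> x px i j; rewrite /hessian sum2E.
have -> : pd i (pd j (u None)) x = pd i (u (Some j)) x.
  by apply: (pd_eq_on _ ob _ px) => y; rewrite inE; exact: pdu.
by rewrite (is_derive_pd (du x i _ px)) sum_option /= !pdu //; ring.
Qed.

(** The parallel form on jets that extends b, for which the constant 1 is a unit
    vector orthogonal to the plane. *)
Definition gram b (m n : option 'I_2) : plane R -> R :=
  match m, n with
  | None, None => fun=> 1
  | Some i, Some j => b i j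
  | _, _ => fun=> 0
  end.

(** [gram] obeys the system that a product of two jets of solutions obeys. *)
Lemma gram_is_derive U G b x k m n : curv_data U G b -> U x ->
  is_derive x 'e_k (gram b m n)
   (\sum_l jet_coeff G b k m l x * gram b l n x + \sum_l jet_coeff G b k n l x * gram b m l x).
Proof.
move=> cd Ux; have bs := cd_bsym cd Ux; rewrite !sum_option; case: m n => [i|] [j|] /=.
- apply: (is_derive_eq (smooth_is_derive k (cd_b cd i j) Ux)).
  by rewrite (cd_parallel cd) // sum2E; ring.
- apply: (is_derive_eq (isdC 0 x _)).
  by elim/ord2P: k; elim/ord2P: i; rewrite /= ?(bs 1 0); ring.
- apply: (is_derive_eq (isdC 0 x _)).
  by elim/ord2P: k; elim/ord2P: j; rewrite /= ?(bs 1 0); ring.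
- by apply: (is_derive_eq (isdC 1 x _)); ring.
Qed.

(** The difference between the matrix sum_a,c D_ac (jet f_a)(jet f_c)^T and
    [gram] solves a homogeneous linear system, with coefficients A2 below, and
    vanishes at p, hence near p; the entry (None, None) is the claim. *)
Lemma quadric (J : finType) (D : J -> J -> R) (f : J -> plane R -> R) U G b p :
  curv_data U G b -> U p -> (forall a, smooth U (f a)) ->
  (forall a, hess_eq U G (f a) (fun i j x => - b i j x)) ->
  (forall m n, \sum_a \sum_c D a c * jet (f a) m p * jet (f c) n p = gram b m n p) ->
  exists2 d, 0 < d & ball p d `<=` U /\
    forall x, ball p d x -> \sum_a \sum_c D a c * f a x * f c x = 1.
Proof.
move=> cd Up sf Hf Qp; set A := jet_coeff G b.
pose q (mn : option 'I_2 * option 'I_2) x :=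
  \sum_a \sum_c D a c * jet (f a) mn.1 x * jet (f c) mn.2 x - gram b mn.1 mn.2 x.
pose A2 k (mn lr : option 'I_2 * option 'I_2) x : R :=
  A k mn.1 lr.1 x * (mn.2 == lr.2)%:R + A k mn.2 lr.2 x * (mn.1 == lr.1)%:R.
have oU := cd_open cd.
have [d d0 [dU H]] : exists2 d, 0 < d & ball p d `<=` U /\ forall mn x, ball p d x -> q mn x = 0.
  apply: (@linear_unique R _ A2 q U p oU Up) => [k mn lr r|x k [m n] Ux|[m n]].
  - by apply: Cn_add => //; apply: Cn_mul => //; try exact: Cn_cst; exact: smooth_jet_coeff.
  - have djet a l := jet_is_derive k l (sf a) (Hf a) Ux.
    have -> : \sum_lr A2 k (m, n) lr x * q lr x =
      \sum_l A k m l x * q (l, n) x + \sum_l A k n l x * q (m, l) x.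
      rewrite -(pair_bigA _ (fun l r => A2 k (m, n) (l, r) x * q (l, r) x)) /= /A2 /=.
      under eq_bigr => l _ do under eq_bigr => r _ do rewrite mulrDl.
      under eq_bigr => l _ do rewrite big_split /=.
      rewrite big_split /=; congr (_ + _).
        apply: eq_bigr => l _; rewrite (bigD1 n) //= eqxx mulr1 big1 ?addr0 // => r rn.
        by rewrite eq_sym (negbTE rn) mulr0 mul0r.
      rewrite exchange_big /=; apply: eq_bigr => r _.
      rewrite (bigD1 m) //= eqxx mulr1 big1 ?addr0 // => l lm.
      by rewrite eq_sym (negbTE lm) mulr0 mul0r.
    have -> : \sum_l A k m l x * q (l, n) x + \sum_l A k n l x * q (m, l) x =
      \sum_a \sum_c ((D a c * \sum_l A k m l x * jet (f a) l x) * jet (f c) n x +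
        D a c * jet (f a) m x * \sum_l A k n l x * jet (f c) l x) -
      (\sum_l A k m l x * gram b l n x + \sum_l A k n l x * gram b m l x).
      rewrite /q /=.
      under eq_bigr => l _ do rewrite mulrBr.
      under [X in _ + X]eq_bigr => l _ do rewrite mulrBr.
      rewrite !sumrB opprD addrACA; congr (_ + _).
      under [RHS]eq_bigr => a _ do rewrite big_split /=.
      rewrite big_split /=; congr (_ + _).
        under eq_bigr => l _ do rewrite mulr_sumr.
        rewrite exchange_big /=; apply: eq_bigr => a _.
        under eq_bigr => l _ do rewrite mulr_sumr.
        rewrite exchange_big /=; apply: eq_bigr => c _.
        rewrite mulr_sumr mulr_suml; apply: eq_bigr => l _; ring.
      under eq_bigr => l _ do rewrite mulr_sumr.
      rewrite exchange_big /=; apply: eq_bigr => a _.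
      under eq_bigr => l _ do rewrite mulr_sumr.
      rewrite exchange_big /=; apply: eq_bigr => c _.
      rewrite mulr_sumr; apply: eq_bigr => l _; ring.
    apply: (isdB _ (gram_is_derive k m n cd Ux)).
    apply: isd_sum => a; apply: isd_sum => c.
    apply: (is_derive_eq (isdM (isdM (isdC (D a c) x _) (djet a m)) (djet c n))).
    by rewrite mul0r add0r.
  - by rewrite /q /= Qp subrr.
exists d => //; split=> // x px.
by have /eqP := H (None, None) x px; rewrite subr_eq0 => /eqP.
Qed.

(** The defect of F from intertwining G and G', which is the error term in the
    chain rule for Hessians ([hessian_comp]). *)
Definition tension G G' F (i j c : 'I_2) x : R :=
  pd i (pd j (fun y => F y 0 c)) x - \sum_k G i j k x * pd k (fun y => F y 0 c) x +
  \sum_a \sum_d G' a d c (F x) * pd i (fun y => F y 0 a) x * pd j (fun y => F y 0 d) x.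

Lemma intertwinesP U G G' F : intertwines U G G' F <->
  forall x, U x -> forall i j c, tension G G' F i j c x = 0.
Proof.
split=> H x Ux i j c; have := H x Ux i j c; rewrite /tension.
  by move=> ->; ring.
by rewrite addrAC => /eqP; rewrite subr_eq0 => /eqP <-.
Qed.

Definition pullback (B : 'I_2 -> 'I_2 -> plane R -> R) F (i j : 'I_2) x : R :=
  \sum_a \sum_d B a d (F x) * pd i (fun y => F y 0 a) x * pd j (fun y => F y 0 d) x.

Lemma smooth_differentiable U f x : open U -> smooth U f -> U x -> differentiable f x.
Proof. by move=> oU sf; exact: Cn_differentiable oU (sf 1%N). Qed.

Lemma smooth_comp U V h F : open U -> open V -> (forall x, U x -> V (F x)) ->
  smooth V h -> smooth_map U F -> smooth U (h \o F).
Proof. by move=> oU oV UV sh sF n; apply: Cn_comp UV (sh n) _ => // k; exact: sF. Qed.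

Lemma pd_comp_on U V h F i x : open U -> open V -> (forall x, U x -> V (F x)) ->
  smooth V h -> smooth_map U F -> U x ->
  pd i (h \o F) x = \sum_k pd k h (F x) * pd i (fun y => F y 0 k) x.
Proof.
move=> oU oV UV sh sF Ux; apply: pd_comp; first exact: smooth_differentiable sh (UV _ Ux).
by move=> k; exact: smooth_differentiable (sF k) Ux.
Qed.

Lemma hess_algebra (ddh : 'I_2 -> 'I_2 -> R) (dh : 'I_2 -> R) (dF : 'I_2 -> 'I_2 -> R)
    (ddF g : 'I_2 -> R) (g' : 'I_2 -> 'I_2 -> 'I_2 -> R) (i j : 'I_2) :
  \sum_k ((\sum_a ddh a k * dF i a) * dF j k + dh k * ddF k) -
    \sum_k g k * (\sum_l dh l * dF k l) =
  \sum_c dh c * (ddF c - \sum_k g k * dF k c + \sum_a \sum_d g' a d c * dF i a * dF j d) +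
  \sum_a \sum_d (ddh a d - \sum_c g' a d c * dh c) * dF i a * dF j d.
Proof. by rewrite !sum2E; ring. Qed.

(** Hess (h o F) = F^* Hess h + dh (tension). *)
Lemma hessian_comp U V G G' h F : open U -> open V -> (forall x, U x -> V (F x)) ->
  smooth V h -> smooth_map U F -> forall x, U x -> forall i j,
  hessian G (h \o F) i j x =
    \sum_c pd c h (F x) * tension G G' F i j c x + pullback (hessian G' h) F i j x.
Proof.
move=> oU oV UV sh sF x Ux i j.
have E : pd i (pd j (h \o F)) x =
    pd i (fun x => \sum_k (pd k h \o F) x * pd j (fun y => F y 0 k) x) x.
  by apply: (pd_eq_on _ oU _ Ux) => y; rewrite inE => Uy; rewrite (pd_comp_on _ oU oV UV).
have dpF l k : is_derive x 'e_i (pd l (fun y => F y 0 k)) (pd i (pd l (fun y => F y 0 k)) x).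
  exact: (smooth_is_derive i (smooth_pd l (sF k)) Ux).
have dph k : is_derive x 'e_i (pd k h \o F) (\sum_a pd a (pd k h) (F x) * pd i (fun y => F y 0 a) x).
  apply: (is_derive_eq (smooth_is_derive i (smooth_comp oU oV UV (smooth_pd k sh) sF) Ux)).
  exact: (pd_comp_on _ oU oV UV (smooth_pd k sh)).
have E2 : pd i (fun x => \sum_k (pd k h \o F) x * pd j (fun y => F y 0 k) x) x =
    \sum_k ((\sum_a pd a (pd k h) (F x) * pd i (fun y => F y 0 a) x) * pd j (fun y => F y 0 k) x +
      pd k h (F x) * pd i (pd j (fun y => F y 0 k)) x).
  by apply: is_derive_pd; apply: isd_sum => k; exact: (isdM (dph k) (dpF j k)).
have pdhF k : pd k (h \o F) x = \sum_l pd l h (F x) * pd k (fun y => F y 0 l) x.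
  exact: (pd_comp_on k oU oV UV sh sF Ux).
rewrite {}E2 in E.
rewrite /tension /pullback /hessian E; under [X in _ - X = _]eq_bigr => k _ do rewrite pdhF.
exact: (hess_algebra (fun a k => pd a (pd k h) (F x)) (fun k => pd k h (F x))
  (fun i k => pd i (fun y => F y 0 k) x) (fun k => pd i (pd j (fun y => F y 0 k)) x)
  (fun k => G i j k x) (fun a d c => G' a d c (F x)) i j).
Qed.

Lemma hessian_pullback U V G G' h F : open U -> open V -> (forall x, U x -> V (F x)) ->
  smooth V h -> smooth_map U F -> intertwines U G G' F -> forall x, U x -> forall i j,
  hessian G (h \o F) i j x = pullback (hessian G' h) F i j x.
Proof.
move=> oU oV UV sh sF /intertwinesP iF x Ux i j.
rewrite (hessian_comp G G' oU oV UV sh sF Ux) big1 ?add0r // => c _.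
by rewrite iF // mulr0.
Qed.

Lemma intertwines_algebra (g : 'I_2 -> 'I_2 -> R) (dH dF : 'I_2 -> 'I_2 -> R) (i j : 'I_2) :
  \sum_a \sum_d (- \sum_e \sum_f g e f * dH a e * dH d f) * dF i a * dF j d +
  \sum_e \sum_f g e f * (\sum_l dH l e * dF i l) * (\sum_l dH l f * dF j l) = 0.
Proof. by rewrite !sum2E; ring. Qed.

(** A map intertwines when its components have the right Hessians, so the
    composite is treated by applying [hessian_pullback] to the components of H. *)
Lemma intertwines_comp U V G G' G'' F H : open U -> open V -> (forall x, U x -> V (F x)) ->
  smooth_map U F -> smooth_map V H -> intertwines U G G' F -> intertwines V G' G'' H ->
  intertwines U G G'' (H \o F).
Proof.
move=> oU oV UV sF sH iF iH; apply/intertwinesP => x Ux i j c.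
have hH a d : hessian G' (fun y => H y 0 c) a d (F x) =
    - \sum_e \sum_f G'' e f c (H (F x)) * pd a (fun y => H y 0 e) (F x) *
      pd d (fun y => H y 0 f) (F x).
  move/intertwinesP: iH => /(_ _ (UV _ Ux) a d c); rewrite /tension => /eqP.
  by rewrite addr_eq0 => /eqP.
have pdH k e : pd k (fun y => (H \o F) y 0 e) x =
    \sum_l pd l (fun y => H y 0 e) (F x) * pd k (fun y => F y 0 l) x.
  exact: (pd_comp_on k oU oV UV (sH e) sF Ux).
have := hessian_pullback oU oV UV (sH c) sF iF Ux i j.
rewrite /tension {1}/hessian => ->.
rewrite /pullback.
under eq_bigr => a _ do under eq_bigr => d _ do rewrite hH.
under [X in _ + X = _]eq_bigr => a _ do under eq_bigr => d _ do rewrite !pdH.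
exact: (intertwines_algebra (fun a d => G'' a d c (H (F x)))
  (fun l e => pd l (fun y => H y 0 e) (F x)) (fun i a => pd i (fun y => F y 0 a) x) i j).
Qed.

Lemma intertwines_sub U V G G' F : U `<=` V -> intertwines V G G' F -> intertwines U G G' F.
Proof. by move=> UV H x /UV; exact: H. Qed.

Lemma integrability_algebra (b1 b0 f Bj1 Bj0 dB1 dB0 : R)
    (df g1 g0 dg1 dg0 B1 B0 : 'I_2 -> R) (h1 h0 : 'I_2 -> 'I_2 -> R) :
  dg1 0 - dg0 0 + \sum_m (g1 m * h0 m 0 - g0 m * h1 m 0) =
    b1 * (0 == 0 :> 'I_2)%:R - b0 * (0 == 1 :> 'I_2)%:R ->
  dg1 1 - dg0 1 + \sum_m (g1 m * h0 m 1 - g0 m * h1 m 1) =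
    b1 * (1 == 0 :> 'I_2)%:R - b0 * (1 == 1 :> 'I_2)%:R ->
  \sum_l (dg1 l * df l + g1 l * (\sum_m h0 l m * df m + f * B0 l)) + (df 0 * Bj1 + f * dB1) =
  \sum_l (dg0 l * df l + g0 l * (\sum_m h1 l m * df m + f * B1 l)) + (df 1 * Bj0 + f * dB0) ->
  b1 * df 0 - b0 * df 1 + Bj1 * df 0 - Bj0 * df 1 +
  f * (dB1 - dB0 + \sum_l (g1 l * B0 l - g0 l * B1 l)) = 0.
Proof.
rewrite !sum2E /= mulr1 mulr0 => c0 c1 /eqP; rewrite -subr_eq0 => /eqP <-.
have -> : dg1 0 = b1 + dg0 0 - (g1 0 * h0 0 0 - g0 0 * h1 0 0 + (g1 1 * h0 1 0 - g0 1 * h1 1 0)).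
  by move/eqP: c0; rewrite subr0 -subr_eq0 => /eqP e; rewrite -[RHS]addr0 -e; ring.
have -> : dg1 1 = - b0 + dg0 1 - (g1 0 * h0 0 1 - g0 0 * h1 0 1 + (g1 1 * h0 1 1 - g0 1 * h1 1 1)).
  by move/eqP: c1; rewrite -subr_eq0 => /eqP e; rewrite -[RHS]addr0 -e; ring.
ring.
Qed.

(** Equality of d_0 d_1 d_j f and d_1 d_0 d_j f, where the second derivatives of
    f are replaced through the equation twice and the curvature appears as
    commutator. *)
Lemma integrability U G b f (B : bilin_field R) : curv_data U G b -> smooth U f ->
  (forall i j, smooth U (B i j)) -> hess_eq U G f B -> forall x, U x -> forall j,
  b 1 j x * pd 0 f x - b 0 j x * pd 1 f x + B 1 j x * pd 0 f x - B 0 j x * pd 1 f x +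
  f x * (pd 0 (B 1 j) x - pd 1 (B 0 j) x + \sum_l (G 1 j l x * B 0 l x - G 0 j l x * B 1 l x)) = 0.
Proof.
move=> cd sf sB Hf x Ux j; have oU := cd_open cd.
have Hf' y : U y -> forall i k, pd i (pd k f) y = \sum_l G i k l y * pd l f y + f y * B i k y.
  by move=> Uy i k; have /eqP := Hf y Uy i k; rewrite /hessian subr_eq addrC => /eqP.
have third i k : pd i (pd k (pd j f)) x = \sum_l (pd i (G k j l) x * pd l f x +
    G k j l x * (\sum_m G i l m x * pd m f x + f x * B i l x)) +
    (pd i f x * B k j x + f x * pd i (B k j) x).
  have -> : pd i (pd k (pd j f)) x = pd i (fun y => \sum_l G k j l y * pd l f y + f y * B k j y) x.
    by apply: (pd_eq_on _ oU _ Ux) => y; rewrite inE => Uy; exact: Hf'.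
  apply: is_derive_pd; apply: isdD; last first.
    apply: isdM; [exact: (smooth_is_derive i sf Ux)|exact: (smooth_is_derive i (sB k j) Ux)].
  apply: isd_sum => l; apply: isdM; first exact: (smooth_is_derive i (cd_G cd k j l) Ux).
  apply: (is_derive_eq (smooth_is_derive i (smooth_pd l sf) Ux)); exact: Hf'.
have S : pd 0 (pd 1 (pd j f)) x = pd 1 (pd 0 (pd j f)) x.
  by apply: schwarz oU _ Ux; exact: (Cn_pd j (sf 3%N)).
have c0 := cd_curv cd Ux j 0; have c1 := cd_curv cd Ux j 1.
rewrite !third in S.
exact: (integrability_algebra (df := fun l => pd l f x)
  (dg1 := fun l => pd 0 (G 1 j l) x) (dg0 := fun l => pd 1 (G 0 j l) x)
  (h1 := fun l m => G 1 l m x) (h0 := fun l m => G 0 l m x) c0 c1 S).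
Qed.

End PlaneGeometry.

(** * Models embedded by solutions *)

Section EmbeddedModels.
Variable R : realType.
Implicit Types (x y p : plane R) (U V N : set (plane R)) (f h u : plane R -> R)
  (G : christoffel R) (b bm : bilin_field R) (F : plane R -> plane R).

(** The three functions Phi solve the equation of the form bm, and [em_inj] says
    that the 3 x 3 matrix of their jets is invertible. *)
Record embedded_model V Gm bm (Phi : 'I_3 -> plane R -> R) : Prop := EmbeddedModel {
  em_open : open V;
  em_smooth : forall a, smooth V (Phi a);
  em_bm : forall i j, smooth V (bm i j);
  em_hess : forall a, hess_eq V Gm (Phi a) (fun i j x => - bm i j x);
  em_inj : forall y, V y -> forall t : option 'I_2 -> R,
    (forall a, \sum_m jet (Phi a) m y * t m = 0) -> forall m, t m = 0 }.

Lemma smooth_sub U V f : U `<=` V -> smooth V f -> smooth U f.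
Proof. by move=> UV sf n; exact: Cn_sub UV (sf n). Qed.

Lemma smooth_eq U f h : open U -> {in U, f =1 h} -> smooth U f -> smooth U h.
Proof. by move=> oU fh sf n; exact: Cn_eq oU fh (sf n). Qed.

Lemma smooth_add U f h : open U -> smooth U f -> smooth U h -> smooth U (fun x => f x + h x).
Proof. by move=> oU sf sh n; exact: Cn_add. Qed.

Lemma smooth_mul U f h : open U -> smooth U f -> smooth U h -> smooth U (fun x => f x * h x).
Proof. by move=> oU sf sh n; exact: Cn_mul. Qed.

Lemma smooth_opp U f : open U -> smooth U f -> smooth U (fun x => - f x).
Proof. by move=> oU sf n; exact: Cn_opp. Qed.

Lemma smooth_cst U (c : R) : smooth U (fun=> c).
Proof. by move=> n; exact: Cn_cst. Qed.

Lemma smooth_sum U (I : Type) (r : seq I) (f : I -> plane R -> R) : open U ->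
  (forall i, smooth U (f i)) -> smooth U (fun x => \sum_(i <- r) f i x).
Proof. by move=> oU sf n; apply: Cn_sum => // i; exact: sf. Qed.

Lemma solve2 (a b c d X Y : R) : a * d - b * c != 0 ->
  X * a + Y * b = 0 -> X * c + Y * d = 0 -> X = 0 /\ Y = 0.
Proof.
move=> D0 e1 e2; split; apply: (mulfI D0); rewrite mulr0.
  by transitivity (d * (X * a + Y * b) - b * (X * c + Y * d)); [ring|rewrite e1 e2; ring].
by transitivity (a * (X * c + Y * d) - c * (X * a + Y * b)); [ring|rewrite e1 e2; ring].
Qed.

Lemma hessian_eq_on U G f h x i j : open U -> {in U, f =1 h} -> U x ->
  hessian G f i j x = hessian G h i j x.
Proof.
move=> oU fh Ux; have e : pd i (pd j f) x = pd i (pd j h) x.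
  by apply: (pd_eq_on _ oU _ Ux) => y; rewrite inE => Uy; exact: (pd_eq_on _ oU fh Uy).
have e1 k : pd k f x = pd k h x := pd_eq_on k oU fh Ux.
by rewrite /hessian e; under eq_bigr => k _ do rewrite e1.
Qed.

Lemma hess_eq_ext U G f h b : open U -> {in U, f =1 h} -> hess_eq U G f b -> hess_eq U G h b.
Proof.
move=> oU fh Hf x Ux i j.
by rewrite -(hessian_eq_on _ _ _ oU fh Ux) Hf // fh // inE.
Qed.

Lemma curv_data_sub U N G b : open N -> N `<=` U -> curv_data U G b -> curv_data N G b.
Proof.
move=> oN NU cd; split=> //.
- by move=> i j k; exact: smooth_sub (cd_G cd i j k).
- by move=> x /NU; exact: (cd_Gsym cd).
- by move=> i j; exact: smooth_sub (cd_b cd i j).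
- by move=> x /NU; exact: (cd_bsym cd).
- by move=> x /NU; exact: (cd_parallel cd).
- by move=> x /NU; exact: (cd_det cd).
- by move=> x /NU; exact: (cd_curv cd).
Qed.

Lemma jac_algebra (dH dF : 'I_2 -> 'I_2 -> R) :
  (\sum_l dH l 0 * dF 0 l) * (\sum_l dH l 1 * dF 1 l) -
  (\sum_l dH l 0 * dF 1 l) * (\sum_l dH l 1 * dF 0 l) =
  (dH 0 0 * dH 1 1 - dH 1 0 * dH 0 1) * (dF 0 0 * dF 1 1 - dF 1 0 * dF 0 1).
Proof. by rewrite !sum2E; ring. Qed.

Lemma jac_comp U V H F x : open U -> open V -> (forall x, U x -> V (F x)) ->
  smooth_map U F -> smooth_map V H -> U x -> jac (H \o F) x = jac H (F x) * jac F x.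
Proof.
move=> oU oV UV sF sH Ux.
have pdH k e : pd k (fun y => (H \o F) y 0 e) x =
    \sum_l pd l (fun y => H y 0 e) (F x) * pd k (fun y => F y 0 l) x.
  exact: (pd_comp_on k oU oV UV (sH e) sF Ux).
rewrite /jac !pdH.
exact: (jac_algebra (fun l e => pd l (fun y => H y 0 e) (F x)) (fun k l => pd k (fun y => F y 0 l) x)).
Qed.

Lemma jac_eq_on U F H x : open U -> {in U, F =1 H} -> U x -> jac F x = jac H x.
Proof.
move=> oU FH Ux; have e k l : pd k (fun y => F y 0 l) x = pd k (fun y => H y 0 l) x.
  by apply: (pd_eq_on _ oU _ Ux) => y Uy; rewrite FH.
by rewrite /jac !e.
Qed.

Lemma smooth_pullback U V bm F i j : open U -> open V -> (forall x, U x -> V (F x)) ->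
  (forall i j, smooth V (bm i j)) -> smooth_map U F -> smooth U (pullback bm F i j).
Proof.
move=> oU oV UV sb sF; apply: smooth_sum => // a; apply: smooth_sum => // d.
apply: smooth_mul => //; last exact: smooth_pd.
by apply: smooth_mul => //; [exact: smooth_comp oU oV UV (sb a d) sF|exact: smooth_pd].
Qed.

Lemma pullback_scale (h : 'I_2 -> 'I_2 -> plane R -> R) bm F c i j x :
  (forall a d, h a d (F x) = c * - bm a d (F x)) ->
  pullback h F i j x = c * - pullback bm F i j x.
Proof. by move=> e; rewrite /pullback !sum2E !e; gen_pd; ring. Qed.

Section OneModel.
Variables (V : set (plane R)) (Gm : christoffel R) (bm : bilin_field R).
Variable Phi : 'I_3 -> plane R -> R.
Hypothesis em : embedded_model V Gm bm Phi.

(** By the chain rule, Hess (Phi_a o F) + (Phi_a o F) b is the value on the jet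
    of Phi_a of a linear form t made of the tension of F and of b - F^* bm. It
    vanishes for the three Phi_a, whose jets span, so t = 0. *)
Lemma model_functions_intertwine N G b F : open N -> smooth_map N F ->
  (forall x, N x -> V (F x)) ->
  (forall a, hess_eq N G (Phi a \o F) (fun i j x => - b i j x)) ->
  intertwines N G Gm F.
Proof.
move=> oN sF NV HF; apply/intertwinesP => x Nx i j c.
(* t is the linear form on jets: its components are the coefficients of Phi_a
   and of its partial derivatives. *)
pose t m := if m is Some c then tension G Gm F i j c x else b i j x - pullback bm F i j x.
suff /(_ (Some c)) : forall m, t m = 0 by [].
apply: (em_inj em (NV _ Nx)) => a.
have := HF a x Nx i j.
rewrite (hessian_comp G Gm oN (em_open em) NV (em_smooth em a) sF Nx).
rewrite (@pullback_scale _ bm _ (Phi a (F x))); last first.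
  by move=> k l; rewrite (em_hess em) //; exact: NV.
rewrite sum2E sum_option /= => /eqP; rewrite -subr_eq0 => /eqP <-; ring.
Qed.

(** An affine map into the model is an isometry for the two forms. The functions
    Phi_a o F have Hessian (Phi_a o F) B with B = - F^* bm; their integrability
    conditions are linear in the jet of Phi_a, whence (b + B)_1j d_0 F =
    (b + B)_0j d_1 F for both components of F, and b + B = 0 since F is a local
    diffeomorphism. *)
Lemma pullback_metric U N G b F : curv_data U G b -> open N -> N `<=` U -> smooth_map N F ->
  (forall x, N x -> V (F x)) -> intertwines N G Gm F -> (forall x, N x -> jac F x != 0) ->
  forall x, N x -> forall i j, pullback bm F i j x = b i j x.
Proof.
move=> cd0 oN NU sF NV iF JF x Nx; have cd := curv_data_sub oN NU cd0.
have oV := em_open em.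
pose B i j x := - pullback bm F i j x.
have sB i j : smooth N (B i j).
  by apply: smooth_opp => //; apply: smooth_pullback (em_bm em) sF.
have HF a : hess_eq N G (Phi a \o F) B.
  move=> y Ny i j; rewrite (hessian_pullback oN oV NV (em_smooth em a) sF iF Ny).
  by apply: pullback_scale => k l; rewrite (em_hess em) //; exact: NV.
have BE i j : B i j x = - pullback bm F i j x by [].
clearbody B.
have key j : b 1 j x + B 1 j x = 0 /\ b 0 j x + B 0 j x = 0.
  pose T := pd 0 (B 1 j) x - pd 1 (B 0 j) x + \sum_l (G 1 j l x * B 0 l x - G 0 j l x * B 1 l x).
  (* The integrability condition as a linear form on jets of the model. *)
  pose t m := if m is Some c then (b 1 j x + B 1 j x) * pd 0 (fun y => F y 0 c) x -
     (b 0 j x + B 0 j x) * pd 1 (fun y => F y 0 c) x else T.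
  have t0 : forall m, t m = 0.
    apply: (em_inj em (NV _ Nx)) => a.
    have := integrability cd (smooth_comp oN oV NV (em_smooth em a) sF) sB (HF a) Nx j.
    have pdF k : pd k (Phi a \o F) x = \sum_l pd l (Phi a) (F x) * pd k (fun y => F y 0 l) x.
      exact: (pd_comp_on k oN oV NV (em_smooth em a) sF Nx).
    rewrite !pdF -/T !sum2E sum_option /= => <-.
    rewrite /T; clearbody T; gen_pd.
    by move: (b 1 j x) (b 0 j x) (B 1 j x) (B 0 j x) (Phi a (F x)) => *; ring.
  have e0 := t0 (Some 0); have e1 := t0 (Some 1); rewrite /t in e0 e1.
  rewrite -mulrN in e0; rewrite -mulrN in e1.
  apply: solve2 e0 e1; have := JF x Nx; rewrite -oppr_eq0; apply: contra_neq.
  by rewrite /jac => e; rewrite -[RHS]e; gen_pd; ring.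
move=> i j; have [k1 k0] := key j; move: k1 k0; rewrite !BE => k1 k0.
by elim/ord2P: i; [exact/esym/(subr0_eq k0)|exact/esym/(subr0_eq k1)].
Qed.

Lemma model_functions_hess U N G b F : curv_data U G b -> open N -> N `<=` U -> smooth_map N F ->
  (forall x, N x -> V (F x)) -> intertwines N G Gm F -> (forall x, N x -> jac F x != 0) ->
  forall a, hess_eq N G (Phi a \o F) (fun i j x => - b i j x).
Proof.
move=> cd oN NU sF NV iF JF a x Nx i j.
rewrite (hessian_pullback oN (em_open em) NV (em_smooth em a) sF iF Nx).
rewrite -(pullback_metric cd oN NU sF NV iF JF Nx).
by apply: pullback_scale => k l; rewrite (em_hess em) //; exact: NV.
Qed.

(** Rows are indexed by the functions, columns by the entries of the jet, with
    0 for the value. *)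
Definition jet_mx y : 'M[R]_3 := \matrix_(a, m) jet (Phi a) (unlift ord0 m) y.

Lemma sum3_unlift (T : option 'I_2 -> R) : \sum_(m < 3) T (unlift ord0 m) = \sum_m T m.
Proof.
by rewrite big_ord_recl unlift_none sum_option sum2E !liftK.
Qed.

Lemma jet_mx_unit y : V y -> jet_mx y \in unitmx.
Proof.
move=> Vy; rewrite -row_full_unit -cokermx_eq0; apply/eqP/matrixP => i j; rewrite [RHS]mxE.
pose t (m : option 'I_2) := cokermx (jet_mx y) (if m is Some k then lift ord0 k else ord0) j.
have H : forall m, t m = 0.
  apply: (em_inj em Vy) => a.
  rewrite -[LHS](sum3_unlift (fun m => jet (Phi a) m y * t m)).
  have /matrixP/(_ a j) := mulmx_coker (jet_mx y); rewrite !mxE => e; rewrite -[RHS]e.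
  apply: eq_bigr => m _.
  rewrite mxE /t; congr (_ * _).
  by case: unliftP => [k ->|->].
by case: (unliftP ord0 i) => [k ->|->]; [exact: (H (Some k))|exact: (H None)].
Qed.

Lemma jets_surjective y (c : option 'I_2 -> R) : V y ->
  exists a : 'rV[R]_3, forall m, \sum_k a 0 k * jet (Phi k) m y = c m.
Proof.
move=> Vy; have := mulmxKV (jet_mx_unit Vy) (\row_m c (unlift ord0 m)).
move: (_ *m invmx _) => a /rowP aS; exists a => m.
have em3 : unlift ord0 (if m is Some k then lift ord0 k else ord0 : 'I_3) = m.
  by case: m => [k|]; [exact: (@liftK 3 ord0 k)|exact: (@unlift_none 3 ord0)].
have := aS (if m is Some k then lift ord0 k else ord0); rewrite 2!mxE em3 => <-.
by apply: eq_bigr => k _; rewrite mxE em3.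
Qed.

Lemma jets_injective y (a : 'rV[R]_3) : V y ->
  (forall m, \sum_k a 0 k * jet (Phi k) m y = 0) -> a = 0.
Proof.
move=> Vy H; rewrite -[a](mulmxK (jet_mx_unit Vy)).
suff -> : a *m jet_mx y = 0 by rewrite mul0mx.
apply/rowP => m; rewrite !mxE -[RHS](H (unlift ord0 m)).
by apply: eq_bigr => k _; rewrite mxE.
Qed.

Lemma jet_comp N F (a : 'rV[R]_3) x : open N -> smooth_map N F ->
  (forall x, N x -> V (F x)) -> N x -> forall i,
  pd i (fun y => \sum_k a 0 k * Phi k (F y)) x =
  \sum_c (\sum_k a 0 k * pd c (Phi k) (F x)) * pd i (fun y => F y 0 c) x.
Proof.
move=> oN sF NV Nx i.
have E : is_derive x 'e_i (fun y => \sum_k a 0 k * Phi k (F y))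
    (\sum_k (0 * Phi k (F x) + a 0 k * \sum_c pd c (Phi k) (F x) * pd i (fun y => F y 0 c) x)).
  apply: isd_sum => k; apply: (isdM (isdC (a 0 k) x _)).
  apply: (is_derive_eq (smooth_is_derive i (smooth_comp oN (em_open em) NV (em_smooth em k) sF) Nx)).
  exact: (pd_comp_on i oN (em_open em) NV (em_smooth em k) sF Nx).
rewrite (is_derive_pd E).
under [RHS]eq_bigr => c _ do rewrite mulr_suml.
rewrite exchange_big /=; apply: eq_bigr => k _; rewrite mul0r add0r mulr_sumr.
by apply: eq_bigr => c _; rewrite mulrA.
Qed.

(** A combination that vanishes near x has zero jet at F x, and the jets of the
    Phi_a are independent. *)
Lemma model_functions_free N F (a : 'rV[R]_3) x : open N -> smooth_map N F ->
  (forall x, N x -> V (F x)) -> N x -> jac F x != 0 ->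
  (\forall y \near x, \sum_k a 0 k * Phi k (F y) = 0) -> a = 0.
Proof.
move=> oN sF NV Nx J0 H; apply: (jets_injective (NV _ Nx)).
have H0 : \sum_k a 0 k * Phi k (F x) = 0 by exact: (nbhs_singleton H).
have Hi i : \sum_c (\sum_k a 0 k * pd c (Phi k) (F x)) * pd i (fun y => F y 0 c) x = 0.
  by rewrite -(jet_comp a oN sF NV Nx) (pd_near_eq (g := fun=> 0)) ?pd_cst.
have e0 := Hi 0; have e1 := Hi 1; rewrite !sum2E in e0 e1.
have [|X0 Y0] := solve2 _ e0 e1.
  by move: J0; apply: contra_neq; rewrite /jac => e; rewrite -[RHS]e; gen_pd; ring.
by case=> [i|]; [elim/ord2P: i|exact: H0].
Qed.

Lemma hess_lincomb N G b (I : Type) (r : seq I) (f : I -> plane R -> R) (c : I -> R) : open N ->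
  (forall k, smooth N (f k)) -> (forall k, hess_eq N G (f k) b) ->
  hess_eq N G (fun y => \sum_(k <- r) c k * f k y) b.
Proof.
move=> oN sf Hf x Nx i j.
have E l y : N y -> is_derive y 'e_l (fun y => \sum_(k <- r) c k * f k y)
    (\sum_(k <- r) (0 * f k y + c k * pd l (f k) y)).
  by move=> Ny; apply: isd_sum => k; exact: (isdM (isdC (c k) y _) (smooth_is_derive l (sf k) Ny)).
have E1 l y : N y -> pd l (fun y => \sum_(k <- r) c k * f k y) y = \sum_(k <- r) c k * pd l (f k) y.
  by move=> Ny; rewrite (is_derive_pd (E l y Ny)); apply: eq_bigr => k _; rewrite mul0r add0r.
have E2 : pd i (pd j (fun y => \sum_(k <- r) c k * f k y)) x = \sum_(k <- r) c k * pd i (pd j (f k)) x.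
  rewrite (pd_eq_on (g := fun y => \sum_(k <- r) c k * pd j (f k) y) i oN _ Nx); last first.
    by move=> y; rewrite inE; exact: E1.
  have E' : is_derive x 'e_i (fun y => \sum_(k <- r) c k * pd j (f k) y)
      (\sum_(k <- r) (0 * pd j (f k) x + c k * pd i (pd j (f k)) x)).
    by apply: isd_sum => k; exact: (isdM (isdC (c k) x _) (smooth_is_derive i (smooth_pd j (sf k)) Nx)).
  by rewrite (is_derive_pd E'); apply: eq_bigr => k _; rewrite mul0r add0r.
rewrite /hessian E2; under [X in _ - X]eq_bigr => l _ do rewrite E1 // mulr_sumr.
rewrite exchange_big /= -sumrB mulr_suml; apply: eq_bigr => k _.
rewrite -mulrA -(Hf k x Nx i j) /hessian mulrBr; congr (_ - _).
by rewrite mulr_sumr; apply: eq_bigr => l _; rewrite mulrCA.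
Qed.

Lemma hess_sub N G b f h : open N -> smooth N f -> smooth N h -> hess_eq N G f b ->
  hess_eq N G h b -> hess_eq N G (fun y => f y - h y) b.
Proof.
move=> oN sf sh Hf Hh.
have := @hess_lincomb N G b bool [:: true; false] (fun k => if k then f else h)
  (fun k => if k then 1 else -1) oN.
move=> /(_ _ _)/hess_eq_ext; apply=> //; try by case.
by move=> y _; rewrite !big_cons big_nil /=; ring.
Qed.

(** The jet of u at x is that of a combination of the Phi_a o F, because the jets
    of the Phi_a at F x span; both functions solve the same system, so they
    agree near x. *)
Lemma solution_is_model_function U N G b F u x : curv_data U G b -> open N -> N `<=` U ->
  smooth_map N F -> (forall x, N x -> V (F x)) -> intertwines N G Gm F ->
  (forall x, N x -> jac F x != 0) -> smooth N u ->
  hess_eq N G u (fun i j x => - b i j x) -> N x ->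
  exists a : 'rV[R]_3, \forall y \near x, u y = \sum_k a 0 k * Phi k (F y).
Proof.
move=> cd0 oN NU sF NV iF JF su Hu Nx; have cd := curv_data_sub oN NU cd0.
have oV := em_open em.
pose v i := pd i u x; pose J := jac F x; have J0 : J != 0 by exact: JF.
set c00 := pd 0 (fun y => F y 0 0) x; set c10 := pd 1 (fun y => F y 0 0) x.
set c01 := pd 0 (fun y => F y 0 1) x; set c11 := pd 1 (fun y => F y 0 1) x.
have J0' : c00 * c11 - c10 * c01 != 0 by exact: J0.
(* c is the jet at F x that F pulls back to the jet of u at x (Cramer's rule). *)
pose c (m : option 'I_2) : R := if m is Some i then
  (if i == 0 then (c11 * v 0 - c01 * v 1) / (c00 * c11 - c10 * c01)
   else (c00 * v 1 - c10 * v 0) / (c00 * c11 - c10 * c01)) else u x.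
have [a Ha] := jets_surjective c (NV _ Nx); exists a.
pose h y := \sum_k a 0 k * (Phi k \o F) y.
have sPF k : smooth N (Phi k \o F) := smooth_comp oN oV NV (em_smooth em k) sF.
have sh : smooth N h.
  by apply: smooth_sum => // k; apply: smooth_mul => //; exact: smooth_cst.
have Hh : hess_eq N G h (fun i j x => - b i j x).
  by apply: hess_lincomb => // k; exact: (model_functions_hess cd oN _ sF NV iF JF).
pose q m := jet (fun y => u y - h y) m.
have sq : smooth N (fun y => u y - h y).
  by apply: smooth_add => //; exact: smooth_opp.
have Hq := hess_sub oN su sh Hu Hh.
have [d d0 [dN Hd]] : exists2 d, 0 < d & ball x d `<=` N /\ forall m y, ball x d y -> q m y = 0.
  apply: (@linear_unique R _ (jet_coeff G b) q N x oN Nx).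
  - by move=> k i j; exact: smooth_jet_coeff cd.
  - by move=> y k m Ny; exact: (jet_is_derive k m sq Hq Ny).
  case=> [i|]; rewrite /q /=; last by rewrite -[u x](Ha None) subrr.
  have ph : pd i h x = pd i u x.
    rewrite (jet_comp a oN sF NV Nx) sum2E.
    have -> : \sum_k a 0 k * pd 0 (Phi k) (F x) = c (Some 0) := Ha (Some 0).
    have -> : \sum_k a 0 k * pd 1 (Phi k) (F x) = c (Some 1) := Ha (Some 1).
    rewrite /c /=; elim/ord2P: i; rewrite -?/c00 -?/c10 -?/c01 -?/c11 -/(v _);
      clearbody c00 c01 c10 c11; move: (v 0) (v 1) => v0 v1; field => //.
  have := isdB (smooth_is_derive i su Nx) (smooth_is_derive i sh Nx).
  by move=> /is_derive_pd ->; rewrite ph subrr.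
apply/nbhs_ballP; exists d => //= y yd.
by have /eqP := Hd None y yd; rewrite subr_eq0 => /eqP.
Qed.

End OneModel.

(** For B = mu b the terms of [integrability] with derivatives of B cancel, b
    being parallel; what remains is (mu + 1)(b_1j d_0 u - b_0j d_1 u) = 0, and b
    is invertible. *)
Lemma rigid_gradient U G b u (mu : R) : curv_data U G b -> smooth U u -> mu != -1 ->
  hess_eq U G u (fun i j x => mu * b i j x) -> forall x, U x -> forall i, pd i u x = 0.
Proof.
move=> cd su mu1 Hu x Ux.
have oU := cd_open cd.
have sB i j : smooth U (fun x => mu * b i j x).
  by apply: smooth_mul; [|exact: smooth_cst|exact: (cd_b cd)].
have key j : b 1 j x * pd 0 u x - b 0 j x * pd 1 u x = 0.
  have := integrability cd su sB Hu Ux j.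
  have pdb k l : pd k (fun x => mu * b l j x) x = 0 * b l j x + mu * pd k (b l j) x.
    exact: (is_derive_pd (isdM (isdC mu x _) (smooth_is_derive k (cd_b cd l j) Ux))).
  rewrite !pdb !(cd_parallel cd Ux) !sum2E !(cd_Gsym cd Ux 1 0) !(cd_bsym cd Ux 1 0) => e.
  have m1 : mu + 1 != 0 by rewrite addr_eq0.
  apply: (mulfI m1); rewrite mulr0 -[RHS]e; gen_pd; ring.
have [] := @solve2 (b 1 1 x) (- b 0 1 x) (b 1 0 x) (- b 0 0 x) (pd 0 u x) (pd 1 u x).
- have := cd_det cd Ux; apply: contra_neq => e; rewrite -[RHS]oppr0 -e; ring.
- by rewrite -[RHS](key 1); ring.
- by rewrite -[RHS](key 0); ring.
- by move=> e0 e1; exact: ord2P.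
Qed.

End EmbeddedModels.

(** * Affine coordinates adapted to a model *)

Section LocalCoordinates.
Variable R : realType.
Implicit Types (x y p : plane R) (U V N : set (plane R)) (f h u : plane R -> R)
  (G : christoffel R) (b bm : bilin_field R) (F : plane R -> plane R).

(** The image of Phi lies on the quadric sum_a,c D_ac v_a v_c = 1, on which two
    of the coordinates, a1 and a2, are coordinates near Phi 0: [qm_jac] is this
    for the model and [qm_select] says that a point v of the quadric close to
    Phi 0 is determined by its entries a1 and a2. The third entry
    is a square root on the sphere and a quotient on the hyperboloids, hence this
    formulation by uniqueness. *)
Record quadric_model V bm (Phi : 'I_3 -> plane R -> R) (D : 'I_3 -> 'I_3 -> R) (a1 a2 : 'I_3) : Prop :=
 QuadricModel {
  qm_origin : V 0;
  qm_jets : forall m n, \sum_a \sum_c D a c * jet (Phi a) m 0 * jet (Phi c) n 0 = gram bm m n 0;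
  qm_diag : bm 0 1 0 = 0 /\ bm 1 0 0 = 0;
  qm_jac : jac (fun y => mkpt (Phi a1 y) (Phi a2 y)) 0 != 0;
  qm_select : exists W e, [/\ open W, W 0, W `<=` V, 0 < e &
    forall y, W y -> forall v : 'I_3 -> R, (forall a, `|v a - Phi a 0| < e) ->
      \sum_a \sum_c D a c * v a * v c = 1 -> v a1 = Phi a1 y -> v a2 = Phi a2 y ->
      forall a, v a = Phi a y] }.

(** The coframe al, be brings b at p to the diagonal form that bm has at 0. *)
Definition frame b bm p (al be : 'I_2 -> R) : Prop :=
  forall i j, b i j p = bm 0 0 0 * (al i * al j) + bm 1 1 0 * (be i * be j).

(** The f_a have at p the jets of the Phi_a at 0 transported by the linear map L
    on jets that the coframe defines, and L carries the form [gram] of the model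
    to that of b. *)
Lemma frame_jets bm b p (al be : 'I_2 -> R) (Phi f : 'I_3 -> plane R -> R) (D : 'I_3 -> 'I_3 -> R) :
  (forall m n, \sum_a \sum_c D a c * jet (Phi a) m 0 * jet (Phi c) n 0 = gram bm m n 0) ->
  bm 0 1 0 = 0 -> bm 1 0 0 = 0 -> frame b bm p al be ->
  (forall a, f a p = Phi a 0) ->
  (forall a i, pd i (f a) p = pd 0 (Phi a) 0 * al i + pd 1 (Phi a) 0 * be i) ->
  forall m n, \sum_a \sum_c D a c * jet (f a) m p * jet (f c) n p = gram b m n p.
Proof.
move=> H b01 b10 fr fp dfp m n.
pose L (l m : option 'I_2) : R := match l, m with
  | None, None => 1 | Some k, Some i => if k == 0 then al i else be i | _, _ => 0 end.
have jf a k : jet (f a) k p = \sum_l jet (Phi a) l 0 * L l k.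
  by rewrite sum_option; case: k => [k|] /=; rewrite ?fp ?dfp ?mulr1 ?mulr0 ?add0r ?addr0.
have -> : \sum_a \sum_c D a c * jet (f a) m p * jet (f c) n p =
    \sum_l \sum_r (\sum_a \sum_c D a c * jet (Phi a) l 0 * jet (Phi c) r 0) * (L l m * L r n).
  transitivity (\sum_a \sum_c \sum_l \sum_r
      D a c * jet (Phi a) l 0 * jet (Phi c) r 0 * (L l m * L r n)).
    apply: eq_bigr => a _; apply: eq_bigr => c _; rewrite !jf [D a c * _]mulr_sumr mulr_suml.
    apply: eq_bigr => l _; rewrite mulr_sumr; apply: eq_bigr => r _; ring.
  under eq_bigr => a _ do rewrite exchange_big /=.
  rewrite exchange_big /=; apply: eq_bigr => l _.
  under eq_bigr => a _ do rewrite exchange_big /=.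
  rewrite exchange_big /=; apply: eq_bigr => r _.
  rewrite mulr_suml; apply: eq_bigr => a _; rewrite mulr_suml.
  by apply: eq_bigr => c _.
under eq_bigr => l _ do under eq_bigr => r _ do rewrite H.
rewrite !sum_option; case: m n => [i|] [j|] /=; rewrite ?b01 ?b10 ?fr; ring.
Qed.

Lemma mkpt_smooth U f h : smooth U f -> smooth U h -> smooth_map U (fun y => mkpt (f y) (h y)).
Proof.
move=> sf sh; apply: ord2P.
  by rewrite (_ : (fun y => _) = f) //; apply/funext => y; rewrite mkpt0.
by rewrite (_ : (fun y => _) = h) //; apply/funext => y; rewrite mkpt1.
Qed.

Lemma jac_mkpt f h x : jac (fun y => mkpt (f y) (h y)) x =
  pd 0 f x * pd 1 h x - pd 1 f x * pd 0 h x.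
Proof.
rewrite /jac (_ : (fun y => mkpt (f y) (h y) 0 0) = f).
  by rewrite (_ : (fun y => mkpt (f y) (h y) 0 1) = h) //; apply/funext => y; rewrite mkpt1.
by apply/funext => y; rewrite mkpt0.
Qed.

Lemma smooth_map_continuous U F x : smooth_map U F -> U x -> {for x, continuous F}.
Proof.
move=> sF Ux; apply/(@cvgrPdist_le _ _ _ (nbhs x)) => e e0.
have H : \forall y \near x, forall k, `|F x 0 k - F y 0 k| <= e.
  apply: ord2_ind_near => k; have /cvgrPdist_le/(_ _ e0) := sF k 0%N x Ux; exact.
apply: filterS H => y Hy; apply/plane_norm_le; first exact: ltW.
by move=> k; rewrite !mxE.
Qed.

(** Take the solutions f_a with these jets. Near p the point (f_a x) is on the
    quadric and close to Phi 0, so it equals Phi (F x), where F x is found from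
    the entries a1 and a2 by inverting the map phi with components Phi_a1 and
    Phi_a2. *)
Theorem local_coordinates V Gm bm Phi D a1 a2 U G b p al be :
  embedded_model V Gm bm Phi -> quadric_model V bm Phi D a1 a2 ->
  curv_data U G b -> U p -> frame b bm p al be ->
  exists N F, [/\ [/\ open N, N p & N `<=` U], smooth_map N F,
    (forall x, N x -> V (F x)), intertwines N G Gm F & jac F p != 0].
Proof.
move=> em qm cd Up fr.
have [b01 b10] := qm_diag qm.
have [d [d0 dU Hd]] := hessian_solve cd Up.
have /choice [f Hf] : forall a, exists f, [/\ smooth (ball p d) f,
    hess_eq (ball p d) G f (fun i j x => - b i j x), f p = Phi a 0 &
    forall i, pd i f p = pd 0 (Phi a) 0 * al i + pd 1 (Phi a) 0 * be i].
  by move=> a; exact: (Hd (Phi a 0) (fun i => pd 0 (Phi a) 0 * al i + pd 1 (Phi a) 0 * be i)).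
have sf a : smooth (ball p d) (f a) by case: (Hf a).
have hf a : hess_eq (ball p d) G (f a) (fun i j x => - b i j x) by case: (Hf a).
have fp a : f a p = Phi a 0 by case: (Hf a).
have dfp a i : pd i (f a) p = pd 0 (Phi a) 0 * al i + pd 1 (Phi a) 0 * be i by case: (Hf a).
have pp : ball p d p by exact: ballxx.
have cdd := curv_data_sub (ball_open p d : open (ball p d)) dU cd.
have [d2 d20 [d2d quad]] := quadric cdd pp sf hf (frame_jets (qm_jets qm) b01 b10 fr fp dfp).
have [W [e [oW W0 WV e0 sel]]] := qm_select qm.
pose phi y := mkpt (Phi a1 y) (Phi a2 y).
have sphi : smooth_map W phi.
  by apply: mkpt_smooth; apply: smooth_sub WV (em_smooth em _).
have [N2 [Psi [[oN2 N20 N2W] oPN2 PsiK cPsi sPsi]]] := inverse_function oW W0 sphi (qm_jac qm).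
(* Psi inverts phi near 0, and F is Psi after fm. *)
pose fm x := mkpt (f a1 x) (f a2 x).
have sfm : smooth_map (ball p d) fm by exact: mkpt_smooth.
have fmp : fm p = phi 0 by rewrite /fm !fp.
have n1 : \forall x \near p, (phi @` N2) (fm x).
  have cfm : {for p, continuous fm} by exact: smooth_map_continuous sfm pp.
  have : nbhs (fm p) (phi @` N2).
    by apply: open_nbhs_nbhs; split=> //; rewrite fmp; exists 0.
  exact: cfm.
have n2 : \forall x \near p, forall a, `|f a x - Phi a 0| < e.
  apply: (@filter_forall _ _ _ (nbhs p)) => a.
  have e20 : 0 < e / 2 by rewrite divr_gt0.
  have := near_dist_le (sf a 0%N p pp) e20; apply: filterS => x; rewrite fp => h.
  by apply: le_lt_trans h _; rewrite ltr_pdivrMr // ltr_pMr // ltr1n.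
have n3 : nbhs p (ball p d2) by apply: open_nbhs_nbhs; split; [exact: ball_open|exact: ballxx].
have /nbhs_ballP[r /= r0 Hr] : nbhs p ((fun x => (phi @` N2) (fm x)) `&`
    (fun x => forall a, `|f a x - Phi a 0| < e) `&` ball p d2).
  by apply: filterI n3; apply: filterI.
set N := ball p r.
have oN : open N by exact: ball_open.
have Nd : N `<=` ball p d by move=> x /Hr[_ /d2d].
pose F := Psi \o fm.
have N2F x : N x -> N2 (F x) /\ phi (F x) = fm x.
  by move=> /Hr[[[y Ny ey] _] _]; rewrite /F /= -ey PsiK.
have sF : smooth_map N F.
  move=> k; apply: (smooth_comp (V := phi @` N2) oN oPN2 _ (sPsi k)).
    by move=> x /Hr[[]].
  by move=> l; exact: smooth_sub Nd (sfm l).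
have NV x : N x -> V (F x) by move=> /N2F[/N2W/WV].
have fPhi x a : N x -> f a x = Phi a (F x).
  move=> Nx; have [N2Fx ephi] := N2F x Nx; have [[_ ne] Qx] := Hr x Nx.
  apply: (sel (F x) (N2W _ N2Fx) (fun a => f a x)) => //.
  - exact: quad.
  - by have := congr1 (fun v : plane R => v 0 0) ephi; rewrite !mkpt0.
  - by have := congr1 (fun v : plane R => v 0 1) ephi; rewrite !mkpt1.
have Np : N p by exact: ballxx.
exists N, F; split=> //; first by split=> // x /Nd/dU.
- apply: (model_functions_intertwine em oN sF NV) => a.
  apply: (hess_eq_ext oN (f := f a)) => [x|x Nx i j]; first by rewrite inE => Nx; exact: fPhi.
  exact: (hf a x (Nd _ Nx)).
- have Fp0 : F p = 0 by rewrite /F /= fmp PsiK.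
  have e1 : jac (phi \o F) p = jac phi (F p) * jac F p.
    by apply: (jac_comp oN oN2 _ sF _ Np) => [x /N2F[]//|k]; exact: smooth_sub N2W (sphi k).
  have e2 : jac (phi \o F) p = jac fm p.
    by apply: (jac_eq_on oN _ Np) => x; rewrite inE => /N2F[].
  have e3 : jac fm p = jac phi 0 * (al 0 * be 1 - al 1 * be 0).
    rewrite !jac_mkpt !dfp; gen_pd; move: (al 0) (al 1) (be 0) (be 1) => *; ring.
  have e4 : bm 0 0 0 * bm 1 1 0 * (al 0 * be 1 - al 1 * be 0) ^+ 2 != 0.
    by have := cd_det cd Up; rewrite !fr; apply: contra_neq => e4; rewrite -[RHS]e4; ring.
  have e5 : al 0 * be 1 - al 1 * be 0 != 0.
    by move: e4; apply: contra_neq => ->; rewrite expr0n mulr0.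
  move: (qm_jac qm) => J0.
  have : jac phi 0 * jac F p != 0 by rewrite -{1}Fp0 -e1 e2 e3 mulf_neq0.
  by rewrite mulf_eq0 negb_or => /andP[].
Qed.

(** Completing the square. *)
Lemma definite_frame (b00 b01 b11 : R) : 0 < b00 -> 0 < b00 * b11 - b01 ^+ 2 ->
  exists a0 a1 c0 c1 : R, [/\ b00 = a0 * a0 + c0 * c0, b01 = a0 * a1 + c0 * c1 & b11 = a1 * a1 + c1 * c1].
Proof.
move=> b0 D0; exists (Num.sqrt b00), (b01 / Num.sqrt b00), 0, (Num.sqrt ((b00 * b11 - b01 ^+ 2) / b00)).
have s0 : Num.sqrt b00 != 0 by rewrite gt_eqF // sqrtr_gt0.
have sE : Num.sqrt b00 * Num.sqrt b00 = b00 by rewrite -expr2 sqr_sqrtr // ltW.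
have s1E : Num.sqrt ((b00 * b11 - b01 ^+ 2) / b00) * Num.sqrt ((b00 * b11 - b01 ^+ 2) / b00) =
  (b00 * b11 - b01 ^+ 2) / b00 by rewrite -expr2 sqr_sqrtr // divr_ge0 // ltW.
split; first by rewrite sE mul0r addr0.
  by rewrite mul0r addr0 mulrC divfK.
rewrite s1E.
have -> : b01 / Num.sqrt b00 * (b01 / Num.sqrt b00) = b01 ^+ 2 / (Num.sqrt b00 * Num.sqrt b00) by field.
by rewrite sE; field; rewrite gt_eqF.
Qed.

(** Completing the square if b00 is non-zero. If b00 = 0, the form is the product
    y (2 b01 x + b11 y), which is the difference of the squares of the half-sum
    and of the half-difference of its factors. *)
Lemma lorentz_frame (b00 b01 b11 : R) : b00 * b11 - b01 ^+ 2 < 0 ->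
  exists a0 a1 c0 c1 : R, [/\ b00 = - (a0 * a0) + c0 * c0, b01 = - (a0 * a1) + c0 * c1 & b11 = - (a1 * a1) + c1 * c1].
Proof.
move=> D0.
have pos (s t u : R) : 0 < s -> s * u - t ^+ 2 < 0 -> exists a0 a1 c0 c1 : R,
    [/\ s = - (a0 * a0) + c0 * c0, t = - (a0 * a1) + c0 * c1 & u = - (a1 * a1) + c1 * c1].
  move=> s0 d0; exists 0, (Num.sqrt ((t ^+ 2 - s * u) / s)), (Num.sqrt s), (t / Num.sqrt s).
  have n0 : Num.sqrt s != 0 by rewrite gt_eqF // sqrtr_gt0.
  have sE : Num.sqrt s * Num.sqrt s = s by rewrite -expr2 sqr_sqrtr // ltW.
  have s1E : Num.sqrt ((t ^+ 2 - s * u) / s) * Num.sqrt ((t ^+ 2 - s * u) / s) = (t ^+ 2 - s * u) / s.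
    by rewrite -expr2 sqr_sqrtr // divr_ge0 ?(ltW s0) //; lra.
  split; first by rewrite sE; ring.
    by rewrite mul0r oppr0 add0r mulrC divfK.
  rewrite s1E.
  have -> : t / Num.sqrt s * (t / Num.sqrt s) = t ^+ 2 / (Num.sqrt s * Num.sqrt s) by field.
  by rewrite sE; field; rewrite gt_eqF.
case: (ltrgt0P b00) => [b0|b0|b0]; first exact: pos.
- have := pos (- b00) (- b01) (- b11); rewrite oppr_gt0 => /(_ b0).
  move=> []; first by rewrite mulrNN sqrrN.
  move=> a0 [a1 [c0 [c1 [e0 e1 e2]]]]; exists c0, c1, a0, a1.
  by split; [rewrite -[LHS]opprK e0|rewrite -[LHS]opprK e1|rewrite -[LHS]opprK e2]; ring.
- subst b00; exists ((- 2 * b01) / 2), ((1 - b11) / 2), (2 * b01 / 2), ((1 + b11) / 2).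
  by split; field.
Qed.

End LocalCoordinates.

(** * The sphere and the hyperboloids *)

Section ModelFunctions.
Variable R : realType.
Implicit Types (x y p : plane R) (U V N : set (plane R)).

Lemma ord3P (P : 'I_3 -> Prop) : P 0 -> P 1 -> P ord_max -> forall k, P k.
Proof.
move=> P0 P1 P2 [[|[|[|//]]] h].
- by rewrite (_ : Ordinal h = 0) //; apply/val_inj.
- by rewrite (_ : Ordinal h = 1) //; apply/val_inj.
- by rewrite (_ : Ordinal h = ord_max) //; apply/val_inj.
Qed.

Lemma sum3E (V : nmodType) (F : 'I_3 -> V) : \sum_(a < 3) F a = F 0 + (F 1 + F ord_max).
Proof.
rewrite !big_ord_recl big_ord0 addr0; congr (F _ + (F _ + F _)); exact/val_inj.
Qed.

(** All the functions of the models are of this shape, which is stable under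
    partial derivatives. *)
Definition sep2 (f g h k : R -> R) : plane R -> R :=
  fun y => f (y 0 0) * g (y 0 1) + h (y 0 0) * k (y 0 1).

Definition deriv_fun (f f' : R -> R) := forall t : R, is_derive t 1 f (f' t).

Lemma pd_sep2 f f' g g' h h' k k' : deriv_fun f f' -> deriv_fun g g' ->
  deriv_fun h h' -> deriv_fun k k' ->
  pd 0 (sep2 f g h k) = sep2 f' g h' k /\ pd 1 (sep2 f g h k) = sep2 f g' h k'.
Proof.
move=> df dg dh dk.
have H i (x : plane R) := isdD (isdM (is_derive_coord_fun i (df (x 0 0))) (is_derive_coord_fun i (dg (x 0 1))))
  (isdM (is_derive_coord_fun i (dh (x 0 0))) (is_derive_coord_fun i (dk (x 0 1)))).
split; apply/funext => x; apply: is_derive_pd; apply: (is_derive_eq (H _ x));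
  by rewrite /sep2 /= !mul0r ?mulr0 !mul1r ?addr0 ?add0r.
Qed.

Lemma hessian_sep2 f f1 f2 g g1 g2 h h1 h2 k k1 k2 G i j x :
  deriv_fun f f1 -> deriv_fun f1 f2 -> deriv_fun g g1 -> deriv_fun g1 g2 ->
  deriv_fun h h1 -> deriv_fun h1 h2 -> deriv_fun k k1 -> deriv_fun k1 k2 ->
  hessian G (sep2 f g h k) i j x =
  (if i == 0 then if j == 0 then sep2 f2 g h2 k x else sep2 f1 g1 h1 k1 x
   else if j == 0 then sep2 f1 g1 h1 k1 x else sep2 f g2 h k2 x) -
  (G i j 0 x * sep2 f1 g h1 k x + G i j 1 x * sep2 f g1 h k1 x).
Proof.
move=> df df1 dg dg1 dh dh1 dk dk1.
have [e0 e1] := pd_sep2 df dg dh dk.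
have [e00 e10] := pd_sep2 df1 dg dh1 dk.
have [e01 e11] := pd_sep2 df dg1 dh dk1.
rewrite /hessian sum2E e0 e1; congr (_ - _).
by elim/ord2P: i; elim/ord2P: j; rewrite /= ?e0 ?e1 ?e00 ?e10 ?e01 ?e11.
Qed.

Definition nsin (t : R) : R := - sin t.
Definition ncos (t : R) : R := - cos t.
Definition expN (t : R) : R := expR (- t).
Definition nexpN (t : R) : R := - expR (- t).
Definition one (t : R) : R := 1.
Definition zero (t : R) : R := 0.

Lemma d_sin : deriv_fun sin cos. Proof. by move=> t; exact: is_derive_sin. Qed.
Lemma d_cos : deriv_fun cos nsin. Proof. by move=> t; exact: is_derive_cos. Qed.
Lemma d_nsin : deriv_fun nsin ncos. Proof. by move=> t; apply: isdN; exact: is_derive_sin. Qed.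
Lemma d_exp : deriv_fun expR expR. Proof. by move=> t; exact: is_derive_expR. Qed.
Lemma d_expN : deriv_fun expN nexpN.
Proof.
move=> t.
have H := is_derive1_comp (is_derive_expR (- t)) (isdN (is_derive_id t (1 : R))).
apply: (is_derive_eq H); rewrite /nexpN.
by rewrite mulrN1.
Qed.
Lemma d_nexpN : deriv_fun nexpN expN.
Proof. by move=> t; rewrite -[expN t]opprK; apply: isdN; exact: d_expN. Qed.
Lemma d_one : deriv_fun one zero. Proof. by move=> t; exact: isdC. Qed.
Lemma d_zero : deriv_fun zero zero. Proof. by move=> t; exact: isdC. Qed.
Lemma d_id : deriv_fun id one. Proof. by move=> t; exact: is_derive_id. Qed.

Lemma coord_fun_C0 (f f' : R -> R) k U : deriv_fun f f' -> Cn 0 U (fun x => f (x 0 k)).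
Proof.
move=> df x _; apply: (@continuous_comp _ _ _ (fun x : plane R => x 0 k) f); first exact: coord_continuous.
have [d _] := df (x 0 k); exact/differentiable_continuous/derivable1_diffP.
Qed.

Lemma smooth_sincos k U : open U -> smooth U (fun x => sin (x 0 k)) /\ smooth U (fun x => cos (x 0 k)).
Proof.
move=> oU; suff H n : Cn n U (fun x => sin (x 0 k)) /\ Cn n U (fun x => cos (x 0 k)).
  by split=> n; case: (H n).
elim: n => [|n [IHs IHc]]; first by split; [exact: coord_fun_C0 d_sin|exact: coord_fun_C0 d_cos].
split; first by apply: (Cn_coord_fun oU _ IHc) => x _; exact: d_sin.
by apply: (@Cn_coord_fun _ _ _ cos nsin k oU _ (Cn_opp oU IHs)) => x _; exact: d_cos.
Qed.

Lemma smooth_exp k U : open U -> smooth U (fun x => expR (x 0 k)).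
Proof.
move=> oU n; elim: n => [|n IH]; first exact: coord_fun_C0 d_exp.
by apply: (Cn_coord_fun oU _ IH) => x _; exact: d_exp.
Qed.

Lemma smooth_expN k U : open U -> smooth U (fun x => expN (x 0 k)).
Proof.
move=> oU n; elim: n => [|n IH]; first exact: coord_fun_C0 d_expN.
by apply: (@Cn_coord_fun _ _ _ expN nexpN k oU _ (Cn_opp oU IH)) => x _; exact: d_expN.
Qed.

Lemma smooth_coord k U : smooth U (fun x => x 0 k).
Proof. by move=> n; exact: Cn_coord. Qed.

Lemma smooth_sep2 f g h k U : open U -> smooth U (fun x => f (x 0 0)) -> smooth U (fun x => g (x 0 1)) ->
  smooth U (fun x => h (x 0 0)) -> smooth U (fun x => k (x 0 1)) -> smooth U (sep2 f g h k).
Proof. by move=> oU sf sg sh sk; apply: smooth_add => //; apply: smooth_mul. Qed.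

(** Cartesian coordinates of the unit sphere, x^1 being the latitude and x^2 the
    longitude. *)
Definition S2_functions (a : 'I_3) : plane R -> R :=
  if a == 0 then sep2 sin one zero one
  else if a == 1 then sep2 cos cos zero one
  else sep2 cos sin zero one.

Definition S2_metric : bilin_field R := fun i j x =>
  if i == j then (if i == 0 then 1 else cos (x 0 0) * cos (x 0 0)) else 0.

Lemma S2_open : open (model_domain (S2 R)).
Proof.
apply: (@open_comp _ _ (fun x : plane R => `|x 0 0|) [set t | t < pi / 2]) => [x _|]; last exact: open_lt.
apply: (@continuous_comp _ _ _ (fun x : plane R => x 0 0) (fun t : R => `|t|)); first exact: coord_continuous.
exact: norm_continuous.
Qed.

Lemma S2_cos x : model_domain (S2 R) x -> cos (x 0 0) != 0.
Proof.
rewrite /= ltr_norml => /andP[x1 x2].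
by rewrite gt_eqF // cos_gt0_pihalf // x1 x2.
Qed.

Lemma linear_combination (a b A B X : R) : A = 0 -> B = 0 -> X = a * A + b * B -> X = 0.
Proof. by move=> -> -> ->; rewrite !mulr0 addr0. Qed.

(** The jets are independent because the position vector and its two partial
    derivatives are orthogonal non-zero vectors of R^3. *)
Lemma embedded_S2 : embedded_model (model_domain (S2 R)) (model_symbols (S2 R)) S2_metric S2_functions.
Proof.
have oV := S2_open.
have [ss0 sc0] := smooth_sincos 0 oV; have [ss1 sc1] := smooth_sincos 1 oV.
split=> //.
- by elim/ord3P; apply: smooth_sep2 => //; exact: smooth_cst.
- move=> i j; rewrite /S2_metric.
  by elim/ord2P: i; elim/ord2P: j; try exact: smooth_cst; exact: smooth_mul.
- move=> a x Vx i j; have c0 := S2_cos Vx.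
  have cs : sin (x 0 0) * sin (x 0 0) = 1 - cos (x 0 0) * cos (x 0 0).
    by apply/eqP; rewrite eq_sym subr_eq addrC -!expr2 cos2Dsin2.
  rewrite /S2_metric /S2_functions; elim/ord3P: a => /=.
  + rewrite (hessian_sep2 _ _ _ _ d_sin d_cos d_one d_zero d_zero d_zero d_one d_zero).
    rewrite /sep2 /nsin /ncos /one /zero /tan; move: c0 cs.
    move: (sin (x 0 0)) (cos (x 0 0)) => s c c0 cs.
    by elim/ord2P: i; elim/ord2P: j => /=; field.
  + rewrite (hessian_sep2 _ _ _ _ d_cos d_nsin d_cos d_nsin d_zero d_zero d_one d_zero).
    rewrite /sep2 /nsin /ncos /one /zero /tan; move: c0 cs.
    move: (sin (x 0 0)) (cos (x 0 0)) (sin (x 0 1)) (cos (x 0 1)) => s c s' c' c0 cs.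
    elim/ord2P: i; elim/ord2P: j => /=; try by field.
    apply/eqP; rewrite -subr_eq0; apply/eqP.
    by transitivity (c' * c * (s * s - (1 - c * c))); [ring|rewrite cs subrr mulr0].
  + rewrite (hessian_sep2 _ _ _ _ d_cos d_nsin d_sin d_cos d_zero d_zero d_one d_zero).
    rewrite /sep2 /nsin /ncos /one /zero /tan; move: c0 cs.
    move: (sin (x 0 0)) (cos (x 0 0)) (sin (x 0 1)) (cos (x 0 1)) => s c s' c' c0 cs.
    elim/ord2P: i; elim/ord2P: j => /=; try by field.
    apply/eqP; rewrite -subr_eq0; apply/eqP.
    by transitivity (s' * c * (s * s - (1 - c * c))); [ring|rewrite cs subrr mulr0].
- move=> y Vy t H; have c0 := S2_cos Vy.
  have h0 := H 0; have h1 := H 1; have h2 := H ord_max.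
  have cs : cos (y 0 0) ^+ 2 + sin (y 0 0) ^+ 2 = 1 := cos2Dsin2 _.
  have cs' : cos (y 0 1) ^+ 2 + sin (y 0 1) ^+ 2 = 1 := cos2Dsin2 _.
  have [e00 e01] := pd_sep2 d_sin d_one d_zero d_one.
  have [e10 e11] := pd_sep2 d_cos d_cos d_zero d_one.
  have [e20 e21] := pd_sep2 d_cos d_sin d_zero d_one.
  move: h0 h1 h2; rewrite !sum_option /jet /S2_functions /= e00 e01 e10 e11 e20 e21.
  rewrite /sep2 /nsin /ncos /one /zero; move: c0 cs cs'.
  move: (sin (y 0 0)) (cos (y 0 0)) (sin (y 0 1)) (cos (y 0 1)) => s c s' c' c0 cs cs'.
  move=> h0 h1 h2.
  have A : c * t None - s * t (Some 0) = 0.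
    transitivity ((c' ^+ 2 + s' ^+ 2) * (c * t None - s * t (Some 0))); first by rewrite cs' mul1r.
    by apply: (@linear_combination c' s' _ _ _ h1 h2); ring.
  have k0 : t None = 0.
    transitivity ((c ^+ 2 + s ^+ 2) * t None); first by rewrite cs mul1r.
    by apply: (@linear_combination c s _ _ _ A h0); ring.
  have k1 : t (Some 0) = 0.
    by apply: (mulfI c0); rewrite mulr0 -[RHS]h0 k0; ring.
  have k2 : t (Some 1) = 0.
    apply: (mulfI c0); rewrite mulr0.
    transitivity ((c' ^+ 2 + s' ^+ 2) * (c * t (Some 1))); first by rewrite cs' mul1r.
    move: h1 h2; rewrite k0 k1 => h1 h2.
    by apply: (@linear_combination (- s') c' _ _ _ h1 h2); ring.
  by case=> [i|//]; elim/ord2P: i.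
Qed.

Definition S2_form (a c : 'I_3) : R := (a == c)%:R.

(** On the sphere the point is known from its entries 0 and 2 as soon as its
    entry 1 is positive. *)
Lemma quadric_S2 : quadric_model (model_domain (S2 R)) S2_metric S2_functions S2_form 0 ord_max.
Proof.
have V0 : model_domain (S2 R) 0 by rewrite /= mxE normr0 divr_gt0 // pi_gt0.
have [e00 e01] := pd_sep2 d_sin d_one d_zero d_one.
have [e10 e11] := pd_sep2 d_cos d_cos d_zero d_one.
have [e20 e21] := pd_sep2 d_cos d_sin d_zero d_one.
have zE k : (0 : plane R) 0 k = 0 by rewrite mxE.
split=> //.
- move=> m n; rewrite !sum3E /S2_form /S2_functions /=.
  case: m n => [i|] [j|]; rewrite /jet /gram /S2_metric; try elim/ord2P: i; try elim/ord2P: j;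
   rewrite /= ?e00 ?e01 ?e10 ?e11 ?e20 ?e21 /sep2 /nsin /ncos /one /zero !zE ?sin0 ?cos0; ring.
- rewrite jac_mkpt /S2_functions /= e00 e01 e20 e21 /sep2 /nsin /one /zero !zE sin0 cos0.
  by rewrite !(mulr0, mulr1, mul0r, addr0, subr0) oner_neq0.
(* Since Phi_1 0 = 1, the radius 1 makes v_1 positive. *)
- exists (model_domain (S2 R) `&` [set y | `|y 0 1| < pi / 2]), 1; split=> //.
  + apply: openI; first exact: S2_open.
    apply: (@open_comp _ _ (fun x : plane R => `|x 0 1|) [set t | t < pi / 2]) => [x _|]; last exact: open_lt.
    apply: (@continuous_comp _ _ _ (fun x : plane R => x 0 1) (fun t : R => `|t|)); first exact: coord_continuous.
    exact: norm_continuous.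
  + by split=> //=; rewrite zE normr0 divr_gt0 // pi_gt0.
  + move=> y [y0 y1] v vb; rewrite /S2_form !sum3E /= => vv v0 v2.
    have c0 : 0 < cos (y 0 0) by rewrite cos_gt0_pihalf // -ltr_norml.
    have c1 : 0 < cos (y 0 1) by rewrite cos_gt0_pihalf // -ltr_norml.
    have v1 : 0 < v 1.
      have := vb 1; rewrite /S2_functions /= /sep2 !zE cos0 /zero mul0r addr0 mulr1.
      by rewrite ltr_norml => /andP[]; lra.
    have cs : cos (y 0 0) ^+ 2 + sin (y 0 0) ^+ 2 = 1 := cos2Dsin2 _.
    have cs' : cos (y 0 1) ^+ 2 + sin (y 0 1) ^+ 2 = 1 := cos2Dsin2 _.
    elim/ord3P => //.
    move: v0 v2; rewrite /S2_functions /= /sep2 /one /zero => v0 v2.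
    rewrite mul0r addr0; apply/eqP; rewrite -(eqrXn2 (n := 2)) // ?ltW ?mulr_gt0 //.
    move: vv; rewrite v0 v2 => vv.
    apply/eqP; transitivity (1 - sin (y 0 0) ^+ 2 - cos (y 0 0) ^+ 2 * sin (y 0 1) ^+ 2).
      by rewrite -vv; ring.
    have -> : sin (y 0 0) ^+ 2 = 1 - cos (y 0 0) ^+ 2 by rewrite -cs; ring.
    have -> : sin (y 0 1) ^+ 2 = 1 - cos (y 0 1) ^+ 2 by rewrite -cs'; ring.
    ring.
Qed.

Definition csq (e t : R) : R := e * (t * t).
Definition csq1 (e t : R) : R := 2 * e * t.
Definition csq2 (e t : R) : R := 2 * e.

Lemma d_csq e : deriv_fun (csq e) (csq1 e).
Proof.
move=> t; apply: (is_derive_eq (isdM (isdC e t 1) (isdM (is_derive_id t 1) (is_derive_id t 1)))).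
by rewrite /csq1; ring.
Qed.

Lemma d_csq1 e : deriv_fun (csq1 e) (csq2 e).
Proof.
move=> t; apply: (is_derive_eq (isdM (isdC (2 * e) t 1) (is_derive_id t 1))).
by rewrite /csq2; ring.
Qed.

(** Coordinates of R^3, the entries 0 and 2 being null, in which the quadric is
    v_0 v_2 - e v_1^2 = 1. *)
Definition H2_functions (e : R) (a : 'I_3) : plane R -> R :=
  if a == 0 then sep2 expR one zero one
  else if a == 1 then sep2 expR id zero one
  else sep2 expN one expR (csq e).

(** The curvature form kappa g of the metric g = e (dx^1)^2 + exp (2 x^1) (dx^2)^2,
    for which kappa = - e. *)
Definition H2_metric (e : R) : bilin_field R := fun i j x =>
  if i == j then (if i == 0 then -1 else - e * expR (2 * x 0 0)) else 0.

Definition H2_form (e : R) (a c : 'I_3) : R :=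
  if (a == 1) && (c == 1) then - e
  else if (a != 1) && (c != 1) && (a != c) then 2^-1 else 0.

Lemma exp_double (t : R) : expR (2 * t) = expR t * expR t.
Proof. by rewrite mulr_natl mulr2n expRD. Qed.

Lemma embedded_H2 (e : R) : e * e = 1 ->
  embedded_model (model_domain (H2 e)) (model_symbols (H2 e)) (H2_metric e) (H2_functions e).
Proof.
move=> ee.
have oV : open (model_domain (H2 e)) by exact: openT.
have sE := smooth_exp 0 oV; have sN := smooth_expN 0 oV.
have s1 : smooth (model_domain (H2 e)) (fun x => x 0 1) by exact: smooth_coord.
split=> //.
- elim/ord3P; apply: smooth_sep2 => //; try exact: smooth_cst.
  by apply: smooth_mul; [|exact: smooth_cst|exact: smooth_mul].
- move=> i j; rewrite /H2_metric.
  elim/ord2P: i; elim/ord2P: j => /=; try exact: smooth_cst.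
  apply: (smooth_eq (f := fun x => - e * (expR (x 0 0) * expR (x 0 0)))) => //.
    by move=> x _; rewrite exp_double.
  by apply: smooth_mul; [|exact: smooth_cst|exact: smooth_mul].
- move=> a x Vx i j.
  rewrite /H2_metric /H2_functions; elim/ord3P: a => /=.
  + rewrite (hessian_sep2 _ _ _ _ d_exp d_exp d_one d_zero d_zero d_zero d_one d_zero).
    rewrite /sep2 /one /zero exp_double; move: (expR (x 0 0)) => E.
    by elim/ord2P: i; elim/ord2P: j => /=; ring.
  + rewrite (hessian_sep2 _ _ _ _ d_exp d_exp d_id d_one d_zero d_zero d_one d_zero).
    rewrite /sep2 /one /zero exp_double; move: (expR (x 0 0)) => E.
    by elim/ord2P: i; elim/ord2P: j => /=; ring.
  + rewrite (hessian_sep2 _ _ _ _ d_expN d_nexpN d_one d_zero d_exp d_exp (d_csq e) (d_csq1 e)).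
    rewrite /sep2 /one /zero /nexpN /expN /csq /csq1 /csq2 exp_double expRN.
    have := expR_gt0 (x 0 0); move: (expR (x 0 0)) => E E0.
    have {}E0 : E != 0 by rewrite gt_eqF.
    by elim/ord2P: i; elim/ord2P: j => /=; field.
- move=> y Vy t H.
  have h0 := H 0; have h1 := H 1; have h2 := H ord_max.
  have [e00 e01] := pd_sep2 d_exp d_one d_zero d_one.
  have [e10 e11] := pd_sep2 d_exp d_id d_zero d_one.
  have [e20 e21] := pd_sep2 d_expN d_one d_exp (d_csq e).
  move: h0 h1 h2; rewrite !sum_option /jet /H2_functions /= e00 e01 e10 e11 e20 e21.
  rewrite /sep2 /nexpN /expN /csq /csq1 /one /zero expRN.
  have := expR_gt0 (y 0 0); move: (expR (y 0 0)) => E E0.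
  have {}E0 : E != 0 by rewrite gt_eqF.
  move=> h0 h1 h2.
  have k1 : t (Some 0) = - t None.
    apply: (mulfI E0); apply/eqP; rewrite -subr_eq0; apply/eqP; rewrite -[RHS]h0; ring.
  have k2 : t (Some 1) = 0.
    apply: (mulfI E0); rewrite mulr0 -[RHS]h1 k1; ring.
  have k0 : t None = 0.
    have n2 : 2 * E^-1 != 0 by rewrite mulf_neq0 ?invr_eq0 // pnatr_eq0.
    apply: (mulfI n2); rewrite mulr0 -[RHS]h2 k1 k2; ring.
  by case=> [i|//]; elim/ord2P: i; rewrite ?k1 ?k2 ?k0 ?oppr0.
Qed.

(** On v_0 v_2 - e v_1^2 = 1 the entry 2 is obtained by dividing by v_0. *)
Lemma quadric_H2 (e : R) : quadric_model (model_domain (H2 e)) (H2_metric e) (H2_functions e) (H2_form e) 0 1.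
Proof.
have [e00 e01] := pd_sep2 d_exp d_one d_zero d_one.
have [e10 e11] := pd_sep2 d_exp d_id d_zero d_one.
have [e20 e21] := pd_sep2 d_expN d_one d_exp (d_csq e).
have zE k : (0 : plane R) 0 k = 0 by rewrite mxE.
split=> //.
- move=> m n; rewrite !sum3E /H2_form /H2_functions /=.
  case: m n => [i|] [j|]; rewrite /jet /gram /H2_metric; try elim/ord2P: i; try elim/ord2P: j;
   rewrite /= ?e00 ?e01 ?e10 ?e11 ?e20 ?e21 /sep2 /nexpN /expN /csq /csq1 /one /zero !zE ?mulr0 ?oppr0 ?expR0; by field.
- rewrite jac_mkpt /H2_functions /= e00 e01 e10 e11 /sep2 /one /zero !zE expR0.
  by rewrite !(mulr0, mulr1, mul0r, addr0, subr0) oner_neq0.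
- exists setT, 1; split=> //; first exact: openT.
  move=> y _ v vb; rewrite /H2_form !sum3E /= => vv v0 v1.
  elim/ord3P => //.
  move: v0 v1; rewrite /H2_functions /= /sep2 /one /zero /expN /csq expRN => v0 v1.
  move: vv; rewrite v0 v1.
  have := expR_gt0 (y 0 0); move: (expR (y 0 0)) => E E0.
  have {}E0 : E != 0 by rewrite gt_eqF.
  move=> vv; apply: (mulfI E0).
  transitivity (1 + e * (y 0 1) ^+ 2 * E ^+ 2); last by field.
  by rewrite -vv; field.
Qed.

End ModelFunctions.

(** * Constant sectional curvature *)

Section ConstantCurvature.
Variable R : realType.
Implicit Types (x y p u v w : plane R) (U V N : set (plane R)) (f h : plane R -> R)
  (G : christoffel R) (b g : bilin_field R) (F : plane R -> plane R).

Lemma covariant_const G u w k :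
  covariant G (const_field u) (const_field w) k = fun y => \sum_i \sum_j u 0 i * w 0 j * G i j k y.
Proof.
apply/funext => y; rewrite /covariant [X in X + _]big1 ?add0r // => i _.
by rewrite pd_cst mulr0.
Qed.

Lemma curvature_const U G u v w k x : (forall i j k, smooth U (G i j k)) -> U x ->
  curvature G (const_field u) (const_field v) (const_field w) k x =
  (u 0 0 * v 0 1 - u 0 1 * v 0 0) * \sum_l w 0 l * riem G 0 1 l k x.
Proof.
move=> sG Ux.
have dC m (s t : plane R) : pd m (fun y => \sum_i \sum_j s 0 i * t 0 j * G i j k y) x =
    \sum_i \sum_j s 0 i * t 0 j * pd m (G i j k) x.
  have E : is_derive x 'e_m (fun y => \sum_i \sum_j s 0 i * t 0 j * G i j k y)
      (\sum_i \sum_j (0 * G i j k x + s 0 i * t 0 j * pd m (G i j k) x)).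
    apply: isd_sum => i; apply: isd_sum => j.
    exact: (isdM (isdC (s 0 i * t 0 j) x _) (smooth_is_derive m (sG i j k) Ux)).
  rewrite (is_derive_pd E); apply: eq_bigr => i _; apply: eq_bigr => j _.
  by rewrite mul0r add0r.
have L : covariant G (lie_bracket (const_field u) (const_field v)) (const_field w) k x = 0.
  have L0 i : lie_bracket (const_field u) (const_field v) i x = 0.
    by rewrite /lie_bracket big1 // => j _; rewrite !pd_cst !mulr0 subrr.
  rewrite /covariant !big1 ?addr0 // => i _; first by rewrite big1 // => j _; rewrite L0 !mul0r.
  by rewrite L0 mul0r.
rewrite /curvature L subr0 {1}/covariant [X in _ - X]/covariant.
under eq_bigr => i _ do rewrite covariant_const dC.
under [X in _ + X - _]eq_bigr => i _ do under eq_bigr => j _ do rewrite covariant_const.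
under [X in _ - (X + _)]eq_bigr => i _ do rewrite covariant_const dC.
under [X in _ - (_ + X)]eq_bigr => i _ do under eq_bigr => j _ do rewrite covariant_const.
rewrite /riem /const_field !sum2E; gen_pd; ring.
Qed.

Lemma area_sym g x u v : g 1 0 x = g 0 1 x ->
  bilin g x u u * bilin g x v v - bilin g x u v ^+ 2 =
  (g 0 0 x * g 1 1 x - g 0 1 x ^+ 2) * (u 0 0 * v 0 1 - u 0 1 * v 0 0) ^+ 2.
Proof. by move=> e; rewrite /bilin !sum2E e; ring. Qed.

(** In dimension two R(d_0, d_1) d_l is known from its products with d_0 and
    d_1. The sectional curvatures of the pairs (d_0, d_1), (d_1, d_0),
    (d_0 + d_1, d_1) and (d_0 + d_1, d_0) give these four numbers, and g is
    invertible. *)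
Lemma riem_of_sectional U G g (kappa : R) x : (forall i j k, smooth U (G i j k)) -> U x ->
  g 1 0 x = g 0 1 x -> g 0 0 x * g 1 1 x - g 0 1 x ^+ 2 != 0 ->
  (forall u v, bilin g x u u * bilin g x v v - bilin g x u v ^+ 2 != 0 ->
    sectional_curvature g G x u v = kappa) ->
  forall j k, riem G 0 1 j k x = kappa * g 1 j x * (k == 0)%:R - kappa * g 0 j x * (k == 1)%:R.
Proof.
move=> sG Ux gs D0 H.
set D := _ - _ in D0; set r := fun l k => riem G 0 1 l k x.
have K u v : u 0 0 * v 0 1 - u 0 1 * v 0 0 != 0 ->
    \sum_k \sum_i g k i x * (\sum_l v 0 l * r l k) * u 0 i =
    kappa * D * (u 0 0 * v 0 1 - u 0 1 * v 0 0).
  move=> d0; have A0 : bilin g x u u * bilin g x v v - bilin g x u v ^+ 2 != 0.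
    by rewrite area_sym // mulf_neq0 // expf_neq0.
  have := H u v A0; rewrite /sectional_curvature => /(congr1 (fun z => z * (D * (u 0 0 * v 0 1 - u 0 1 * v 0 0) ^+ 2))).
  rewrite area_sym // in A0 *; rewrite divfK // {1}/bilin.
  under eq_bigr => k _ do under eq_bigr => i _ do rewrite mxE (curvature_const _ _ _ _ sG Ux).
  move=> e; apply: (mulfI d0); rewrite -/D in e.
  rewrite [RHS](_ : _ = kappa * (D * (u 0 0 * v 0 1 - u 0 1 * v 0 0) ^+ 2)); last by ring.
  by rewrite -e /r !sum2E; move: (riem G 0 1) (u 0) (v 0) => *; ring.
have k1 := K (mkpt 1 0) (mkpt 0 1); have k2 := K (mkpt 0 1) (mkpt 1 0).
have k3 := K (mkpt 1 1) (mkpt 0 1); have k4 := K (mkpt 1 1) (mkpt 1 0).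
rewrite !mkpt0 !mkpt1 !sum2E !mkpt0 !mkpt1 gs in k1 k2 k3 k4.
have {}k1 : g 0 0 x * r 1 0 + g 0 1 x * r 1 1 = kappa * D.
  by rewrite [RHS](_ : _ = kappa * D * (1 * 1 - 0 * 0)); [rewrite -k1; [ring|lra]|ring].
have {}k2 : g 0 1 x * r 0 0 + g 1 1 x * r 0 1 = - (kappa * D).
  by rewrite [RHS](_ : _ = kappa * D * (0 * 0 - 1 * 1)); [rewrite -k2; [ring|lra]|ring].
have {}k3 : g 0 1 x * r 1 0 + g 1 1 x * r 1 1 = 0.
  by apply: (addrI (kappa * D)); rewrite addr0 -{1}k1 [RHS](_ : _ = kappa * D * (1 * 1 - 1 * 0)); [rewrite -k3; [ring|lra]|ring].
have {}k4 : g 0 0 x * r 0 0 + g 0 1 x * r 0 1 = 0.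
  by apply: (addrI (- (kappa * D))); rewrite addr0 -{1}k2 [RHS](_ : _ = kappa * D * (1 * 0 - 1 * 1)); [rewrite -k4; [ring|lra]|ring].
move=> j k; rewrite -/(r j k); apply: (mulfI D0).
elim/ord2P: j; elim/ord2P: k => /=; rewrite ?mulr1 ?mulr0 ?subr0 ?sub0r ?gs.
- transitivity (g 1 1 x * (g 0 0 x * r 0 0 + g 0 1 x * r 0 1) - g 0 1 x * (g 0 1 x * r 0 0 + g 1 1 x * r 0 1)).
    by rewrite /D; ring.
  by rewrite k4 k2; ring.
- transitivity (g 0 0 x * (g 0 1 x * r 0 0 + g 1 1 x * r 0 1) - g 0 1 x * (g 0 0 x * r 0 0 + g 0 1 x * r 0 1)).
    by rewrite /D; ring.
  by rewrite k4 k2; ring.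
- transitivity (g 1 1 x * (g 0 0 x * r 1 0 + g 0 1 x * r 1 1) - g 0 1 x * (g 0 1 x * r 1 0 + g 1 1 x * r 1 1)).
    by rewrite /D; ring.
  by rewrite k1 k3; ring.
- transitivity (g 0 0 x * (g 0 1 x * r 1 0 + g 1 1 x * r 1 1) - g 0 1 x * (g 0 0 x * r 1 0 + g 0 1 x * r 1 1)).
    by rewrite /D; ring.
  by rewrite k1 k3; ring.
Qed.

(** The trace of Z -> b(X,Y)Z - b(Z,Y)X is 2b - b. *)
Lemma ricci_curv_data U G b x i j : curv_data U G b -> U x -> ricci_sym G i j x = b i j x.
Proof.
move=> cd Ux; suff E k l : ricci G k l x = b k l x.
  by rewrite /ricci_sym !E (cd_bsym cd Ux j i); field.
rewrite /ricci sum2E !(curvature_const _ _ _ _ (cd_G cd) Ux) !sum2E !(cd_curv cd Ux) !mxE.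
by elim/ord2P: k; elim/ord2P: l; rewrite /= !mulr1n; ring.
Qed.

End ConstantCurvature.

(** * From the metric to its curvature form *)

Section Surfaces.
Variables (R : realType) (M : surface R).
Implicit Types (nabla : connection M) (g : sym2_tensor M) (phi : chart R M).

Lemma riemannian_positive g phi x : riemannian g -> atlas phi -> (chart_map phi @` source phi) x ->
  0 < g phi 0 0 x /\ 0 < g phi 0 0 x * g phi 1 1 x - g phi 0 1 x ^+ 2.
Proof.
move=> rg aphi Ux; have gs := entries_sym g aphi Ux 1 0.
have nz (v : plane R) : v 0 0 != 0 -> v != 0 by apply: contra_neq => ->; rewrite mxE.
have g0 : 0 < g phi 0 0 x.
  have := rg phi aphi x Ux (mkpt 1 0).
  rewrite /bilin !sum2E !mkpt0 !mkpt1 !(mulr0, mulr1, addr0); apply.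
  by apply: nz; rewrite mkpt0 oner_neq0.
split=> //; have [g00|g00] := boolP (g phi 0 1 x == 0).
  have := rg phi aphi x Ux (mkpt 0 1).
  rewrite /bilin !sum2E !mkpt0 !mkpt1 !(mulr0, mulr1, addr0, add0r) (eqP g00) expr0n /= subr0.
  move=> H; apply: mulr_gt0 => //; apply: H.
  by apply/eqP => /(congr1 (fun v : plane R => v 0 1)); rewrite mkpt1 mxE => /eqP; rewrite oner_eq0.
have := rg phi aphi x Ux (mkpt (- g phi 0 1 x) (g phi 0 0 x)).
rewrite /bilin !sum2E !mkpt0 !mkpt1 gs => H.
rewrite -(pmulr_rgt0 _ g0).
have /H : mkpt (- g phi 0 1 x) (g phi 0 0 x) != 0 by apply: nz; rewrite mkpt0 oppr_eq0.
by congr (0 < _); ring.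
Qed.

(** The Gram determinant of the two given vectors is negative, and it is the
    determinant of g times a square. *)
Lemma lorentzian_negative g phi x : lorentzian g -> atlas phi -> (chart_map phi @` source phi) x ->
  g phi 0 0 x * g phi 1 1 x - g phi 0 1 x ^+ 2 < 0.
Proof.
move=> lg aphi Ux; have gs := entries_sym g aphi Ux 1 0.
have [v [w [vw vv ww]]] := lg phi aphi x Ux.
have := area_sym v w gs; rewrite vw expr0n /= subr0 => e.
have : bilin (g phi) x v v * bilin (g phi) x w w < 0 by rewrite nmulr_rlt0.
rewrite e; case: (ltrP (g phi 0 0 x * g phi 1 1 x - g phi 0 1 x ^+ 2) 0) => // d.
by rewrite ltNge mulr_ge0 // sqr_ge0.
Qed.

Lemma chart_curv_data nabla g (kappa : R) phi : riemannian g \/ lorentzian g ->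
  levi_civita g nabla -> constant_sectional_curvature g nabla kappa -> kappa != 0 -> atlas phi ->
  curv_data (chart_map phi @` source phi) (nabla phi) (fun i j x => kappa * g phi i j x).
Proof.
move=> rl lc csc k0 aphi.
have D0 x : (chart_map phi @` source phi) x -> g phi 0 0 x * g phi 1 1 x - g phi 0 1 x ^+ 2 != 0.
  move=> Ux; case: rl => [rg|lg]; first by have [_] := riemannian_positive rg aphi Ux; rewrite lt0r => /andP[].
  by rewrite lt_eqF // (lorentzian_negative lg aphi Ux).
split.
- exact: target_open.
- exact: symbols_smooth.
- by move=> x Ux i j k; exact: symbols_torsion_free.
- move=> i j; apply: smooth_mul; [exact: target_open|exact: smooth_cst|exact: entries_smooth].
- by move=> x Ux i j; rewrite (entries_sym g aphi Ux i j).
- move=> x Ux k i j.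
  have := is_derive_pd (isdM (isdC kappa x _) (smooth_is_derive k (entries_smooth g aphi i j) Ux)).
  move=> ->; rewrite mul0r add0r (lc phi aphi x Ux) mulr_sumr.
  by apply: eq_bigr => l _; rewrite mulrDr !(mulrCA kappa).
- move=> x Ux; have := mulf_neq0 (mulf_neq0 k0 k0) (D0 x Ux); apply: contra_neq => e.
  by rewrite -[RHS]e (entries_sym g aphi Ux 1 0); ring.
- move=> x Ux; apply: (@riem_of_sectional _ (chart_map phi @` source phi)) => //; first exact: symbols_smooth.
  + exact: entries_sym.
  + exact: D0.
  + exact: csc.
Qed.

End Surfaces.

(** * Charts and local to global arguments *)

(** Coefficients that exist locally and are locally unique are globally constant
    on a connected set: for every a, the set of points near which Q a holds is
    open. *)
Lemma locally_constant_constant (T : topologicalType) (K : pointedType) (S : set T) (Q : K -> T -> Prop) :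
  connected S -> (forall p, S p -> exists a, \forall q \near p, Q a q) ->
  (forall p a a', S p -> (\forall q \near p, Q a q) -> (\forall q \near p, Q a' q) -> a = a') ->
  exists a, forall p, S p -> Q a p.
Proof.
move=> cS ex uni.
have [[p0 Sp0]|S0] := pselect (exists p, S p); last first.
  by exists point => p Sp; case: S0; exists p.
have [a0 H0] := ex p0 Sp0; exists a0.
pose near_good a : set T := [set p : T | \forall q \near p, Q a q].
have og a : open (near_good a) by exact: (open_interior [set q | Q a q]).
suff E : S `&` near_good a0 = S.
  by move=> p; rewrite -E => -[_]; exact: nbhs_singleton.
apply: cS; first by exists p0.
  by exists (near_good a0).
exists (~` [set p | exists2 a, a <> a0 & near_good a p]).
  apply: open_closedC; rewrite openE => p [a aa0 ap].
  have ga : nbhs p (near_good a) by exact: open_nbhs_nbhs (conj (og a) ap).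
  by rewrite /interior; apply: filterS ga => q gq; exists a.
apply/seteqP; split=> p [Sp]; first by move=> gp; split=> // -[a aa0 ga]; exact/aa0/(uni p).
move=> ng; split=> //; have [a ga] := ex p Sp.
by have [<-//|aa0] := pselect (a = a0); case: ng; exists a.
Qed.

Section ChartTopology.
Variables (R : realType) (M : topologicalType).
Implicit Types (phi psi : chart R M) (x y z : plane R) (W : set M) (N : set (plane R)).

Lemma chart_invK phi x : (chart_map phi @` source phi) x ->
  source phi (chart_inv phi x) /\ chart_map phi (chart_inv phi x) = x.
Proof. by move=> [p sp <-]; rewrite chart_mapK. Qed.

Lemma chart_imageE phi W : chart_map phi @` (source phi `&` W) =
  [set x | (chart_map phi @` source phi) x /\ W (chart_inv phi x)].
Proof.
apply/seteqP; split=> x; first by move=> [p [sp Wp] <-]; split; [exists p|rewrite chart_mapK].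
by move=> [tx Wx]; have [sx e] := chart_invK tx; exists (chart_inv phi x).
Qed.

Lemma chart_image_open phi W : open W -> open (chart_map phi @` (source phi `&` W)).
Proof.
move=> oW; rewrite chart_imageE openE => x [tx Wx].
rewrite /interior; have ot := @target_open _ _ phi; rewrite openE in ot; have nt := ot _ tx.
rewrite openE in oW; have := chart_inv_continuous tx (oW _ Wx) => nW.
exact: filterI nt nW.
Qed.

Lemma chart_preimage_open phi N : open N -> open (source phi `&` chart_map phi @^-1` N).
Proof.
move=> oN; rewrite openE => p [sp Np].
rewrite /interior; have os := @source_open _ _ phi; rewrite openE in os; have ns := os _ sp.
rewrite openE in oN; have nN := chart_map_continuous sp (oN _ Np).
exact: filterI ns nN.
Qed.

Lemma overlap_open phi psi : open (overlap phi psi).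
Proof. exact/chart_image_open/source_open. Qed.

Lemma overlapP phi psi x : overlap phi psi x <->
  (chart_map phi @` source phi) x /\ source psi (chart_inv phi x).
Proof. by rewrite /overlap chart_imageE. Qed.

Lemma overlap_target phi psi : overlap phi psi `<=` chart_map phi @` source phi.
Proof. by move=> x /overlapP[]. Qed.

Lemma overlap_source phi psi p : source phi p -> source psi p -> overlap phi psi (chart_map phi p).
Proof. by move=> sp tp; exists p. Qed.

Lemma transition_overlap phi psi x : overlap phi psi x -> overlap psi phi (transition phi psi x).
Proof. by move=> [p [sp tp] <-]; rewrite /transition chart_mapK //; exists p. Qed.

Lemma transitionE phi psi p : source phi p -> transition phi psi (chart_map phi p) = chart_map psi p.
Proof. by move=> sp; rewrite /transition chart_mapK. Qed.

Lemma transitionK phi psi x : overlap phi psi x -> transition psi phi (transition phi psi x) = x.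
Proof. by move=> [p [sp tp] <-]; rewrite !transitionE. Qed.

(** Passes between germs at a point of the surface, read in psi, and germs in the
    chart phi. *)
Lemma transition_near phi psi (P : plane R -> Prop) p : source phi p -> source psi p ->
  (\forall y \near chart_map phi p, P (transition phi psi y)) <->
  (\forall q \near p, P (chart_map psi q)).
Proof.
move=> sp tp; split=> H.
  have ns : nbhs p (source phi) by exact: open_nbhs_nbhs (conj (source_open phi) sp).
  apply: filterS2 ns (chart_map_continuous sp H) => q sq /=.
  by rewrite transitionE.
have tx : (chart_map phi @` source phi) (chart_map phi p) by exists p.
have c := chart_inv_continuous tx.
by apply: (c (fun q => P (chart_map psi q))); rewrite chart_mapK.
Qed.

(** A chart followed by a homeomorphism between open sets of the plane. *)
Lemma recoordinate phi N F (G : plane R -> plane R) : open N -> N `<=` chart_map phi @` source phi ->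
  open (F @` N) -> (forall y, N y -> G (F y) = y) ->
  (forall y, N y -> {for y, continuous F}) -> (forall z, (F @` N) z -> {for z, continuous G}) ->
  exists c : chart R M, [/\ source c = source phi `&` chart_map phi @^-1` N,
    chart_map c = F \o chart_map phi & chart_inv c = chart_inv phi \o G].
Proof.
move=> oN Nt oF GF cF cG.
have tE : (F \o chart_map phi) @` (source phi `&` chart_map phi @^-1` N) = F @` N.
  apply/seteqP; split=> z; first by move=> [p [sp Np] <-]; exists (chart_map phi p).
  by move=> [y Ny <-]; have [p sp e] := Nt _ Ny; exists p; rewrite /= e //; split=> //=; rewrite e.
have o1 : open ((F \o chart_map phi) @` (source phi `&` chart_map phi @^-1` N)) by rewrite tE.
have k1 p : (source phi `&` chart_map phi @^-1` N) p ->
    (chart_inv phi \o G) ((F \o chart_map phi) p) = p.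
  by move=> [sp Np] /=; rewrite GF // chart_mapK.
have c1 p : (source phi `&` chart_map phi @^-1` N) p -> {for p, continuous (F \o chart_map phi)}.
  move=> [sp Np]; apply: continuous_comp; first exact: chart_map_continuous.
  exact: cF.
have c2 z : ((F \o chart_map phi) @` (source phi `&` chart_map phi @^-1` N)) z ->
    {for z, continuous (chart_inv phi \o G)}.
  rewrite tE => Nz; apply: continuous_comp; first exact: cG.
  by move: Nz => [y Ny <-]; rewrite GF //; exact/chart_inv_continuous/Nt.
by exists (Chart (chart_preimage_open phi oN) o1 k1 c1 c2).
Qed.

End ChartTopology.

Arguments chart_image_open {R M} phi W.
Arguments overlap_open {R M} phi psi.

Lemma hessian_cst (R : realType) (G : christoffel R) (c : R) i j x : hessian G (fun=> c) i j x = 0.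
Proof.
have p0 k : pd k (fun _ : plane R => c) = fun=> 0 by apply/funext => y; exact: pd_cst.
by rewrite /hessian p0 pd_cst big1 ?subr0 // => k _; rewrite p0 mulr0.
Qed.

(** * Affine charts and the spaces E(mu) *)

Section AffineCharts.
Variables (R : realType) (M : surface R) (nabla : connection M) (b : chart R M -> bilin_field R).
Hypothesis cdb : forall phi, atlas phi -> curv_data (chart_map phi @` source phi) (nabla phi) (b phi).
Implicit Types (phi psi c : chart R M) (x y z : plane R) (W : set M) (N : set (plane R)).

(** The transition in the other direction is an inverse. *)
Lemma transition_jac phi psi x : compatible phi psi -> overlap phi psi x ->
  jac (transition phi psi) x != 0.
Proof.
move=> [s1 s2] ox.
have := jac_comp (overlap_open phi psi) (overlap_open psi phi) (@transition_overlap _ _ phi psi) s1 s2 ox.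
rewrite (jac_eq_on (H := id) (overlap_open phi psi) _ ox); last first.
  by move=> y; rewrite inE => oy; rewrite /= transitionK.
rewrite {1}/jac !pd_coord /= mulr0 subr0 mulr1 => /esym e.
by apply/eqP => e0; move: e; rewrite e0 mulr0 => /esym/eqP; rewrite oner_eq0.
Qed.

(** The map of [local_coordinates] is restricted to a neighbourhood where it is
    invertible and composed with a chart of the atlas; compatibility with the
    other charts is that of the atlas. *)
Lemma affine_chart_exists (m : plane_model R) bm Phi D a1 a2 phi p al be :
  embedded_model (model_domain m) (model_symbols m) bm Phi ->
  quadric_model (model_domain m) bm Phi D a1 a2 ->
  atlas phi -> source phi p -> frame (b phi) bm (chart_map phi p) al be ->
  exists2 c, affine_coordinates nabla m c & source c p.
Proof.
move=> em qm aphi sp fr.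
have cd := cdb aphi.
have Up : (chart_map phi @` source phi) (chart_map phi p) by exists p.
have [N0 [F [[oN0 N0p N0U] sF0 N0V iF0 jF]]] := local_coordinates em qm cd Up fr.
have [N [G [[oN Np NN0] oF GF cG sG]]] := inverse_function oN0 N0p sF0 jF.
have sF : smooth_map N F by move=> k; exact: smooth_sub (sF0 k).
have iF : intertwines N (nabla phi) (model_symbols m) F := intertwines_sub NN0 iF0.
have NU : N `<=` chart_map phi @` source phi by move=> y /NN0 /N0U.
have cF y : N y -> {for y, continuous F} by exact: smooth_map_continuous sF.
have [c [sc mc ic]] := recoordinate oN NU oF GF cF cG.
exists c; last by rewrite sc.
have tc : chart_map c @` source c `<=` F @` N.
  by move=> z [q]; rewrite sc mc => -[sq Nq] <-; exists (chart_map phi q).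
have o1 psi : overlap psi c `<=` overlap psi phi.
  by move=> x [q [sq]]; rewrite sc => -[tq Nq] <-; exists q.
have toN psi x : overlap psi c x -> N (transition psi phi x).
  by move=> [q [sq]]; rewrite sc => -[tq Nq] <-; rewrite transitionE.
have tr psi : transition psi c = F \o transition psi phi.
  by apply/funext => x; rewrite /transition mc.
have rt psi : transition c psi = transition phi psi \o G.
  by apply/funext => x; rewrite /transition ic.
have toO psi z : overlap c psi z -> overlap phi psi (G z).
  by move=> [q []]; rewrite sc mc => -[tq Nq] sq <- /=; rewrite GF //; exists q.
have cmp psi := atlas_compatible aphi (psi := psi).
split.
- by move=> z /tc[y Ny <-]; exact/N0V/NN0.
- move=> psi apsi; have [s1 s2] := cmp psi apsi; split=> k.
    rewrite tr; apply: (smooth_comp (overlap_open psi c) oN (toN psi) (sF k)) => l.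
    exact: smooth_sub (o1 psi) (s2 l).
  rewrite rt; apply: (smooth_comp (overlap_open c psi) (overlap_open phi psi) (toO psi) (s1 k)) => l.
  apply: smooth_sub (sG l) => z /overlap_target; exact: tc.
- move=> psi apsi; have [s1 s2] := cmp psi apsi; rewrite tr.
  apply: (intertwines_comp (overlap_open psi c) oN (toN psi) _ sF _ iF).
    by move=> l; exact: smooth_sub (o1 psi) (s2 l).
  exact: intertwines_sub (o1 psi) (symbols_transform nabla apsi aphi).
Qed.

Lemma E_hess W mu f phi : E nabla W mu f -> atlas phi ->
  smooth (chart_map phi @` (source phi `&` W)) (f \o chart_inv phi) /\
  hess_eq (chart_map phi @` (source phi `&` W)) (nabla phi) (f \o chart_inv phi)
    (fun i j x => mu * b phi i j x).
Proof.
move=> [sf Hf] aphi; split; first exact: sf.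
move=> _ [p [sp Wp] <-] i j; rewrite (Hf phi aphi p sp Wp) /= chart_mapK //.
rewrite (ricci_curv_data _ _ (cdb aphi)); last by exists p.
by ring.
Qed.

Lemma hess_E W mu f : (forall phi, atlas phi ->
  smooth (chart_map phi @` (source phi `&` W)) (f \o chart_inv phi) /\
  hess_eq (chart_map phi @` (source phi `&` W)) (nabla phi) (f \o chart_inv phi)
    (fun i j x => mu * b phi i j x)) -> E nabla W mu f.
Proof.
move=> H; split=> [phi /H[]//|phi aphi p sp Wp i j].
have [_ ->] := H phi aphi; last by exists p.
rewrite /= chart_mapK // (ricci_curv_data _ _ (cdb aphi)); last by exists p.
by ring.
Qed.

(** Locally an element of E(-1) is a combination of the functions of the model by
    [solution_is_model_function], with unique coefficients by
    [model_functions_free], so the coefficients are constant on the connected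
    source. *)
Lemma model_span (m : plane_model R) bm Phi c f :
  embedded_model (model_domain m) (model_symbols m) bm Phi ->
  affine_coordinates nabla m c -> connected (source c) ->
  E nabla (source c) (-1) f <->
  exists a : 'rV[R]_3, forall p, source c p -> f p = \sum_k a 0 k * Phi k (chart_map c p).
Proof.
move=> em [tV cmp itw] cc.
have toV phi x : overlap phi c x -> model_domain m (transition phi c x).
  by move=> /transition_overlap/overlap_target/tV.
have mN (B : bilin_field R) : (fun i j x => -1 * B i j x) = (fun i j x => - B i j x).
  by apply/funext => i; apply/funext => j; apply/funext => x; rewrite mulN1r.
split=> [Ef|[a Ha]].
- apply: (@locally_constant_constant _ 'rV[R]_3 _
      (fun a p => f p = \sum_k a 0 k * Phi k (chart_map c p)) cc).
    move=> p cp; have [phi aphi sp] := atlas_cover p.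
    have [sf Hf] := E_hess Ef aphi; rewrite mN in Hf.
    have [s1 _] := cmp phi aphi.
    have [a Ha] := solution_is_model_function em (cdb aphi) (overlap_open phi c)
      (@overlap_target _ _ phi c) s1 (toV phi) (itw phi aphi)
      (fun x ox => transition_jac (cmp phi aphi) ox) sf Hf (overlap_source sp cp).
    exists a; have ns : nbhs p (source phi) by exact: open_nbhs_nbhs (conj (source_open phi) sp).
    apply: filterS2 ns (chart_map_continuous sp Ha) => q sq /=.
    by rewrite chart_mapK // transitionE.
  move=> p a a' cp Ha Ha'; have [phi aphi sp] := atlas_cover p.
  have [s1 _] := cmp phi aphi; apply/eqP; rewrite -subr_eq0; apply/eqP.
  apply: (model_functions_free em (overlap_open phi c) s1 (toV phi) (overlap_source sp cp)
    (transition_jac (cmp phi aphi) (overlap_source sp cp))).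
  apply/(@transition_near _ _ _ _ (fun z => \sum_k (a - a') 0 k * Phi k z = 0) _ sp cp).
  apply: filterS2 Ha Ha' => q e e'.
  under eq_bigr => k _ do rewrite !mxE mulrBl.
  by rewrite sumrB -e -e' subrr.
- apply: hess_E => phi aphi; rewrite mN.
  have [s1 _] := cmp phi aphi; have oO := overlap_open phi c.
  have E : {in overlap phi c, (fun y => \sum_k a 0 k * (Phi k \o transition phi c) y) =1 f \o chart_inv phi}.
    move=> y; rewrite inE => /overlapP[ty cy] /=.
    by rewrite Ha.
  have sP k : smooth (overlap phi c) (Phi k \o transition phi c).
    exact: smooth_comp oO (em_open em) (toV phi) (em_smooth em k) s1.
  split.
    apply: (smooth_eq oO E); apply: smooth_sum => // k.
    by apply: smooth_mul => //; exact: smooth_cst.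
  apply: (hess_eq_ext oO E); apply: hess_lincomb => // k.
  exact: (model_functions_hess em (cdb aphi) oO (@overlap_target _ _ phi c) s1 (toV phi) (itw phi aphi)
    (fun x ox => transition_jac (cmp phi aphi) ox)).
Qed.

Lemma rigid_zero_gradient W mu f phi : open W -> mu != -1 -> E nabla W mu f -> atlas phi ->
  forall x, (chart_map phi @` (source phi `&` W)) x -> forall i, pd i (f \o chart_inv phi) x = 0.
Proof.
move=> oW mu1 Ef aphi; have [sf Hf] := E_hess Ef aphi.
have sub : chart_map phi @` (source phi `&` W) `<=` chart_map phi @` source phi.
  by move=> x [p [sp _] <-]; exists p.
exact: (rigid_gradient (curv_data_sub (chart_image_open phi _ oW) sub (cdb aphi)) sf mu1 Hf).
Qed.

Lemma E0_constants W : open W -> connected W -> E nabla W 0 = span_on W [:: fun=> 1].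
Proof.
move=> oW cW; apply/seteqP; split=> f.
- move=> Ef; suff [a Ha] : exists a, forall p, W p -> f p = a.
    by exists (fun=> a) => p /Ha ->; rewrite big_ord1 mulr1.
  apply: (@locally_constant_constant _ R _ (fun a p => f p = a) cW); last first.
    by move=> p a a' Wp /nbhs_singleton <- /nbhs_singleton.
  move=> p Wp; have [phi aphi sp] := atlas_cover p; exists (f p).
  have oO := chart_image_open phi _ oW.
  have ox : (chart_map phi @` (source phi `&` W)) (chart_map phi p) by exists p.
  have [d d0 dO] := open_ball oO ox.
  have [sf _] := E_hess Ef aphi.
  have mu1 : (0 : R) != -1 by rewrite eq_sym oppr_eq0 oner_eq0.
  have H y : ball (chart_map phi p) d y -> (f \o chart_inv phi) y = f p.
    move=> yd; rewrite -[in RHS](chart_mapK sp); apply: (pd_zero_cst _ _ yd).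
      by move=> z /dO Oz i; exact: smooth_derivable sf Oz.
    by move=> z i /dO Oz; exact: (rigid_zero_gradient oW mu1 Ef aphi Oz).
  have ns : nbhs p (source phi) by exact: open_nbhs_nbhs (conj (source_open phi) sp).
  have nb : nbhs (chart_map phi p) (ball (chart_map phi p) d) by exact: nbhsx_ballx.
  apply: filterS2 ns (chart_map_continuous sp nb) => q sq /= /H /=.
  by rewrite chart_mapK.
- move=> [a Ha]; apply: hess_E => phi aphi; have oO := chart_image_open phi _ oW.
  have e : {in chart_map phi @` (source phi `&` W), (fun=> a 0%N) =1 f \o chart_inv phi}.
    by move=> x; rewrite inE chart_imageE => -[_ Wx] /=; rewrite Ha // big_ord1 mulr1.
  split; first exact: (smooth_eq oO e (smooth_cst _ _)).
  apply: (hess_eq_ext oO e) => x Ox i j.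
  by rewrite hessian_cst mul0r mulr0.
Qed.

Lemma E_trivial W mu : open W -> mu != -1 -> mu != 0 ->
  E nabla W mu = [set f | forall p, W p -> f p = 0].
Proof.
move=> oW mu1 mu0; apply/seteqP; split=> f.
- move=> Ef p Wp; have [phi aphi sp] := atlas_cover p.
  have oO := chart_image_open phi _ oW.
  have ox : (chart_map phi @` (source phi `&` W)) (chart_map phi p) by exists p.
  have [_ Hf] := E_hess Ef aphi; have g0 := rigid_zero_gradient oW mu1 Ef aphi.
  have H i j : f p * b phi i j (chart_map phi p) = 0.
    have := Hf _ ox i j; rewrite /hessian big1 ?subr0; last first.
      by move=> k _; rewrite g0 // mulr0.
    rewrite (pd_eq_on (g := fun=> 0) i oO _ ox); last by move=> y; rewrite inE => Oy; exact: g0.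
    rewrite pd_cst /= chart_mapK // => /esym e.
    by apply: (mulfI mu0); rewrite mulr0 -[RHS]e; ring.
  have D0 : b phi 0 0 (chart_map phi p) * b phi 1 1 (chart_map phi p) -
      b phi 0 1 (chart_map phi p) * b phi 1 0 (chart_map phi p) != 0.
    by apply: (cd_det (cdb aphi)); exists p.
  by apply: (mulIf D0); rewrite mul0r mulrBr !mulrA !H !mul0r subrr.
- move=> f0; apply: hess_E => phi aphi; have oO := chart_image_open phi _ oW.
  have e : {in chart_map phi @` (source phi `&` W), (fun=> 0) =1 f \o chart_inv phi}.
    by move=> x; rewrite inE chart_imageE => -[_ Wx] /=; rewrite f0.
  split; first exact: (smooth_eq oO e (smooth_cst _ _)).
  apply: (hess_eq_ext oO e) => x Ox i j.
  by rewrite hessian_cst mul0r.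
Qed.

End AffineCharts.

(** * Choice of the model and conclusion *)

Section NormalForms.
Variables (R : realType) (M : surface R) (nabla : connection M) (b : chart R M -> bilin_field R).
Hypothesis cdb : forall phi, atlas phi -> curv_data (chart_map phi @` source phi) (nabla phi) (b phi).
Implicit Types (phi c : chart R M).

Lemma frame_intro (b0 bm : bilin_field R) p (a0 a1 c0 c1 : R) : b0 1 0 p = b0 0 1 p ->
  b0 0 0 p = bm 0 0 0 * (a0 * a0) + bm 1 1 0 * (c0 * c0) ->
  b0 0 1 p = bm 0 0 0 * (a0 * a1) + bm 1 1 0 * (c0 * c1) ->
  b0 1 1 p = bm 0 0 0 * (a1 * a1) + bm 1 1 0 * (c1 * c1) ->
  exists al be, frame b0 bm p al be.
Proof.
move=> bs e00 e01 e11.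
exists (fun i => if i == 0 then a0 else a1), (fun i => if i == 0 then c0 else c1) => i j.
by elim/ord2P: i; elim/ord2P: j; rewrite /= ?bs ?e00 ?e01 ?e11 //; ring.
Qed.

Lemma locally_model (m : plane_model R) bm Phi D a1 a2 :
  embedded_model (model_domain m) (model_symbols m) bm Phi ->
  quadric_model (model_domain m) bm Phi D a1 a2 ->
  (forall phi x, atlas phi -> (chart_map phi @` source phi) x -> exists al be, frame (b phi) bm x al be) ->
  locally_affine_isomorphic nabla m.
Proof.
move=> em qm fr p; have [phi aphi sp] := atlas_cover p.
have [|al [be F]] := fr phi (chart_map phi p) aphi; first by exists p.
exact: (affine_chart_exists cdb em qm aphi sp F).
Qed.

Lemma E_span (m : plane_model R) bm Phi c (h0 h1 h2 : M -> R) :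
  embedded_model (model_domain m) (model_symbols m) bm Phi ->
  affine_coordinates nabla m c -> connected (source c) ->
  (forall p, [/\ Phi 0 (chart_map c p) = h0 p, Phi 1 (chart_map c p) = h1 p &
    Phi ord_max (chart_map c p) = h2 p]) ->
  E nabla (source c) (-1) = span_on (source c) [:: h0; h1; h2].
Proof.
move=> em ac cc Hh; apply/seteqP; split=> f.
  move/(model_span cdb f em ac cc) => [a Ha].
  exists (fun i => a 0 (inord i)) => p cp; have [e0 e1 e2] := Hh p.
  rewrite Ha // !sum3E e0 e1 e2 /=; congr (a 0 _ * _ + (a 0 _ * _ + a 0 _ * _));
    by apply/val_inj; rewrite /= inordK.
move=> [a Ha]; apply/(model_span cdb f em ac cc); exists (\row_i a i) => p cp.
by have [e0 e1 e2] := Hh p; rewrite Ha // !sum3E e0 e1 e2 !mxE.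
Qed.

Lemma sphere_case : (forall phi x, atlas phi -> (chart_map phi @` source phi) x ->
    0 < b phi 0 0 x /\ 0 < b phi 0 0 x * b phi 1 1 x - b phi 0 1 x ^+ 2) ->
  locally_affine_isomorphic nabla (S2 R) /\
  forall c, affine_coordinates nabla (S2 R) c -> connected (source c) ->
  E nabla (source c) (-1) = span_on (source c)
    [:: fun p => sin (chart_map c p 0 0);
        fun p => cos (chart_map c p 0 0) * cos (chart_map c p 0 1);
        fun p => cos (chart_map c p 0 0) * sin (chart_map c p 0 1)].
Proof.
move=> pos; split.
  apply: (locally_model (embedded_S2 R) (quadric_S2 R)) => phi x aphi Ux.
  have [b0 D0] := pos phi x aphi Ux.
  have [u0 [u1 [v0 [v1 [e00 e01 e11]]]]] := definite_frame b0 D0.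
  apply: (@frame_intro _ _ _ u0 u1 v0 v1); rewrite ?(cd_bsym (cdb aphi) Ux 1 0) //;
    by rewrite /S2_metric /= mxE cos0 !mul1r.
move=> c ac cc; apply: (E_span (embedded_S2 R) ac cc) => p.
by rewrite /S2_functions /sep2 /one /zero /= !mul0r !mulr1 !addr0.
Qed.

Lemma hyperbolic_case (eps : R) : eps = 1 \/ eps = -1 ->
  (forall phi x, atlas phi -> (chart_map phi @` source phi) x ->
    exists a0 a1 c0 c1 : R, [/\ b phi 0 0 x = - (a0 * a0) - eps * (c0 * c0),
      b phi 0 1 x = - (a0 * a1) - eps * (c0 * c1) & b phi 1 1 x = - (a1 * a1) - eps * (c1 * c1)]) ->
  locally_affine_isomorphic nabla (H2 eps) /\
  forall c, affine_coordinates nabla (H2 eps) c -> connected (source c) ->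
  E nabla (source c) (-1) = span_on (source c)
    [:: fun p => expR (chart_map c p 0 0);
        fun p => chart_map c p 0 1 * expR (chart_map c p 0 0);
        fun p => expR (- chart_map c p 0 0) + eps * chart_map c p 0 1 ^+ 2 * expR (chart_map c p 0 0)].
Proof.
move=> eps1 fr; have ee : eps * eps = 1 by case: eps1 => ->; rewrite ?mulr1 ?mulrNN ?mulr1.
have em := embedded_H2 ee; split.
  apply: (locally_model em (quadric_H2 eps)) => phi x aphi Ux.
  have [u0 [u1 [v0 [v1 [e00 e01 e11]]]]] := fr phi x aphi Ux.
  apply: (@frame_intro _ _ _ u0 u1 v0 v1); rewrite ?(cd_bsym (cdb aphi) Ux 1 0) //;
    rewrite ?e00 ?e01 ?e11 /H2_metric /= mxE mulr0 expR0; ring.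
move=> c ac cc; apply: (E_span em ac cc) => p.
by rewrite /H2_functions /sep2 /one /zero /expN /csq /=; split; rewrite ?mul0r ?mulr1 ?addr0 // mulrC ?expr2.
Qed.

End NormalForms.

Theorem theorem4p7 (R : realType) (M : surface R) (nabla : connection M)
    (typeC : nonflat_typeC nabla) :
  (   (locally_affine_isomorphic nabla (S2 R) /\
       forall c : chart R M, affine_coordinates nabla (S2 R) c ->
         connected (source c) ->
         let x1 := fun p => chart_map c p 0 0 in
         let x2 := fun p => chart_map c p 0 1 in
         E nabla (source c) (-1) =
         span_on (source c)
           [:: fun p => sin (x1 p);
               fun p => cos (x1 p) * cos (x2 p);
               fun p => cos (x1 p) * sin (x2 p)])
   \/
      (exists eps : R,
       [/\ eps = 1 \/ eps = -1,
           locally_affine_isomorphic nabla (H2 eps)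
         & forall c : chart R M, affine_coordinates nabla (H2 eps) c ->
             connected (source c) ->
             let x1 := fun p => chart_map c p 0 0 in
             let x2 := fun p => chart_map c p 0 1 in
             E nabla (source c) (-1) =
             span_on (source c)
               [:: fun p => expR (x1 p);
                   fun p => x2 p * expR (x1 p);
                   fun p => expR (- x1 p)
                            + eps * (x2 p) ^+ 2 * expR (x1 p)]]))
  /\
  (forall W : set M, open W -> connected W ->
     E nabla W 0 = span_on W [:: fun=> 1] /\
     forall mu : R, mu != -1 -> mu != 0 ->
       E nabla W mu = [set f | forall p, W p -> f p = 0]).
Proof.

have [_ [g [kappa [rl lc csc k0]]]] := typeC.
have cdb phi := chart_curv_data (phi := phi) rl lc csc k0.
split; last first.
  move=> W oW cW; split; first exact: (E0_constants cdb).
  by move=> mu; exact: (E_trivial cdb).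
have scale (k b00 b01 b11 : R) : k * b00 * (k * b11) - (k * b01) ^+ 2 =
    k ^+ 2 * (b00 * b11 - b01 ^+ 2) by ring.
have k2 : 0 < kappa ^+ 2 by rewrite exprn_even_gt0.
case: rl => [rg|lg].
  have [kp|kn] := ltrP 0 kappa.
    left; apply: (sphere_case cdb) => phi x aphi Ux.
    have [g0 D0] := riemannian_positive rg aphi Ux.
    by rewrite scale !pmulr_rgt0.
  have {}kn : 0 < - kappa by rewrite oppr_gt0 lt_neqAle k0.
  right; exists 1; have [|L S] := hyperbolic_case cdb (or_introl (erefl 1)); last by split=> //; left.
  move=> phi x aphi Ux; have [g0 D0] := riemannian_positive rg aphi Ux.
  have [||u0 [u1 [v0 [v1 [e00 e01 e11]]]]] :=
      @definite_frame _ (- kappa * g phi 0 0 x) (- kappa * g phi 0 1 x) (- kappa * g phi 1 1 x).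
  - by rewrite pmulr_rgt0.
  - by rewrite scale sqrrN pmulr_rgt0.
  exists u0, u1, v0, v1.
  by rewrite !mul1r -!opprD -e00 -e01 -e11 !mulNr !opprK.
right; exists (-1); have [|L S] := hyperbolic_case cdb (or_intror (erefl (-1))); last by split=> //; right.
move=> phi x aphi Ux; have D0 := lorentzian_negative lg aphi Ux.
have [|u0 [u1 [v0 [v1 [e00 e01 e11]]]]] :=
    @lorentz_frame _ (kappa * g phi 0 0 x) (kappa * g phi 0 1 x) (kappa * g phi 1 1 x).
  by rewrite scale pmulr_rlt0.
by exists u0, u1, v0, v1; rewrite !mulN1r !opprK.
Qed.
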